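(* Let $n\geq 4$ be an integer, let $p$ be a real number with $1<p<n-1$, let $\Phi\in\mathbb{S}^{n-1}$ and let $d$ denote the geodesic distance from $\Phi$ on $\mathbb{S}^{n-1}$. Let $u\in W^{1,p}(\mathbb{S}^{n-1}\to\mathbb{R})$. Then $\frac{u}{\sin d}\in L^{p}(\mathbb{S}^{n-1})$ when $1<p<n-1$, and $\frac{u}{|\tan d|}\in L^{p}(\mathbb{S}^{n-1})$ when $2\leq p<n-1$. Moreover, with $\alpha_{n,p}:=\frac{n-p-1}{p}$, $$\alpha_{n,p}^{p}\int_{\mathbb{S}^{n-1}}\frac{|u|^{p}}{\sin^{p}d}\,d\sigma_{n-1}\;\leq\;\int_{\mathbb{S}^{n-1}}|\nabla_{\mathbb{S}^{n-1}}u|^{p}\,|\cos d|^{p}\,d\sigma_{n-1}+(n-p)\,\alpha_{n,p}^{p-1}\int_{\mathbb{S}^{n-1}}\frac{|u|^{p}}{\sin^{p-2}d}\,d\sigma_{n-1}\qquad\text{for }1<p<n-1,$$ and $$\alpha_{n,p}^{p}\int_{\mathbb{S}^{n-1}}\frac{|u|^{p}}{|\tan d|^{p}}\,d\sigma_{n-1}\;\leq\;\int_{\mathbb{S}^{n-1}}|\nabla_{\mathbb{S}^{n-1}}u|^{p}\,d\sigma_{n-1}+(p-1)\,\alpha_{n,p}^{p-1}\int_{\mathbb{S}^{n-1}}\frac{|u|^{p}}{|\tan d|^{p-2}}\,d\sigma_{n-1}\qquad\text{for }2\leq p<n-1.$$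
   Context: $\mathbb{S}^{n-1}$ is the unit sphere in $\mathbb{R}^{n}$ with surface measure $\sigma_{n-1}$ and the Riemannian metric induced from $\mathbb{R}^n$. For a fixed point $\Phi\in\mathbb{S}^{n-1}$, the geodesic distance from $\Phi$ is $d(\Theta)=d(\Theta,\Phi):=\arccos(\Theta\cdot\Phi)\in[0,\pi]$, $\Theta\in\mathbb{S}^{n-1}$, where $\cdot$ is the Euclidean inner product. $\nabla_{\mathbb{S}^{n-1}}$ is the (weak) surface gradient: for $f\in L^1(\mathbb{S}^{n-1})$ it is the tangential $L^1$ vector field $\Psi_f$, if it exists, with $\int_{\mathbb{S}^{n-1}}\Psi_f\cdot V\,d\sigma_{n-1}=-\int_{\mathbb{S}^{n-1}}f\,\nabla\cdot V\,d\sigma_{n-1}$ for all smooth tangent vector fields $V$ on $\mathbb{S}^{n-1}$. The Sobolev space is $W^{1,p}(\mathbb{S}^{n-1}):=\{f\in L^p(\mathbb{S}^{n-1}): |\Psi_f|\in L^p(\mathbb{S}^{n-1})\}$, equivalently the completion of $C^\infty(\mathbb{S}^{n-1})$ in the usual Sobolev norm; functions are real-valued. The integrands with $\tan d$ and $\sin d$ are understood almost everywhere, with $1/|\tan d|=|\cos d|/\sin d$. *)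

(* Defs.v *)
From HB Require Import structures.
From mathcomp Require Import all_boot all_order all_algebra.
From mathcomp Require Import all_classical all_reals all_analysis.
From mathcomp Require Import measurable_realfun.

Set Implicit Arguments.
Unset Strict Implicit.
Unset Printing Implicit Defensive.

Import Order.TTheory GRing.Theory Num.Theory.
Import numFieldNormedType.Exports.

Local Open Scope classical_set_scope.
Local Open Scope ring_scope.

Definition measure_rV_display : measure_display -> measure_display.
Proof. exact. Qed.

(* The Borel sigma-algebra of R^n, as the product sigma-algebra. *)
Section measurable_rV.
Context {R : realType} {n : nat}.

Definition rV_coord (i : 'I_n) (x : 'rV[R]_n) : R := x ord0 i.

Let rV_set0 : g_sigma_preimage rV_coord set0.
Proof. exact: sigma_algebra0. Qed.

Let rV_setC A : g_sigma_preimage rV_coord A -> g_sigma_preimage rV_coord (~` A).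
Proof. exact: sigma_algebraC. Qed.

Let rV_bigcup (F : _^nat) : (forall i, g_sigma_preimage rV_coord (F i)) ->
  g_sigma_preimage rV_coord (\bigcup_i (F i)).
Proof. exact: sigma_algebra_bigcup. Qed.

HB.instance Definition _ :=
  @isMeasurable.Build (measure_rV_display default_measure_display)
    'rV[R]_n (g_sigma_preimage rV_coord) rV_set0 rV_setC rV_bigcup.

Lemma measurable_rV_coord (i : 'I_n) :
  measurable_fun [set: 'rV[R]_n] (rV_coord i).
Proof.
move=> _ Y mY; rewrite setTI; apply: sub_sigma_algebra => /=.
rewrite -bigcup_seq/=; exists i => /=; first by rewrite mem_index_enum.
by exists Y => //; rewrite setTI.
Qed.

Lemma measurable_fun_rV d (T : measurableType d) (f : T -> 'rV[R]_n) :
  (forall i, measurable_fun [set: T] (fun x => f x ord0 i)) ->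
  measurable_fun [set: T] f.
Proof.
move=> mf; suff mg : g_sigma_preimage (fun i => rV_coord i \o f) `<=` measurable.
  by move=> _ A mA; rewrite setTI; apply: mg; rewrite g_sigma_preimage_comp;
     exists A => //; rewrite setTI.
apply: smallest_sub; first exact: sigma_algebra_measurable.
rewrite -bigcup_seq => A [i _ [B mB <-]].
by apply: (mf i) => //.
Qed.

End measurable_rV.

(* Lebesgue measure on R^n is the n-fold product of [lebesgue_measure]: the
   measure on R^(n+1) is the image of the product of those on R and R^n. *)
Section lebesgue_rV.
Local Open Scope ereal_scope.
Context {R : realType}.

Definition cons_rV n (x : measurableTypeR R * 'rV[R]_n) : 'rV[R]_n.+1 :=
  row_mx (const_mx x.1 : 'rV[R]_1) x.2.

Lemma measurable_cons_rV n : measurable_fun setT (@cons_rV n).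
Proof.
apply: measurable_fun_rV => i; have [j ->|j ->] := @split_ordP 1 n i.
- rewrite (_ : (fun _ => _) = (fun x : measurableTypeR R * 'rV[R]_n => x.1 : R)).
    exact: measurable_fst.
  by apply/funext => x; rewrite (@row_mxEl _ 1 1 n) mxE.
- rewrite (_ : (fun _ => _) = rV_coord j \o snd).
    exact: (measurableT_comp (measurable_rV_coord j) measurable_snd).
  by apply/funext => x; rewrite (@row_mxEr _ 1 1 n).
Qed.

HB.instance Definition _ n :=
  @isMeasurableFun.Build _ _ _ _ (@cons_rV n) (@measurable_cons_rV n).

Section step.
Context {n : nat}.
Variable mu : {sigma_finite_measure set 'rV[R]_n -> \bar R}.

Definition lebesgue_rVS : set 'rV[R]_n.+1 -> \bar R :=
  pushforward (@lebesgue_measure R \x mu) (@cons_rV n).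

Let lebesgue_rVS0 : lebesgue_rVS set0 = 0.
Proof. exact: measure0. Qed.

Let lebesgue_rVS_ge0 A : 0 <= lebesgue_rVS A.
Proof. exact: measure_ge0. Qed.

Let lebesgue_rVS_sigma_additive : semi_sigma_additive lebesgue_rVS.
Proof. exact: measure_semi_sigma_additive. Qed.

HB.instance Definition _ := isMeasure.Build _ _ _ lebesgue_rVS
  lebesgue_rVS0 lebesgue_rVS_ge0 lebesgue_rVS_sigma_additive.

Let lebesgue_rVS_sigma_finite : sigma_finite setT lebesgue_rVS.
Proof.
pose behead_rV (x : 'rV[R]_n.+1) : measurableTypeR R * 'rV[R]_n :=
  (x ord0 ord0, \row_j x ord0 (rshift 1 j)).
have beheadK : cancel (@cons_rV n) behead_rV.
  move=> [a v]; rewrite /behead_rV /cons_rV; congr pair => /=.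
    rewrite (_ : (ord0 : 'I_n.+1) = @lshift 1 n ord0); last exact/val_inj.
    by rewrite (@row_mxEl _ 1 1 n) mxE.
  by apply/rowP => j; rewrite mxE (@row_mxEr _ 1 1 n).
have mbehead : measurable_fun setT behead_rV.
  apply/measurable_fun_pairP; split.
    exact: (@measurable_rV_coord R n.+1 ord0).
  apply: measurable_fun_rV => j.
  rewrite (_ : (fun _ => _) = @rV_coord R n.+1 (rshift 1 j)).
    exact: measurable_rV_coord.
  by apply/funext => x /=; rewrite mxE.
have /sigma_finiteP[F [FT ndF Foo]] := sigma_finiteT (@lebesgue_measure R).
have /sigma_finiteP[G [GT ndG Goo]] := sigma_finiteT mu.
exists (fun k => behead_rV @^-1` (F k `*` G k)).
  rewrite -preimage_bigcup (_ : \bigcup_k _ = setT) ?preimage_setT//.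
  apply/seteqP; split => // -[x y] _.
  have [i _ Fix_] : (\bigcup_i F i) x by rewrite -FT.
  have [j _ Gjy] : (\bigcup_i G i) y by rewrite -GT.
  exists (maxn i j) => //; split.
  - by move: x Fix_; exact/subsetPset/ndF/leq_maxl.
  - by move: y Gjy; exact/subsetPset/ndG/leq_maxr.
move=> k; have [mF Fk] := Foo k; have [mG Gk] := Goo k; split.
  by rewrite -[X in measurable X]setTI; apply: mbehead => //; exact: measurableX.
rewrite /lebesgue_rVS /pushforward -comp_preimage.
rewrite (_ : behead_rV \o _ = id); last exact/funext/beheadK.
by rewrite preimage_id product_measure1E// lte_mul_pinfty// ge0_fin_numE.
Qed.

HB.instance Definition _ := Measure_isSigmaFinite.Build _ _ _ lebesgue_rVS
  lebesgue_rVS_sigma_finite.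

End step.

Fixpoint lebesgue_rV n : {sigma_finite_measure set 'rV[R]_n -> \bar R} :=
  if n is m.+1 then lebesgue_rVS (lebesgue_rV m) else \d_(0%R : 'rV[R]_0).

End lebesgue_rV.

Section sphere.
Context {R : realType}.

Definition dot n (x y : 'rV[R]_n) : R := \sum_i x ord0 i * y ord0 i.

(* The norm of the library on ['rV[R]_n] is the sup norm. *)
Definition enorm n (x : 'rV[R]_n) : R := Num.sqrt (dot x x).

Definition sphere n : set 'rV[R]_n := [set x | enorm x = 1].

Definition punctured_ball n : set 'rV[R]_n := [set x | 0 < enorm x <= 1].

Definition normalize n (x : 'rV[R]_n) : 'rV[R]_n := (enorm x)^-1 *: x.

Lemma measurable_enorm n : measurable_fun setT (@enorm n).
Proof.
rewrite (_ : @enorm n = (@powR R ^~ 2^-1) \o (fun x => dot x x)).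
  apply: measurableT_comp; first exact: measurable_powR.
  by apply: measurable_sum => i; apply: measurable_funM;
    exact: measurable_rV_coord.
apply/funext => x /=; rewrite powR12_sqrt//.
by apply: sumr_ge0 => i _; rewrite -expr2 sqr_ge0.
Qed.

Lemma measurable_sphere n : measurable (@sphere n).
Proof.
rewrite (_ : @sphere n = @enorm n @^-1` [set 1])//.
by rewrite -[X in measurable X]setTI; apply: measurable_enorm.
Qed.

Lemma measurable_punctured_ball n : measurable (@punctured_ball n).
Proof.
rewrite (_ : @punctured_ball n = @enorm n @^-1` `]0, 1]).
  by rewrite -[X in measurable X]setTI; apply: measurable_enorm.
by apply/seteqP; split => x /=; rewrite in_itv.
Qed.

Lemma measurable_normalize n : measurable_fun setT (@normalize n).
Proof.
apply: measurable_fun_rV => i.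
rewrite (_ : (fun _ => _) = (fun x => enorm x `^ (- 1) * rV_coord i x)).
  apply: measurable_funM; last exact: measurable_rV_coord.
  apply: (measurableT_comp (measurable_powR (- 1))); exact: measurable_enorm.
by apply/funext => x; rewrite mxE powR_inv1// sqrtr_ge0.
Qed.

Section surface_measure.
Local Open Scope ereal_scope.
Variable n : nat.

(* Polar coordinates: the surface measure of a part [A] of the sphere is [n]
   times the volume of the cone [{t x | x in A, 0 < t <= 1}] over it. This is
   a measure on R^n carried by the sphere. *)
Definition surface_measure (A : set 'rV[R]_n) : \bar R :=
  n%:R%:E * lebesgue_rV n (@normalize n @^-1` A `&` @punctured_ball n).

Let surface_measure0 : surface_measure set0 = 0.
Proof. by rewrite /surface_measure preimage_set0 set0I measure0 mule0. Qed.

Let surface_measure_ge0 A : 0 <= surface_measure A.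
Proof. by rewrite mule_ge0. Qed.

Let surface_measure_sigma_additive : semi_sigma_additive surface_measure.
Proof.
move=> F mF tF mUF; rewrite /surface_measure.
pose nu := mrestr (lebesgue_rV n) (@measurable_punctured_ball n).
have mnF A : measurable A -> measurable (@normalize n @^-1` A).
  by move=> mA; rewrite -[X in measurable X]setTI; exact: measurable_normalize.
under eq_fun do rewrite -ge0_sume_distrr//.
apply: cvgeZl => //.
rewrite preimage_bigcup; apply: (@measure_semi_sigma_additive _ _ _ nu).
- by move=> i; exact: mnF.
- apply/trivIsetP => i j _ _ ij; rewrite -preimage_setI.
  by move/trivIsetP : tF => /(_ _ _ Logic.I Logic.I ij) ->; rewrite preimage_set0.
- by rewrite -preimage_bigcup; exact: mnF.
Qed.

HB.instance Definition _ := isMeasure.Build _ _ _ surface_measure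
  surface_measure0 surface_measure_ge0 surface_measure_sigma_additive.

End surface_measure.

End sphere.

Arguments sphere {R} n.
Arguments surface_measure {R} n.

Section sobolev.
Context {R : realType} {n : nat}.
Local Notation E := 'rV[R]_n.
Local Notation sigma := (@surface_measure R n).
Local Notation S := (@sphere R n).

(* Scalar and vector fields on the sphere are (the restrictions to the sphere
   of) functions on R^n, whose values outside of the sphere are irrelevant. *)

Definition partial (i : 'I_n) (f : E -> R) : E -> R :=
  fun x => 'D_(delta_mx ord0 i) f x.

Definition smooth_on (U : set E) (f : E -> R) : Prop :=
  forall (s : seq 'I_n) (x : E), U x -> differentiable (foldr partial f s) x.

(* Smooth fields on the sphere are those that extend smoothly to a
   neighborhood of it. *)
Definition smooth_tangent_field (V : E -> E) : Prop :=
  (exists2 U : set E, open U /\ S `<=` U &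
     forall i, smooth_on U (fun x => V x ord0 i)) /\
  (forall x, S x -> dot (V x) x = 0).

(* The divergence of a tangent field is the trace of its covariant derivative,
   i.e., of the tangential part of its differential: the sum of the derivatives
   of its components [V_i] in the directions [e_i - x_i x], the projections of
   the canonical basis on the tangent space at [x]. *)
Definition sphere_div (V : E -> E) (x : E) : R :=
  \sum_(i < n) 'D_(delta_mx ord0 i - x ord0 i *: x) (fun y => V y ord0 i) x.

Definition sphere_Lp (p : R) (f : E -> R) : Prop := f \_ S \in Lfun sigma p%:E.

Definition is_sphere_grad (f : E -> R) (Psi : E -> E) : Prop :=
  [/\ sphere_Lp 1 f,
      forall i, sphere_Lp 1 (fun x => Psi x ord0 i),
      {ae sigma, forall x, dot (Psi x) x = 0} &
      forall V, smooth_tangent_field V ->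
        (\int[sigma]_(x in S) (dot (Psi x) (V x))%:E =
         - \int[sigma]_(x in S) (f x * sphere_div V x)%:E)%E].

(* The weak gradient of [f], if it exists: it is unique up to equality almost
   everywhere and [sphere_grad f] is a representative of it. *)
Definition sphere_grad (f : E -> R) : E -> E :=
  get [set Psi | is_sphere_grad f Psi].

Definition sobolev (p : R) (f : E -> R) : Prop :=
  [/\ sphere_Lp p f, exists Psi, is_sphere_grad f Psi &
      sphere_Lp p (fun x => enorm (sphere_grad f x))].

Definition geodist (Phi Theta : E) : R := acos (dot Theta Phi).

End sobolev.

(* Main.v *)
(* Let X = Phi - c x be the gradient of the latitude c = x.Phi = cos d. Then
   |X| = sin d, X c = sin^2 d, div X = - (n - 1) c, and the flow F_t of X is an
   explicit conformal map of the sphere. Testing the weak gradient of u against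
   smooth functions transported by F_t and integrating in time yields, without
   approximating u by smooth functions,
     |u(F_t x)| <= |u(x)| + int_0^t |w(F_s x)| ds   for almost every x,
   where w = grad u . X. Multiply by p |u(F_t x)|^(p-1) h(c) with h = a^(p-1) b,
   where a, b >= 0 are nondecreasing functions of c vanishing for c <= 0; apply
   Young's inequality and the change of variables F_s, divide by t and let t
   tend to 0: for every alpha > 0,
     alpha^(p-1) int |u|^p ((n-1) c h(c) - sin^2 d h'(c))
       <= (p-1) alpha^p int a(c)^p |u|^p + int b(c)^p |w|^p.
   With v = (sin^2 d + eps)^(-1/2) on c > 0, the choices (a, b) = (v, c v) and
   (a, b) = (c v, v), together with |w| <= |grad u| sin d, give the two
   inequalities on the hemisphere c > 0 up to eps; those for - Phi cover the
   other hemisphere, and eps tends to 0 by Fatou's lemma. At eps > 0 the first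
   one also bounds int |u|^p (sin^2 d + eps)^(-p/2) uniformly in eps, whence the
   integrability statement. *)
From HB Require Import structures.
From mathcomp Require Import all_boot all_order all_algebra.
From mathcomp Require Import all_classical all_reals all_analysis.
From mathcomp Require Import measurable_realfun ring lra.
Require Import Defs.
Set Implicit Arguments.
Unset Strict Implicit.
Unset Printing Implicit Defensive.

Import Order.TTheory GRing.Theory Num.Theory.
Import numFieldNormedType.Exports.

Local Open Scope classical_set_scope.
Local Open Scope ring_scope.

(** * Lebesgue measure and polar coordinates *)

(** The gradient of [u] is given only by duality with smooth tangent fields, so the singular
    one-sided weights cannot be tested against it. All smoothness is put on the test side: a bump
    composed with F_s and multiplied by [jac] solves the continuity equation, its time derivative
    being the divergence of its product with X. Paired with [u], this identifies u o F_t - u almost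
    everywhere; for the constant 1, it proves that [jac] is the Jacobian. The weights must be
    nondecreasing in c because the change of variables moves the flow onto them, and flowing back
    lowers c. Functions such as 1 / sin d are monotone only on each side of the equator, hence the
    two hemispheres. The regularization eps keeps the integrals finite, so that the Young term can
    be subtracted. For the weights used, that subtraction leaves the coefficient alpha^(p-1) (n - 1
    - p) - (p - 1) alpha^p. It is largest at alpha = (n - 1 - p) / p, where it equals alpha^p. *)

Section lebesgue_affine.
Context {R : realType}.
Local Open Scope ereal_scope.

Definition affine_rV n (r : R) (v x : 'rV[R]_n) : 'rV[R]_n := (r *: x + v)%R.

Lemma measurable_affine_rV n r v : measurable_fun setT (@affine_rV n r v).
Proof.
apply: measurable_fun_rV => i.
rewrite (_ : (fun _ => _) = (fun x => r * rV_coord i x + v ord0 i)%R).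
  apply: measurable_funD => //; apply: measurable_funM => //.
  exact: measurable_rV_coord.
by apply/funext => x; rewrite !mxE.
Qed.

HB.instance Definition _ n r v := @isMeasurableFun.Build _ _ _ _
  (@affine_rV n r v) (@measurable_affine_rV n r v).

Definition affine1 (r a : R) (x : measurableTypeR R) : measurableTypeR R :=
  (r * x + a)%R.

Lemma measurable_affine1 r a : measurable_fun setT (@affine1 r a).
Proof.
exact: (@measurable_funD _ _ R).
Qed.

HB.instance Definition _ r a := @isMeasurableFun.Build _ _ _ _
  (@affine1 r a) (@measurable_affine1 r a).

Lemma lebesgue_measure_affine (r a : R) (A : set (measurableTypeR R)) :
  (0 < r)%R -> measurable A ->
  r%:E * lebesgue_measure (affine1 r a @^-1` A) = lebesgue_measure A.
Proof.
move=> r0 mA; apply/esym.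
pose k : {nonneg R} := NngNum (ltW r0).
apply: (@lebesgue_measure_unique _
  (mscale k (pushforward (@lebesgue_measure R) (@affine1 r a)))) => // X.
move=> -[[x y] /= _ <-].
rewrite /= /mscale /pushforward /=.
rewrite [X in _ * lebesgue_measure X](_ : _ = `](r^-1 * (x - a))%R, (r^-1 * (y - a))%R]%classic);
  last first.
  apply/seteqP; split => z /=; rewrite /affine1 !in_itv/= => /andP[h1 h2]; apply/andP; split.
  - by rewrite mulrC ltr_pdivrMr// mulrC ltrBlDr.
  - by rewrite mulrC ler_pdivlMr// mulrC lerBrDr.
  - by move: h1; rewrite mulrC ltr_pdivrMr// mulrC ltrBlDr.
  - by move: h2; rewrite mulrC ler_pdivlMr// mulrC lerBrDr.
rewrite !lebesgue_measure_itv/= !lte_fin ltr_pM2l ?invr_gt0// ltrBlDr subrK.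
case: ifPn => _; last by rewrite mule0.
by rewrite -!EFinD -EFinM; congr EFin; field; rewrite gt_eqF.
Qed.

(** Induction on the dimension: [cons_rV] intertwines the affine map with its actions on the first
    coordinate and on the others. Two measures on a product are then compared on rectangles, where
    [lebesgue_measure_affine] and the induction hypothesis apply. *)
Lemma lebesgue_rV_affine n (r : R) (v : 'rV[R]_n) A :
  (0 < r)%R -> measurable A ->
  (r ^+ n)%:E * lebesgue_rV n (affine_rV r v @^-1` A) = lebesgue_rV n A.
Proof.
move=> r0; elim: n => [|n IH] in v A *; move=> mA.
  rewrite expr0 mul1e (_ : affine_rV r v @^-1` A = A)//.
  by apply/seteqP; split => x /=;
    rewrite (_ : affine_rV _ _ _ = x)//; apply/rowP => -[].
rewrite /= /lebesgue_rVS /pushforward/=.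
pose a := v ord0 ord0.
pose w : 'rV[R]_n := \row_j v ord0 (rshift 1 j).
pose T (x : measurableTypeR R * 'rV[R]_n) : measurableTypeR R * 'rV[R]_n :=
  (affine1 r a x.1, affine_rV r w x.2).
have mT : measurable_fun setT T.
  apply/measurable_fun_pairP; split.
    by apply: (measurableT_comp (@measurable_affine1 r a)) => //; exact: measurable_fst.
  by apply: (measurableT_comp (@measurable_affine_rV n r w)) => //; exact: measurable_snd.
have k0 : (0 <= r ^+ n.+1)%R by rewrite exprn_ge0// ltW.
pose k : {nonneg R} := NngNum k0.
pose Tm : {mfun _ >-> _} := HB.pack T (isMeasurableFun.Build _ _ _ _ _ mT).
have E : affine_rV r v \o @cons_rV R n = @cons_rV R n \o T.
  apply/funext => -[x y]; apply/rowP => i.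
  rewrite /= /affine_rV [LHS]mxE [X in (X + _)%R]mxE.
  have [j ->|j ->] := @split_ordP 1 n i.
    rewrite !(@row_mxEl _ 1 1 n) !mxE /= /affine1 /a; congr (_ * _ + v _ _)%R.
    by apply/val_inj; rewrite /= ord1.
  by rewrite !(@row_mxEr _ 1 1 n) !mxE.
rewrite -[X in _ * _ X]/((affine_rV r v \o @cons_rV R n) @^-1` A) E.
rewrite -[X in _ * _ X]/(T @^-1` (@cons_rV R n @^-1` A)).
apply/esym/(@product_measure_unique _ _ _ _ _ (@lebesgue_measure R) (lebesgue_rV n)
  (mscale k (pushforward (@lebesgue_measure R \x lebesgue_rV n) Tm))); last first.
  by rewrite -[X in measurable X]setTI; exact: measurable_cons_rV.
move=> B C mB mC.
transitivity ((r ^+ n.+1)%:E * (@lebesgue_measure R \x lebesgue_rV n)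
  ((affine1 r a @^-1` B) `*` (affine_rV r w @^-1` C))); first by [].
rewrite product_measure1E; last 2 first.
- by rewrite -[X in measurable X]setTI; exact: measurable_affine1.
- by rewrite -[X in measurable X]setTI; exact: measurable_affine_rV.
rewrite exprS EFinM muleACA; congr (_ * _); last exact: IH.
exact: lebesgue_measure_affine.
Qed.

Definition box_rV n (M : R) : set 'rV[R]_n := [set x | forall i, (`|x ord0 i| <= M)%R].

Lemma measurable_box_rV n M : measurable (@box_rV n M).
Proof.
rewrite (_ : @box_rV n M = \big[setI/setT]_(i <- enum 'I_n)
    (rV_coord i @^-1` `[(-M)%R, M])).
  apply: bigsetI_measurable => i _.
  by rewrite -[X in measurable X]setTI; apply: measurable_rV_coord.
rewrite -bigcap_seq; apply/seteqP; split => x /=.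
  by move=> h i _; rewrite /= in_itv/= -ler_norml; exact: h.
by move=> h i; have /= := h i (mem_enum _ _); rewrite in_itv/= -ler_norml.
Qed.

Lemma lebesgue_rV_box_fin n M : lebesgue_rV n (@box_rV n M) < +oo.
Proof.
elim: n => [|n IH]; first by rewrite /= diracE ltry.
rewrite /= /lebesgue_rVS /pushforward.
rewrite (_ : _ @^-1` _ = `[(-M)%R, M]%classic `*` @box_rV n M).
  rewrite product_measure1E//; last exact: measurable_box_rV.
  rewrite lte_mul_pinfty//.
  rewrite [X in X \is a fin_num](_ : _ = lebesgue_measure `[(-M)%R, M]%classic)//.
  by rewrite lebesgue_measure_itv/=; case: ifPn.
apply/seteqP; split => -[x y] /=; rewrite /box_rV /cons_rV/= in_itv/= -ler_norml.
  move=> h; split.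
    by have := h (@lshift 1 n ord0); rewrite (@row_mxEl _ 1 1 n) mxE.
  by move=> i; have := h (rshift 1 i); rewrite (@row_mxEr _ 1 1 n).
move=> [h1 h2] i; have [j ->|j ->] := @split_ordP 1 n i.
  by rewrite (@row_mxEl _ 1 1 n) mxE.
by rewrite (@row_mxEr _ 1 1 n).
Qed.

End lebesgue_affine.

(** * Change of variables with a density *)

Section transfer.
Local Open Scope ereal_scope.
Context d1 d2 (T1 : measurableType d1) (T2 : measurableType d2) (R : realType).
Variables (mu1 : {measure set T1 -> \bar R}) (mu2 : {measure set T2 -> \bar R}).
Variables (D1 : set T1) (D2 : set T2) (phi : T1 -> T2) (J : T1 -> R).
Hypotheses (mD1 : measurable D1) (mD2 : measurable D2).
Hypotheses (mphi : measurable_fun setT phi) (mJ : measurable_fun setT J).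
Hypothesis J_ge0 : forall x, D1 x -> (0 <= J x)%R.
Hypothesis mu12 : forall A, measurable A ->
  \int[mu1]_(x in D1) (J x * \1_A (phi x))%:E = mu2 (A `&` D2).

Import HBNNSimple.

Let transfer_nnsfun (h : {nnsfun T2 >-> R}) :
  \int[mu1]_(x in D1) ((J x)%:E * (h (phi x))%:E) =
  \int[mu2]_(x in D2) (h x)%:E.
Proof.
have mh (r : R) : measurable (h @^-1` [set r]) by exact: measurable_sfunP.
have m1 (r : R) : measurable_fun D1 (fun x => (J x * \1_(h @^-1` [set r]) (phi x))%:E).
  apply/measurable_EFinP/measurable_funM; first exact: measurable_funTS.
  by apply/measurable_funTS/measurableT_comp => //; exact: measurable_indic.
have nn (r : R) y : (0 <= r * \1_(h @^-1` [set r]) y)%R.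
  by rewrite -lee_fin EFinM nnfun_muleindic_ge0.
under [LHS]eq_integral.
  move=> x xD; rewrite fimfunE -fsumEFin// ge0_mule_fsumr; last first.
    by move=> r; rewrite lee_fin.
  over.
rewrite [LHS]ge0_integral_fsum//; last 2 first.
  - by move=> r; under eq_fun do rewrite -EFinM mulrCA EFinM; exact: measurable_funeM.
  - by move=> r x xD; rewrite mule_ge0// lee_fin ?J_ge0.
under [RHS]eq_integral do rewrite fimfunE -fsumEFin//.
rewrite [RHS]ge0_integral_fsum//; last 2 first.
  - by move=> r; exact/measurable_EFinP/measurableT_comp.
  - by move=> r x xD; rewrite lee_fin.
apply: eq_fsbigr => r _.
under eq_integral do rewrite -EFinM mulrCA EFinM.
under [RHS]eq_integral do rewrite EFinM.
have [r0|r0] := leP 0%R r.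
  rewrite [RHS]ge0_integralZl//; last first.
    exact/measurable_EFinP/measurable_funTS/measurable_indic.
  rewrite ge0_integralZl//; first by rewrite mu12// integral_indic.
  by move=> x xD; rewrite lee_fin mulr_ge0// J_ge0.
rewrite preimage_nnfun0//; under eq_integral do rewrite indic0 mulr0 mule0.
by under [RHS]eq_integral do rewrite indic0 mule0; rewrite !integral0.
Qed.

(** The hypothesis [mu12] is the case of indicators; simple functions and monotone convergence give
    the rest. Polar coordinates, affine maps and the flow are all instances. *)
Lemma ge0_integral_transfer (g : T2 -> \bar R) :
  measurable_fun setT g -> (forall x, 0 <= g x) ->
  \int[mu1]_(x in D1) ((J x)%:E * g (phi x)) = \int[mu2]_(x in D2) g x.
Proof.
move=> mg g0; pose g_ := nnsfun_approx measurableT mg.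
have mJ1 : measurable_fun D1 (EFin \o J) by exact/measurable_EFinP/measurable_funTS.
have mg_ k : measurable_fun D1 (fun x => (g_ k (phi x))%:E).
  by apply/measurable_EFinP/measurable_funTS/measurableT_comp.
transitivity (limn (fun k => \int[mu1]_(x in D1) ((J x)%:E * (g_ k (phi x))%:E))).
  rewrite -monotone_convergence//=.
  - apply: eq_integral => x /[!inE] xD; apply/esym/cvg_lim => //=.
    by apply: cvgeZl => //; exact: cvg_nnsfun_approx.
  - by move=> k; exact: emeasurable_funM.
  - by move=> k x xD; rewrite mule_ge0// lee_fin ?J_ge0.
  - move=> x xD a b ab; rewrite lee_wpmul2l ?lee_fin ?J_ge0//.
    exact/lefP/nd_nnsfun_approx.
under eq_fun do rewrite transfer_nnsfun.
rewrite -monotone_convergence//=.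
- apply: eq_integral => x /[!inE] xD; apply/cvg_lim => //.
  exact: cvg_nnsfun_approx.
- by move=> k; exact/measurable_EFinP/measurable_funTS.
- by move=> k x _; rewrite lee_fin.
- by move=> x _ a b ab; rewrite lee_fin//; exact/lefP/nd_nnsfun_approx.
Qed.

(** A nonnegative density commutes with positive and negative parts, so both sides are the
    difference of the same two integrals. *)
Lemma integral_transfer (g : T2 -> \bar R) : measurable_fun setT g ->
  \int[mu1]_(x in D1) ((J x)%:E * g (phi x)) = \int[mu2]_(x in D2) g x.
Proof.
move=> mg; rewrite integralE [RHS]integralE; congr (_ - _).
  rewrite -ge0_integral_transfer//; last exact: measurable_funepos.
  apply: eq_integral => x /[!inE] xD.
  by rewrite !funeposE maxe_pMr ?mule0// lee_fin J_ge0.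
rewrite -ge0_integral_transfer//; last exact: measurable_funeneg.
apply: eq_integral => x /[!inE] xD.
by rewrite !funenegE maxe_pMr ?mule0 ?muleN// lee_fin J_ge0.
Qed.

Lemma integrable_transfer (g : T2 -> \bar R) : measurable_fun setT g ->
  mu1.-integrable D1 (fun x => (J x)%:E * g (phi x)) <-> mu2.-integrable D2 g.
Proof.
move=> mg.
have e : \int[mu1]_(x in D1) `|(J x)%:E * g (phi x)| = \int[mu2]_(x in D2) `|g x|.
  rewrite -ge0_integral_transfer//; last exact: measurableT_comp.
  by apply: eq_integral => x /[!inE] xD; rewrite abseM gee0_abs// lee_fin J_ge0.
split => /integrableP[h1 h2]; apply/integrableP; split.
- exact: measurable_funTS.
- by rewrite -e.
- apply: emeasurable_funM; first exact/measurable_EFinP/measurable_funTS.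
  exact/measurable_funTS/measurableT_comp.
- by rewrite e.
Qed.

End transfer.

Section euclidean.
Context {R : realType} {n : nat}.
Implicit Types (x y z : 'rV[R]_n) (a : R).

Lemma dotC x y : dot x y = dot y x.
Proof. by apply: eq_bigr => i _; rewrite mulrC. Qed.

Lemma dotDl x y z : dot (x + y) z = dot x z + dot y z.
Proof. by rewrite /dot -big_split; apply: eq_bigr => i _; rewrite mxE mulrDl. Qed.

Lemma dotZl a x z : dot (a *: x) z = a * dot x z.
Proof. by rewrite /dot mulr_sumr; apply: eq_bigr => i _; rewrite mxE mulrA. Qed.

Lemma dotDr x y z : dot z (x + y) = dot z x + dot z y.
Proof. by rewrite dotC dotDl !(dotC _ z). Qed.

Lemma dotZr a x z : dot z (a *: x) = a * dot z x.
Proof. by rewrite dotC dotZl dotC. Qed.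

Lemma dotNl x z : dot (- x) z = - dot x z.
Proof. by rewrite -scaleN1r dotZl mulN1r. Qed.

Lemma dotNr x z : dot z (- x) = - dot z x.
Proof. by rewrite dotC dotNl dotC. Qed.

Lemma dot_ge0 x : 0 <= dot x x.
Proof. by apply: sumr_ge0 => i _; rewrite -expr2 sqr_ge0. Qed.

Lemma enorm_ge0 x : 0 <= enorm x.
Proof. exact: sqrtr_ge0. Qed.

Lemma enorm_sqr x : enorm x ^+ 2 = dot x x.
Proof. by rewrite sqr_sqrtr// dot_ge0. Qed.

Lemma le_coord_enorm x i : `|x ord0 i| <= enorm x.
Proof.
rewrite -(@ler_pXn2r _ 2)// ?nnegrE ?enorm_ge0//.
rewrite enorm_sqr real_normK ?num_real// /dot (bigD1 i)//= -expr2 lerDl.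
by apply: sumr_ge0 => j _; rewrite -expr2 sqr_ge0.
Qed.

Lemma enormZ a x : enorm (a *: x) = `|a| * enorm x.
Proof.
by rewrite /enorm dotZl dotZr mulrA -expr2 sqrtrM ?sqr_ge0// sqrtr_sqr.
Qed.

Lemma enorm0 : enorm (0 : 'rV[R]_n) = 0.
Proof. by rewrite -(scale0r 0) enormZ normr0 mul0r. Qed.

Lemma enorm0_eq0 x : enorm x = 0 -> x = 0.
Proof.
move=> x0; apply/rowP => i; rewrite mxE; apply/eqP.
by rewrite -normr_le0 -x0 le_coord_enorm.
Qed.

Lemma enorm_gt0 x : (0 < enorm x) = (x != 0).
Proof.
rewrite lt_neqAle enorm_ge0 andbT eq_sym; congr negb; apply/eqP/eqP => [|->].
  exact: enorm0_eq0.
exact: enorm0.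
Qed.

Lemma sphereE x : sphere n x <-> dot x x = 1.
Proof.
split => [/= h|h]; first by rewrite -enorm_sqr h expr1n.
by rewrite /sphere /= /enorm h sqrtr1.
Qed.

Lemma normalize_sphere x : x != 0 -> sphere n (normalize x).
Proof.
rewrite -enorm_gt0 => x0; rewrite /sphere/= /normalize enormZ.
by rewrite ger0_norm ?invr_ge0 ?ltW// mulVf// gt_eqF.
Qed.

Lemma normalizeZ a x : 0 < a -> normalize (a *: x) = normalize x.
Proof.
move=> a0; rewrite /normalize enormZ (gtr0_norm a0) scalerA invfM mulrAC.
by rewrite mulVf ?mul1r// gt_eqF.
Qed.

Lemma dot_sqr_le x y : dot x y ^+ 2 <= dot x x * dot y y.
Proof.
have [->|] := eqVneq y 0.
  by rewrite -(scale0r 0) !dotZr !mul0r expr0n mulr0.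
rewrite -enorm_gt0 => y0.
have dy : 0 < dot y y by rewrite -enorm_sqr exprn_gt0.
have := dot_ge0 (dot y y *: x - dot x y *: y).
rewrite !(dotDl, dotDr, dotNl, dotNr, dotZl, dotZr) (dotC y x).
rewrite [X in 0 <= X](_ : _ = dot y y * (dot x x * dot y y - dot x y ^+ 2)).
  by rewrite pmulr_rge0// subr_ge0.
by ring.
Qed.

Lemma normr_dot_le x y : `|dot x y| <= enorm x * enorm y.
Proof.
rewrite -(@ler_pXn2r _ 2)// ?nnegrE ?mulr_ge0 ?enorm_ge0//.
by rewrite exprMn !enorm_sqr real_normK ?num_real// dot_sqr_le.
Qed.

Lemma enormD_le x y : enorm (x + y) <= enorm x + enorm y.
Proof.
rewrite -(@ler_pXn2r _ 2)// ?nnegrE ?addr_ge0 ?enorm_ge0//.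
rewrite enorm_sqr sqrrD !dotDl !dotDr !enorm_sqr (dotC y x).
have := normr_dot_le x y; have := ler_norm (dot x y); lra.
Qed.

Lemma enormN x : enorm (- x) = enorm x.
Proof. by rewrite -scaleN1r enormZ normrN1 mul1r. Qed.

Lemma enormB_le x y : `|enorm x - enorm y| <= enorm (x - y).
Proof.
rewrite ler_norml; apply/andP; split.
  have := enormD_le (y - x) x; rewrite subrK -(enormN (y - x)) opprB; lra.
by have := enormD_le (x - y) y; rewrite subrK; lra.
Qed.

Lemma measurable_dot y : measurable_fun setT (fun x => dot x y).
Proof.
apply: measurable_sum => i; apply: measurable_funM => //.
exact: measurable_rV_coord.
Qed.

End euclidean.

(** * Polar coordinates and balls *)

Section cone_integral.
Local Open Scope ereal_scope.
Context {R : realType} (n : nat).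
Local Notation lam := (@lebesgue_rV R n).
Local Notation sigma := (@surface_measure R n).
Local Notation S := (@sphere R n).

Lemma integral_surface (g : 'rV[R]_n -> \bar R) : measurable_fun setT g ->
  \int[lam]_(x in @punctured_ball R n) (n%:R%:E * g (normalize x)) =
  \int[sigma]_(x in S) g x.
Proof.
move=> mg; apply: (integral_transfer (J := cst n%:R)) => //.
- exact: measurable_punctured_ball.
- exact: measurable_sphere.
- exact: measurable_normalize.
move=> A mA; under eq_integral do rewrite [cst _ _]/= EFinM.
rewrite ge0_integralZl//; last 2 first.
- exact: measurable_punctured_ball.
- apply/measurable_EFinP/measurable_funTS/measurableT_comp => //.
  exact: measurable_normalize.
rewrite (_ : (fun x => _) = EFin \o \1_(@normalize R n @^-1` A)); last first.
  by apply/funext => x /=; rewrite !indicE; congr (_%:R%:E);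
    apply/idP/idP; rewrite !inE.
rewrite integral_indic//; last 2 first.
- exact: measurable_punctured_ball.
- by rewrite -[X in measurable X]setTI; exact: measurable_normalize.
congr (_ * lam _); apply/seteqP; split => x /= [h1 h2]; split => //.
  by split => //; apply: normalize_sphere; rewrite -enorm_gt0; case/andP: h2.
by case: h1.
Qed.

Lemma integral_affine (r : R) (v : 'rV[R]_n) (D : set 'rV[R]_n) g :
  (0 < r)%R -> measurable D -> measurable_fun setT g ->
  \int[lam]_(x in affine_rV r v @^-1` D) ((r ^+ n)%:E * g (affine_rV r v x)) =
  \int[lam]_(x in D) g x.
Proof.
move=> r0 mD mg.
have mT := @measurable_affine_rV R n r v.
have mTD : measurable (affine_rV r v @^-1` D).
  by rewrite -[X in measurable X]setTI; exact: mT.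
apply: (integral_transfer (J := cst (r ^+ n)%R)) => //.
  by move=> x _; rewrite exprn_ge0// ltW.
move=> A mA; under eq_integral do rewrite [cst _ _]/= EFinM.
have mTA : measurable (affine_rV r v @^-1` A).
  by rewrite -[X in measurable X]setTI; exact: mT.
rewrite ge0_integralZl//; last 2 first.
- by apply/measurable_EFinP/measurable_funTS/measurableT_comp.
- by rewrite lee_fin exprn_ge0// ltW.
rewrite (_ : (fun x => _) = EFin \o \1_(affine_rV r v @^-1` A)); last first.
  by apply/funext => x /=; rewrite !indicE; congr (_%:R%:E);
    apply/idP/idP; rewrite !inE.
rewrite integral_indic// -preimage_setI lebesgue_rV_affine//.
exact: measurableI.
Qed.

End cone_integral.

Section cone_scaling.
Local Open Scope ereal_scope.
Context {R : realType} (n : nat).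
Local Notation lam := (@lebesgue_rV R n).
Local Notation sigma := (@surface_measure R n).
Local Notation S := (@sphere R n).
Local Notation B1 := (@punctured_ball R n).

Definition pball (rho : R) : set 'rV[R]_n := [set x | (0 < enorm x <= rho)%R].

Lemma measurable_pball rho : measurable (pball rho).
Proof.
rewrite (_ : pball rho = @enorm R n @^-1` `]0%R, rho]).
  by rewrite -[X in measurable X]setTI; apply: measurable_enorm.
by apply/seteqP; split => x /=; rewrite in_itv.
Qed.

(** Dilation by [rho] maps the unit ball onto [pball rho] and leaves [normalize] unchanged. *)
Lemma integral_pball (rho : R) (g : 'rV[R]_n -> \bar R) : (0 < rho)%R ->
  measurable_fun setT g -> (forall x, 0 <= g x) ->
  \int[lam]_(x in pball rho) g (normalize x) =
  (rho ^+ n)%:E * \int[lam]_(x in B1) g (normalize x).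
Proof.
move=> rho0 mg g0.
have mgn : measurable_fun setT (fun x => g (normalize x)).
  by apply: measurableT_comp => //; exact: measurable_normalize.
rewrite -(@integral_affine _ _ rho 0%R)//; last exact: measurable_pball.
have E x : affine_rV rho 0%R x = (rho *: x)%R :> 'rV[R]_n by rewrite /affine_rV addr0.
rewrite (_ : affine_rV rho 0%R @^-1` pball rho = B1); last first.
  apply/seteqP; split => x; rewrite /pball /punctured_ball/= E enormZ gtr0_norm// pmulr_rgt0//;
    by rewrite ger_pMr.
under eq_integral do rewrite E normalizeZ//.
rewrite ge0_integralZl//; [exact: measurable_punctured_ball|exact: measurable_funTS|].
by rewrite lee_fin exprn_ge0// ltW.
Qed.

Lemma lebesgue_pball (rho : R) : (0 < rho)%R ->
  lam (pball rho) = (rho ^+ n)%:E * lam B1.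
Proof.
move=> rho0.
have := @integral_pball rho (cst 1) rho0 (measurable_cst _) (fun=> lee01).
by rewrite !integral_cst ?mul1e//; [exact: measurable_punctured_ball|exact: measurable_pball].
Qed.

Lemma lebesgue_punctured_ball_fin : lam B1 < +oo.
Proof.
apply: le_lt_trans (@lebesgue_rV_box_fin R n 1); apply: le_measure.
- by rewrite inE; exact: measurable_punctured_ball.
- by rewrite inE; exact: measurable_box_rV.
- by move=> x /andP[_ h] i; exact: le_trans (le_coord_enorm _ _) h.
Qed.

Lemma surface_measure_fin : sigma setT < +oo.
Proof.
rewrite /surface_measure/= preimage_setT setTI lte_mul_pinfty//.
exact: lebesgue_punctured_ball_fin.
Qed.

(** The sphere and the ball of radius [rho < 1] are disjoint in the unit ball, so the sphere has
    measure at most [(1 - rho ^+ n) * lam B1], which tends to 0 as [rho] tends to 1. *)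
Lemma lebesgue_sphere : (0 < n)%N -> lam S = 0.
Proof.
move=> n0; apply/eqP; rewrite eq_le measure_ge0 andbT.
have fB := lebesgue_punctured_ball_fin.
have fS : lam S <= lam B1.
  apply: le_measure; rewrite ?inE.
  - exact: measurable_sphere.
  - exact: measurable_punctured_ball.
  - by move=> x /= h; rewrite /punctured_ball/= h ltr01 lexx.
have fBn : lam B1 \is a fin_num by rewrite ge0_fin_numE.
have key (rho : R) : (0 < rho < 1)%R -> lam S <= (1 - rho ^+ n)%:E * lam B1.
  move=> /andP[rho0 rho1].
  have -> : (1 - rho ^+ n)%:E * lam B1 = lam B1 - lam (pball rho).
    rewrite lebesgue_pball// -(fineK fBn) -!EFinM -EFinB; congr EFin; ring.
  rewrite leeBrDr; last first.
    by rewrite lebesgue_pball// fin_numM.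
  rewrite -measureU//.
  - apply: le_measure; rewrite ?inE.
    + by apply: measurableU; [exact: measurable_sphere|exact: measurable_pball].
    + exact: measurable_punctured_ball.
    + move=> x /= [h|/andP[h1 h2]]; rewrite /punctured_ball/=.
        by rewrite h ltr01 lexx.
      by rewrite h1 (le_trans h2)// ltW.
  - exact: measurable_sphere.
  - exact: measurable_pball.
  - rewrite -subset0 => x /= [h1 /andP[_ h2]].
    by move: h2; rewrite h1 leNgt rho1.
apply/lee_addgt0Pr => e e0; rewrite add0e.
pose b := fine (lam B1).
have b0 : (0 <= b)%R by rewrite fine_ge0.
(* The radius will be [1 - d]: the minimum keeps it positive, and [1 - (1 - d) ^+ n <= n * d] makes
   the bound at most [e]. The denominator has [b + 1] since only [0 <= b] is at hand. *)
pose d : R := (Num.min (2^-1) (e / (n%:R * (b + 1))))%R.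
have nb0 : (0 < n%:R * (b + 1))%R by rewrite mulr_gt0// ?ltr0n// ltr_wpDl.
have d0 : (0 < d)%R by rewrite lt_min invr_gt0 ltr0n/= divr_gt0.
have d1 : (d < 1)%R.
  by rewrite gt_min invf_lt1 ?ltr1n.
apply: le_trans (key (1 - d)%R _) _; first by apply/andP; split; lra.
rewrite -(fineK fBn) -EFinM lee_fin -/b.
have h : (1 - (1 - d) ^+ n <= n%:R * d)%R.
  elim: (n) => [|m IH]; first by rewrite expr0 mul0r subrr.
  rewrite exprS mulrSr.
  have h2 : (0 <= (1 - d) ^+ m <= 1)%R.
    by rewrite exprn_ge0 ?exprn_ile1//=; lra.
  nra.
apply: (@le_trans _ _ (n%:R * d * (b + 1))%R).
  by apply: ler_pM => //; [rewrite subr_ge0 exprn_ile1//; lra | lra].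
rewrite mulrAC -ler_pdivlMl// mulrC.
by rewrite ge_min lexx orbT.
Qed.

(** Dilation by 2 fixes the origin, whose finite measure is therefore equal to itself times
    [2 ^+ n > 1]. *)
Lemma lebesgue_rV_set0 : (0 < n)%N -> lam [set 0%R] = 0.
Proof.
move=> n0.
have m0 : measurable ([set 0%R] : set 'rV[R]_n).
  rewrite (_ : [set _] = @enorm R n @^-1` [set 0%R]).
    by rewrite -[X in measurable X]setTI; apply: measurable_enorm.
  by apply/seteqP; split => x /=; [move=> ->; rewrite enorm0|exact: enorm0_eq0].
have f0 : lam [set 0%R] \is a fin_num.
  rewrite ge0_fin_numE//; apply: le_lt_trans (@lebesgue_rV_box_fin R n 1).
  apply: le_measure; rewrite ?inE//; first exact: measurable_box_rV.
  by move=> x /= -> i; rewrite mxE normr0.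
have := @lebesgue_rV_affine R n 2 0 _ (ltr0n _ 2) m0.
rewrite (_ : affine_rV 2 0 @^-1` _ = [set 0%R]); last first.
  apply/seteqP; split => x /=; rewrite /affine_rV addr0; last by move=> ->; rewrite scaler0.
  by move=> /eqP; rewrite scaler_eq0 pnatr_eq0/= => /eqP.
rewrite -(fineK f0) -EFinM => -[] /eqP.
rewrite -subr_eq0 -{2}(mul1r (fine _)) -mulrBl mulf_eq0 => /orP[|/eqP->//].
rewrite subr_eq0 => /eqP h; exfalso.
have : (1 < 2 ^+ n :> R)%R by rewrite exprn_egt1// ?ltr1n// -lt0n.
by rewrite h ltxx.
Qed.

End cone_scaling.

(** * Directional derivatives and the divergence theorem *)

Section directional_derivatives.
Context {R : realType} {V : normedModType R}.
Implicit Types (f g : V -> R) (x v : V) (a b : R).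

(** Reduces a derivative along [v] to one on the real line, from which the chain rule with real
    functions carries over. *)
Lemma is_derive_line f x v a :
  is_derive x v f a <-> is_derive (0 : R) (1 : R) (fun t => f (t *: v + x)) a.
Proof.
have E : (fun h : R => h^-1 *: (((fun t => f (t *: v + x)) \o shift (0 : R)) (h *: (1 : R))
      - f ((0 : R) *: v + x))) =
    (fun h : R => h^-1 *: ((f \o shift x) (h *: v) - f x)).
  apply/funext => h /=; rewrite scale0r add0r addr0.
  by rewrite /GRing.scale/= mulr1.
split => -[h1 h2].
  by split; rewrite /derivable/derive E.
by split; rewrite /derivable/derive -E.
Qed.

Lemma der_cst x v a : is_derive x v (fun=> a) 0.
Proof. exact: is_derive_cst. Qed.

Lemma derD f g x v a b : is_derive x v f a -> is_derive x v g b ->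
  is_derive x v (fun y => f y + g y) (a + b).
Proof. by move=> h1 h2; exact: (is_deriveD h1 h2). Qed.

Lemma derN f x v a : is_derive x v f a -> is_derive x v (fun y => - f y) (- a).
Proof. by move=> h1; exact: (is_deriveN h1). Qed.

Lemma derB f g x v a b : is_derive x v f a -> is_derive x v g b ->
  is_derive x v (fun y => f y - g y) (a - b).
Proof. by move=> h1 h2; exact: (is_deriveB h1 h2). Qed.

Lemma derM f g x v a b : is_derive x v f a -> is_derive x v g b ->
  is_derive x v (fun y => f y * g y) (a * g x + f x * b).
Proof.
move=> h1 h2; apply: is_derive_eq (is_deriveM h1 h2) _.
by rewrite /GRing.scale/= addrC mulrC.
Qed.

Lemma derX f n x v a : is_derive x v f a ->
  is_derive x v (fun y => f y ^+ n) (n%:R * f x ^+ n.-1 * a).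
Proof.
move=> h1; rewrite (_ : (fun y => _) = f ^+ n); first exact: is_deriveX.
by apply/funext => y; rewrite fctE.
Qed.

Lemma der_comp f (g : R -> R) x v a b : is_derive x v f a ->
  is_derive (f x) 1 g b -> is_derive x v (fun y => g (f y)) (b * a).
Proof.
move=> /is_derive_line h1 h2; apply/is_derive_line.
apply: (@is_derive1_comp _ g (fun t => f (t *: v + x))) => //.
by rewrite scale0r add0r.
Qed.

Lemma derV f x v a : f x != 0 -> is_derive x v f a ->
  is_derive x v (fun y => (f y)^-1) (- a / f x ^+ 2).
Proof.
move=> fx h1.
apply: is_derive_eq (der_comp h1 (is_deriveV fx (is_derive_id _ _))) _.
by rewrite /GRing.scale/= mulr1 mulNr mulNr mulrC.
Qed.

Lemma der_sum n (h : 'I_n -> V -> R) x v (dh : 'I_n -> R) :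
  (forall i, is_derive x v (h i) (dh i)) ->
  is_derive x v (fun y => \sum_i h i y) (\sum_i dh i).
Proof.
move=> H; rewrite (_ : (fun y => _) = \sum_i h i); last first.
  by apply/funext => y; rewrite fct_sumE.
exact: is_derive_sum.
Qed.

End directional_derivatives.

Lemma is_derive_continuous {R : realType} (F f : R -> R) :
  (forall x : R, is_derive x 1 F (f x)) -> continuous F.
Proof.
move=> dF x; apply: differentiable_continuous.
by apply/derivable1_diffP; have [] := dF x.
Qed.

Section ftc.
Context {R : realType}.

Lemma integral_derive (f F : R -> R) (a b : R) : a < b ->
  (forall x : R, is_derive x 1 F (f x)) -> continuous f ->
  (\int[lebesgue_measure]_(x in `[a, b]) (f x)%:E = (F b - F a)%:E)%E.
Proof.
move=> ab dF cf.
have cF := is_derive_continuous dF.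
rewrite EFinB; apply: continuous_FTC2 => //.
- exact: continuous_subspaceT.
- split.
  + by move=> x _; have [] := dF x.
  + exact: cvg_at_right_filter (cF a).
  + exact: cvg_at_left_filter (cF b).
- by move=> x _; rewrite derive1E; have [] := dF x.
Qed.

End ftc.

(** * Radial integration of the tent function *)

Section tent.
Local Open Scope ereal_scope.
Context {R : realType} (n : nat).
Local Notation lam := (@lebesgue_rV R n).
Local Notation B1 := (@punctured_ball R n).

Lemma integral_exprn : \int[@lebesgue_measure R]_(x in `[0%R, 1%R]) (x ^+ n)%:E =
  (n.+1%:R^-1)%:E.
Proof.
have dF (x : R) : is_derive x 1%R (fun x : R => n.+1%:R^-1 * x ^+ n.+1)%R (x ^+ n)%R.
  apply: is_derive_eq (derM (der_cst _ _ _) (derX n.+1 (is_derive_id _ _))) _.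
  by rewrite /= mul0r add0r mulr1 mulrA mulVf ?mul1r// pnatr_eq0.
rewrite (integral_derive _ dF)//; last exact: exprn_continuous.
by rewrite expr1n expr0n mulr0 subr0 mulr1.
Qed.

(** Layer cake: [1 - enorm x] is the length of [[enorm x, 1]]. By Tonelli the integral becomes one
    over [y] in []0, 1]] of the integral on the ball of radius [y], which is [y ^+ n] times that on
    the unit ball. *)
Lemma ge0_integral_tent (g : 'rV[R]_n -> R) : measurable_fun setT g ->
  (forall x, (0 <= g x)%R) ->
  \int[lam]_(x in B1) ((1 - enorm x) * g (normalize x))%:E =
  (n.+1%:R^-1)%:E * \int[lam]_(x in B1) (g (normalize x))%:E.
Proof.
move=> mg g0.
have mgn : measurable_fun setT (fun x => g (normalize x)).
  by apply: measurableT_comp => //; exact: measurable_normalize.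
pose A : set ('rV[R]_n * measurableTypeR R) :=
  [set z | [&& (0 < enorm z.1), (enorm z.1 <= z.2) & (z.2 <= 1)]%R].
have mA : measurable A.
  rewrite (_ : A = (fun z : 'rV[R]_n * measurableTypeR R =>
     [&& (0 < enorm z.1), (enorm z.1 <= z.2) & (z.2 <= 1)]%R) @^-1` [set true])//.
  rewrite -[X in measurable X]setTI.
  have me : measurable_fun setT (fun z : 'rV[R]_n * measurableTypeR R => enorm z.1).
    exact: (measurableT_comp (@measurable_enorm R n) measurable_fst).
  have m2 : measurable_fun setT (fun z : 'rV[R]_n * measurableTypeR R => z.2 : R).
    exact: measurable_snd.
  suff : measurable_fun setT (fun z : 'rV[R]_n * measurableTypeR R =>
     [&& (0 < enorm z.1), (enorm z.1 <= z.2) & (z.2 <= 1)]%R) by exact.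
  apply: measurable_and; first exact: measurable_fun_ltr.
  by apply: measurable_and; exact: measurable_fun_ler.
pose f (z : 'rV[R]_n * measurableTypeR R) : \bar R := (\1_A z * g (normalize z.1))%:E.
have mf : measurable_fun setT f.
  apply/measurable_EFinP/measurable_funM; first exact: measurable_indic.
  exact: (measurableT_comp mgn measurable_fst).
have f0 z : 0 <= f z by rewrite lee_fin mulr_ge0.
have := @fubini_tonelli _ _ _ _ _ lam (@lebesgue_measure R) f mf f0.
have -> : \int[lam]_x \int[lebesgue_measure]_y f (x, y) =
   \int[lam]_(x in B1) ((1 - enorm x) * g (normalize x))%:E.
  rewrite [RHS]integral_mkcond; apply: eq_integral => x _.
  rewrite patchE; case: ifPn => [|/negP]; rewrite inE /punctured_ball/= => hx.
    rewrite (_ : (fun y => f (x, y)) =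
       fun y => (g (normalize x))%:E * (\1_(`[enorm x, 1%R]) y)%:E); last first.
      apply/funext => y; rewrite /f /= -EFinM mulrC; congr (_ * _)%:E.
      rewrite !indicE; congr (nat_of_bool _)%:R.
      apply/idP/idP; rewrite !inE /A/= in_itv/=.
        by case/and3P => _ -> ->.
      by move=> ->; case/andP: hx => ->.
    rewrite ge0_integralZl ?lee_fin//; last exact/measurable_EFinP.
    rewrite integral_indic// setIT.
    transitivity ((g (normalize x))%:E * lebesgue_measure `[enorm x, 1%R]%classic) => //.
    rewrite lebesgue_measure_itv/= lte_fin.
    case/andP: hx => _; rewrite le_eqVlt => /orP[/eqP ->|->].
      by rewrite ltxx mule0 subrr mul0r.
    by rewrite -EFinB -EFinM mulrC.
  rewrite (_ : (fun y => f (x, y)) = cst 0); first by rewrite integral0.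
  apply/funext => y; rewrite /f /= indicE memNset ?mul0r// /A/= => /and3P[h1 h2 h3].
  by apply: hx; rewrite h1 (le_trans h2).
move=> ->.
rewrite (_ : (fun y => _) = (fun y : R => (\1_(`]0%R, 1%R]) y * y ^+ n)%:E *
   \int[lam]_(x in B1) (g (normalize x))%:E)); last first.
  apply/funext => y.
  rewrite indicE; case: (boolP (y \in _)) => [|/negP]; rewrite inE/= in_itv/=.
    move=> /andP[y0 y1]; rewrite mul1r -(@integral_pball _ _ y (EFin \o g))//; last first.
      exact/measurable_EFinP.
    rewrite [RHS]integral_mkcond; apply: eq_integral => x _.
    rewrite patchE /f indicE/=; case: ifPn => [|/negP]; rewrite inE /pball/= => hx.
      rewrite mem_set ?mul1r// /A/= y1; by case/andP : hx => -> ->.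
    rewrite memNset ?mul0r// /A/= => /and3P[h1 h2 h3].
    by apply: hx; rewrite h1 h2.
  move=> hy; rewrite mul0r mul0e; apply: integral0_eq => x _.
  rewrite /f indicE memNset ?mul0r// /A/= => /and3P[h1 h2 h3].
  by apply: hy; rewrite h3 (lt_le_trans h1).
rewrite ge0_integralZr//; last 3 first.
- apply/measurable_EFinP/measurable_funM; first exact: measurable_indic.
  exact: measurable_funX.
- move=> x _; rewrite lee_fin indicE; case: (boolP (x \in _)); last by rewrite mul0r.
  by rewrite inE/= in_itv/= mul1r => /andP[x0 _]; rewrite exprn_ge0// ltW.
- by apply: integral_ge0 => x _; rewrite lee_fin.
congr (_ * _); rewrite -integral_exprn -(integral_itv_obnd_cbnd (r := 0%R))//.
  rewrite [RHS]integral_mkcond; apply: eq_integral => x _.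
  by rewrite patchE indicE; case: ifPn => _; rewrite ?mul1r ?mul0r.
exact/measurable_EFinP/measurable_funX.
Qed.

Lemma integral_tent (g : 'rV[R]_n -> R) : measurable_fun setT g ->
  lam.-integrable B1 (fun x => (g (normalize x))%:E) ->
  \int[lam]_(x in B1) ((1 - enorm x) * g (normalize x))%:E =
  (n.+1%:R^-1)%:E * \int[lam]_(x in B1) (g (normalize x))%:E.
Proof.
move=> mg ig.
have mB := @measurable_punctured_ball R n.
have e1 x : B1 x -> (0 <= 1 - enorm x)%R by case/andP => _; rewrite subr_ge0.
have ip := integrable_pos_fin_num mB ig.
have im := integrable_neg_fin_num mB ig.
rewrite [X in _ * X]integralE muleBr//; last by rewrite fin_num_adde_defl// fin_numN.
rewrite [LHS]integralE; congr (_ - _).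
  transitivity (\int[lam]_(x in B1) ((1 - enorm x) * (g^\+ (normalize x)))%:E).
    apply: eq_integral => x /[!inE] /e1 x1.
    by rewrite !funeposE/= maxr_pMr// mulr0 EFin_max.
  rewrite ge0_integral_tent; last 2 first.
  - exact: measurable_funrpos.
  - exact: funrpos_ge0.
  congr (_ * _); apply: eq_integral => x _.
  by rewrite funeposE/= /funrpos EFin_max.
transitivity (\int[lam]_(x in B1) ((1 - enorm x) * (g^\- (normalize x)))%:E).
  apply: eq_integral => x /[!inE] /e1 x1.
  by rewrite !funenegE/= maxr_pMr// mulr0 EFin_max mulrN.
rewrite ge0_integral_tent; last 2 first.
- exact: measurable_funrneg.
- exact: funrneg_ge0.
congr (_ * _); apply: eq_integral => x _.
by rewrite funenegE/= /funrneg EFin_max.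
Qed.

End tent.

Section derivatives_rV.
Context {R : realType} {n : nat}.
Local Notation E := 'rV[R]_n.
Implicit Types (x y v : E).

Lemma der_coord x v i : is_derive x v (fun z : E => z ord0 i) (v ord0 i).
Proof.
apply/is_derive_line.
rewrite (_ : (fun t => _) = fun t => t * v ord0 i + x ord0 i); last first.
  by apply/funext => t; rewrite !mxE.
apply: is_derive_eq (derD (derM (is_derive_id _ _) (der_cst _ _ _)) (der_cst _ _ _)) _.
by rewrite mul1r mulr0 !addr0.
Qed.

Lemma der_dot x v y : is_derive x v (fun z => dot z y) (dot v y).
Proof.
apply: is_derive_eq (der_sum (fun i => derM (der_coord x v i) (der_cst _ _ (y ord0 i)))) _.
by apply: eq_bigr => i _; rewrite mulr0 addr0.
Qed.

Lemma der_sqdot x v : is_derive x v (fun z => dot z z) (2 * dot x v).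
Proof.
apply: is_derive_eq (der_sum (fun i => derM (der_coord x v i) (der_coord x v i))) _.
rewrite /dot mulr_sumr; apply: eq_bigr => i _; ring.
Qed.

Lemma der_enorm x v : x != 0 -> is_derive x v (@enorm R n) (dot (normalize x) v).
Proof.
rewrite -enorm_gt0 => x0.
have d0 : 0 < dot x x by rewrite -enorm_sqr exprn_gt0.
apply: is_derive_eq (der_comp (der_sqdot x v) (is_derive1_sqrt d0)) _.
rewrite /normalize dotZl -/(enorm x); field; exact: lt0r_neq0.
Qed.

Lemma differentiable_curve (gamma : R -> E) (w : E) (s : R) :
  (forall i, is_derive s 1 (fun t => gamma t ord0 i) (w ord0 i)) ->
  differentiable gamma s /\ 'D_1 gamma s = w.
Proof.
move=> H; have D : derivable gamma s 1.
  by apply/derivable_mxP => i j; rewrite ord1; have [] := H j.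
split; first exact/derivable1_diffP.
rewrite derive_mx//; apply/rowP => j; rewrite mxE; have [_] := H j; exact.
Qed.

Lemma der_curve (psi : E -> R) (gamma : R -> E) (w : E) (s : R) :
  differentiable psi (gamma s) ->
  (forall i, is_derive s 1 (fun t => gamma t ord0 i) (w ord0 i)) ->
  is_derive s 1 (fun t => psi (gamma t)) ('D_w psi (gamma s)).
Proof.
move=> dpsi /differentiable_curve[dg Dg].
have dc : differentiable (psi \o gamma) s by exact: differentiable_comp.
split; first exact/derivable1_diffP.
rewrite deriveE// diff_comp// [LHS]/= (deriveE w dpsi).
by congr ('d psi _ _); rewrite -deriveE.
Qed.

(** The differential of the radial projection is [(enorm x)^-1] times the orthogonal projection onto
    the tangent space at [normalize x]. *)
Lemma der_normalize x v i : x != 0 ->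
  is_derive x v (fun z => normalize z ord0 i)
    ((enorm x)^-1 * (v ord0 i - dot (normalize x) v * normalize x ord0 i)).
Proof.
move=> x0; have ex0 : enorm x != 0 by rewrite gt_eqF// enorm_gt0.
rewrite (_ : (fun z => _) = fun z => (enorm z)^-1 * z ord0 i); last first.
  by apply/funext => z; rewrite mxE.
apply: is_derive_eq (derM (derV ex0 (der_enorm v x0)) (der_coord x v i)) _.
rewrite mxE; field; exact: ex0.
Qed.

Lemma der_comp_normalize (psi : E -> R) x v : x != 0 ->
  differentiable psi (normalize x) ->
  is_derive x v (fun z => psi (normalize z))
    ((enorm x)^-1 * 'D_(v - dot (normalize x) v *: normalize x) psi (normalize x)).
Proof.
move=> x0 dpsi.
have E0 : (0 : R) *: v + x = x by rewrite scale0r add0r.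
apply/is_derive_line.
apply: is_derive_eq.
  apply: (@der_curve psi (fun t => normalize (t *: v + x))
    ((enorm x)^-1 *: (v - dot (normalize x) v *: normalize x)) 0).
    by rewrite E0.
  move=> i.
  apply: is_derive_eq ((is_derive_line _ _ _ _).1 (der_normalize v i x0)) _.
  by rewrite !mxE.
by rewrite /= E0 !deriveE// linearZ.
Qed.

End derivatives_rV.

Section difference_quotients.
Context {R : realType} {V : normedModType R}.
Implicit Types (f : V -> R) (x v : V) (a s : R).

Lemma is_derive_along f x v a s :
  is_derive (s *: v + x) v f a -> is_derive s (1 : R) (fun t => f (t *: v + x)) a.
Proof.
move=> /is_derive_line h.
have h1 : is_derive s (1 : R) (fun r : R => r - s) (1 - 0).
  exact: (derB (is_derive_id _ _) (der_cst _ _ _)).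
have h2 : is_derive (s - s) (1 : R) (fun t => f (t *: v + (s *: v + x))) a.
  by rewrite subrr.
apply: is_derive_eq.
  rewrite (_ : (fun t => _) = fun t => f ((t - s) *: v + (s *: v + x))); last first.
    by apply/funext => t; rewrite addrA -scalerDl subrK.
  exact: (der_comp h1 h2).
by rewrite subr0 mulr1.
Qed.

(** Steps along the sequence [harmonic], which never vanishes, give difference quotients in the form
    that dominated convergence takes. *)
Lemma cvg_difference_quotient f x v a : is_derive x v f a ->
  (f (x + harmonic j *: v) - f x) / harmonic j @[j --> \oo] --> a.
Proof.
move=> [df <-].
have /cvgr_dnbhsP : h^-1 *: ((f \o shift x) (h *: v) - f x) @[h --> 0^'] --> 'D_v f x.
  exact: df.
have hne j : (@harmonic R j) != 0 by rewrite invr_eq0.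
move=> /(_ (@harmonic R) (conj hne (@cvg_harmonic R))) H.
rewrite (_ : (fun j => _) = (fun j => (@harmonic R j)^-1 *:
   ((f \o shift x) (@harmonic R j *: v) - f x))) //.
by apply/funext => j; rewrite /= [RHS]mulrC [x + _]addrC.
Qed.

End difference_quotients.

(** * The divergence theorem for multiples of the latitude gradient *)

Section divergence.
Context {R : realType} (n : nat) (Phi : 'rV[R]_n).
Hypothesis n0 : (0 < n)%N.
Hypothesis Phi1 : dot Phi Phi = 1.
Local Notation E := 'rV[R]_n.
Local Notation lam := (@lebesgue_rV R n).
Local Notation sigma := (@surface_measure R n).
Local Notation S := (@sphere R n).
Local Notation B1 := (@punctured_ball R n).

Definition tang (x : E) : E := Phi - dot x Phi *: x.

Lemma enorm_Phi : enorm Phi = 1.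
Proof. by rewrite /enorm Phi1 sqrtr1. Qed.

Lemma normr_dot_sphere x : S x -> `|dot x Phi| <= 1.
Proof.
by move=> Sx; have := normr_dot_le x Phi; rewrite enorm_Phi mulr1 (Sx : enorm x = 1).
Qed.

Lemma enorm_addPhi (x : E) t : `|enorm (x + t *: Phi) - enorm x| <= `|t|.
Proof.
by have := enormB_le (x + t *: Phi) x; rewrite [x + _]addrC addrK enormZ enorm_Phi mulr1.
Qed.

Variables (psi chi : E -> R) (M : R).
Hypotheses (mpsi : measurable_fun setT psi) (mchi : measurable_fun setT chi).
Hypothesis dpsi : forall x, S x -> differentiable psi x.
Hypothesis chiE : forall x, S x -> 'D_(tang x) psi x = chi x.
Hypothesis psiM : forall x, S x -> `|psi x| <= M.
Hypothesis chiM : forall x, S x -> `|chi x| <= M.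

(* The extension of psi of homogeneity degree 1, cut off by [(1 - |x|)_+] is Lipschitz with
   compact support: by translation invariance of the Lebesgue measure, its
   derivative in the direction Phi has integral zero. *)
Let g (x : E) := psi (normalize x) * enorm x.
Let k (x : E) := Num.max (1 - enorm x) 0.
Let H (x : E) := g x * k x.
Let G (x : E) := \1_B1 x *
  ((1 - enorm x) * (chi (normalize x) + psi (normalize x) * dot (normalize x) Phi) -
   enorm x * (psi (normalize x) * dot (normalize x) Phi)).

Let M0 : 0 <= M.
Proof.
apply: le_trans (normr_ge0 (psi Phi)) (psiM _).
exact: enorm_Phi.
Qed.

Let dg x : x != 0 ->
  is_derive x Phi g (chi (normalize x) + psi (normalize x) * dot (normalize x) Phi).
Proof.
move=> x0; have Sx := normalize_sphere x0.
apply: is_derive_eq (derM (der_comp_normalize Phi x0 (dpsi Sx)) (der_enorm Phi x0)) _.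
rewrite -/(tang _) chiE// mulrAC mulVf ?mul1r// gt_eqF// enorm_gt0//.
Qed.

Let gM x : `|g x| <= M * enorm x.
Proof.
rewrite /g normrM (ger0_norm (enorm_ge0 _)).
have [->|x0] := eqVneq x 0; first by rewrite enorm0 !mulr0.
by rewrite ler_wpM2r ?enorm_ge0// psiM//; exact: normalize_sphere.
Qed.

Let dgM x : x != 0 ->
  `|chi (normalize x) + psi (normalize x) * dot (normalize x) Phi| <= 2 * M.
Proof.
move=> x0; have Sx := normalize_sphere x0.
apply: (le_trans (ler_normD _ _)); rewrite normrM mulrDl mul1r lerD ?chiM//.
by rewrite -[leRHS]mulr1 ler_pM// ?psiM// normr_dot_sphere.
Qed.

(** Away from the origin [g] is derivable along [Phi] with derivative at most [2 * M]. If the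
    segment meets the origin, the linear bound [gM] at both ends replaces the mean value theorem. *)
Let g_lip x t : 0 < t -> `|g (x + t *: Phi) - g x| <= 2 * M * t.
Proof.
move=> t0; have [[s /andP[s0 st] xs]|nx] :=
    pselect (exists2 s, 0 <= s <= t & s *: Phi + x = 0).
  have {}xs : x = - s *: Phi by apply/eqP; rewrite scaleNr -addr_eq0 addrC xs.
  apply: (le_trans (ler_normB _ _)); rewrite -mulrA mulr_natl mulr2n lerD//.
    apply: (le_trans (gM _)); rewrite ler_wpM2l//.
    by rewrite xs -scalerDl enormZ enorm_Phi mulr1 ger0_norm; lra.
  apply: (le_trans (gM _)); rewrite ler_wpM2l//.
  by rewrite xs enormZ enorm_Phi mulr1 normrN ger0_norm.
have ne s : s \in `[0, t] -> s *: Phi + x != 0.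
  by rewrite in_itv/= => sI; apply/eqP => e; apply: nx; exists s.
have der s : s \in `[0, t] -> is_derive s (1 : R) (fun r => g (r *: Phi + x)) _ :=
  fun sI => is_derive_along (dg (ne s sI)).
have [c cI] := MVT_segment (ltW t0) (fun s (sI : s \in `]0, t[) =>
   der s (subset_itv_oo_cc sI)) (derivable_within_continuous (fun s sI =>
     (let: DeriveDef h _ := der s sI in h))).
rewrite scale0r add0r subr0 [_ + x]addrC => ->.
by rewrite normrM (gtr0_norm t0) ler_wpM2r ?(ltW t0)// dgM// ne.
Qed.

Let k_ge0 x : 0 <= k x. Proof. by rewrite le_max lexx orbT. Qed.

Let k_le1 x : k x <= 1.
Proof. by rewrite ge_max ler01 gerBl enorm_ge0. Qed.

Let k_lip x t : 0 < t -> `|k (x + t *: Phi) - k x| <= t.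
Proof.
move=> t0; have := enorm_addPhi x t; rewrite (gtr0_norm t0) ler_norml => /andP[h1 h2].
rewrite /k /Num.max ler_norml; case: ifPn; case: ifPn; rewrite -?leNgt => h3 h4;
  apply/andP; split; lra.
Qed.

Let k_eq0 x : 1 <= enorm x -> k x = 0.
Proof. by move=> x1; rewrite /k; apply/max_idPr; rewrite subr_le0. Qed.

Let HM x : `|H x| <= M * \1_(@box_rV R n 1) x.
Proof.
rewrite normrM (ger0_norm (k_ge0 _)).
have [x1|x1] := leP (enorm x) 1.
  rewrite indicE mem_set ?mulr1; last by move=> i; exact: le_trans (le_coord_enorm _ _) x1.
  rewrite -[leRHS]mulr1 ler_pM ?k_le1//; apply: (le_trans (gM _)).
  by rewrite ler_piMr.
by rewrite k_eq0 ?(ltW x1)// mulr0 mulr_ge0.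
Qed.

Let H_lip x t : 0 < t <= 1 ->
  `|H (x + t *: Phi) - H x| <= 4 * M * t * \1_(@box_rV R n 2) x.
Proof.
move=> /andP[t0 t1].
(* Since [t <= 1], outside the ball of radius 2 both points have norm at least 1, where the cutoff
   vanishes. *)
have [x2|x2] := leP (enorm x) 2; last first.
  have := enorm_addPhi x t; rewrite (gtr0_norm t0) ler_norml => /andP[h1 h2].
  rewrite /H !k_eq0; [|lra..]; rewrite !mulr0 subrr normr0.
  by rewrite !mulr_ge0// ltW.
rewrite indicE mem_set ?mulr1; last by move=> i; exact: le_trans (le_coord_enorm _ _) x2.
rewrite (_ : H _ - H x = (g (x + t *: Phi) - g x) * k (x + t *: Phi) +
   g x * (k (x + t *: Phi) - k x)); last by rewrite /H; ring.
apply: (le_trans (ler_normD _ _)); rewrite !normrM.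
rewrite (_ : 4 * M * t = 2 * M * t + 2 * M * t); last ring.
apply: lerD.
  by rewrite -[leRHS]mulr1 ler_pM ?g_lip// ger0_norm ?k_le1.
apply: ler_pM => //; last exact: k_lip.
by rewrite -normrM -/(g x); apply: (le_trans (gM _)); rewrite mulrC ler_wpM2r.
Qed.

Let mpsin : measurable_fun setT (fun x => psi (normalize x)).
Proof. by apply: measurableT_comp => //; exact: measurable_normalize. Qed.

Let mchin : measurable_fun setT (fun x => chi (normalize x)).
Proof. by apply: measurableT_comp => //; exact: measurable_normalize. Qed.

Let mdotn : measurable_fun setT (fun x => dot (normalize x) Phi).
Proof.
by apply: (measurableT_comp (measurable_dot Phi)); exact: measurable_normalize.
Qed.

Let mH : measurable_fun setT H.
Proof.
apply: measurable_funM.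
  by apply: measurable_funM => //; exact: measurable_enorm.
by apply: measurable_maxr => //; apply: measurable_funB => //; exact: measurable_enorm.
Qed.

Let mG : measurable_fun setT G.
Proof.
have mB1 := @measurable_punctured_ball R n.
apply: measurable_funM; first exact: measurable_indic.
have me := @measurable_enorm R n.
have mpd := measurable_funM mpsin mdotn.
apply: measurable_funB; last exact: measurable_funM.
by apply: measurable_funM; [exact: measurable_funB|exact: measurable_funD].
Qed.

Let integrable_box (f : E -> R) C r : measurable_fun setT f ->
  (forall x, `|f x| <= C * \1_(@box_rV R n r) x) ->
  lam.-integrable setT (EFin \o f).
Proof.
move=> mf fC; have mB := @measurable_box_rV R n r.
apply: (@le_integrable _ _ _ _ _ _ _ (EFin \o (fun x => C * \1_(@box_rV R n r) x))) => //.
- exact/measurable_EFinP.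
- move=> x _; rewrite /= lee_fin; apply: le_trans (fC x) _; exact: ler_norm.
have := @integrableZl _ _ _ lam setT measurableT C (EFin \o \1_(@box_rV R n r)).
apply; apply/integrableP; split; first exact/measurable_EFinP/measurable_indic.
under eq_integral do rewrite /= ger0_norm//.
by rewrite integral_indic// setIT; exact: lebesgue_rV_box_fin.
Qed.

Let iH : lam.-integrable setT (EFin \o H).
Proof. exact: integrable_box HM. Qed.

Let mHt (t : R) : measurable_fun setT (fun x : E => H (x + t *: Phi)).
Proof.
rewrite (_ : (fun x => _) = H \o @affine_rV R n 1 (t *: Phi)).
  by apply: measurableT_comp => //; exact: measurable_affine_rV.
by apply/funext => x; rewrite /= /affine_rV scale1r.
Qed.

Let intHt (t : R) : (\int[lam]_x (H (x + t *: Phi))%:E = \int[lam]_x (H x)%:E)%E.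
Proof.
have mEH : measurable_fun setT (EFin \o H) by exact/measurable_EFinP.
have := integral_affine (t *: Phi) ltr01 measurableT mEH.
rewrite preimage_setT expr1n => <-; apply: eq_integral => x _.
by rewrite mul1e /affine_rV scale1r.
Qed.

Let cvgH x : x != 0 -> enorm x != 1 ->
  (H (x + harmonic j *: Phi) - H x) / harmonic j @[j --> \oo] --> G x.
Proof.
move=> x0 x1; rewrite /G.
have near_lt e : 0 < e -> \forall j \near \oo, @harmonic R j < e.
  move=> e0; have /cvgrPdist_lt/(_ _ e0) := @cvg_harmonic R.
  apply: filterS => j; rewrite sub0r normrN; exact: le_lt_trans (ler_norm _).
have hge j : 0 < @harmonic R j by rewrite invr_gt0.
have [xl1|x_gt1|/eqP] := ltgtP (enorm x) 1; last by rewrite (negbTE x1).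
  have -> : \1_B1 x = 1 :> R.
    by rewrite indicE mem_set// /punctured_ball/= enorm_gt0 x0 ltW.
  have d1 : is_derive x Phi (fun y => g y * (1 - enorm y)) _ :=
    derM (dg x0) (derB (der_cst _ _ _) (der_enorm Phi x0)).
  have := cvg_difference_quotient d1.
  rewrite (_ : _ * (1 - enorm x) + _ = 1 * ((1 - enorm x) * (chi (normalize x) +
     psi (normalize x) * dot (normalize x) Phi) -
     enorm x * (psi (normalize x) * dot (normalize x) Phi))); last by rewrite /g; ring.
  apply: cvg_trans; apply: near_eq_cvg.
  have := near_lt (1 - enorm x); rewrite subr_gt0 => /(_ xl1).
  apply: filterS => j hj.
  have := enorm_addPhi x (harmonic j); rewrite (gtr0_norm (hge j)) ler_norml => /andP[h1 h2].
  by rewrite /H /k !(max_l, @max_l _ _ (1 - enorm _)); [|lra..].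
have -> : \1_B1 x = 0 :> R.
  by rewrite indicE memNset// /punctured_ball/= leNgt x_gt1 andbF.
rewrite mul0r; apply: cvg_near_cst.
have := near_lt (enorm x - 1); rewrite subr_gt0 => /(_ x_gt1).
apply: filterS => j hj.
have := enorm_addPhi x (harmonic j); rewrite (gtr0_norm (hge j)) ler_norml => /andP[h1 h2].
by rewrite /H !k_eq0 ?mulr0 ?subrr ?mul0r//; lra.
Qed.

(** The difference quotients of [H] are dominated by [4 * M] on a box, and converge to [G] except at
    the origin and on the unit sphere, which are null. *)
Let intG : (lam.-integrable setT (EFin \o G) /\ \int[lam]_x (G x)%:E = 0)%E.
Proof.
pose f_ (j : nat) (x : E) : \bar R := ((H (x + harmonic j *: Phi) - H x) / harmonic j)%:E.
have hge j : 0 < @harmonic R j by rewrite invr_gt0.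
have hle j : @harmonic R j <= 1 by rewrite invf_le1// ler1n.
pose C : E -> \bar R := EFin \o (fun x => 4 * M * \1_(@box_rV R n 2) x).
have mB2 := @measurable_box_rV R n 2.
have mf_ j : measurable_fun setT (f_ j).
  by apply/measurable_EFinP/measurable_funM => //; exact: measurable_funB.
have f_C x j : (`|f_ j x| <= C x)%E.
  rewrite lee_fin normrM normfV (gtr0_norm (hge j)) ler_pdivrMr// mulrAC.
  by apply: H_lip; rewrite hge hle.
have iC : lam.-integrable setT C.
  apply: (@integrable_box _ (4 * M) 2).
    by apply: measurable_funM => //; exact: measurable_indic.
  by move=> x; rewrite ger0_norm// mulr_ge0// mulr_ge0.
have f_G : {ae lam, forall x, setT x -> f_ j x @[j --> \oo] --> (G x)%:E}.
  exists (S `|` [set 0]); split.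
  - apply: measurableU; first exact: measurable_sphere.
    rewrite (_ : [set _] = @enorm R n @^-1` [set 0]).
      by rewrite -[X in measurable X]setTI; apply: measurable_enorm.
    by apply/seteqP; split => x /=; [move=> ->; rewrite enorm0|exact: enorm0_eq0].
  - apply: null_set_setU.
    + exact: measurable_sphere.
    + rewrite (_ : [set _] = @enorm R n @^-1` [set 0]).
        by rewrite -[X in measurable X]setTI; apply: measurable_enorm.
      by apply/seteqP; split => x /=; [move=> ->; rewrite enorm0|exact: enorm0_eq0].
    + exact: lebesgue_sphere.
    + exact: lebesgue_rV_set0.
  move=> x /=; apply: contra_notP => /not_orP[/eqP x1 /eqP x0] _.
  by apply/fine_cvgP; split; [exact: nearW|exact: cvgH].
have [iG _] := dominated_convergence measurableT mf_ ((measurable_EFinP _ _).2 mG) f_G iC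
  (aeW _ (fun x j _ => f_C x j)).
have -> : (fun j => (\int[lam]_x f_ j x)%E) = cst 0%E.
  apply/funext => j /=.
  rewrite /f_; under eq_integral do rewrite mulrC EFinM EFinB.
  have iHt : lam.-integrable setT (fun x => (H (x + harmonic j *: Phi))%:E).
    apply: (@integrable_box _ M 2) => // x; apply: (le_trans (HM _)).
    rewrite ler_wpM2l// !indicE; case: (boolP (_ \in _)) => //.
    rewrite inE => hb; rewrite mem_set// => i.
    have := hb i; rewrite !mxE.
    have := le_coord_enorm Phi i; rewrite enorm_Phi.
    have := hle j; have := hge j.
    have := ler_normB (x ord0 i + harmonic j * Phi ord0 i) (harmonic j * Phi ord0 i).
    rewrite addrK normrM => h1 h2 h3 h4 h5.
    apply: (le_trans h1); rewrite (gtr0_norm h2).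
    have := mulr_ile1 (ltW h2) (normr_ge0 _) h3 h4; lra.
  rewrite integralZl//; last exact: integrableB.
  by rewrite integralB// intHt subee ?mule0// integrable_fin_num.
move=> /cvg_lim <-//; split => //.
by rewrite lim_cst.
Qed.

(** The integrand is the divergence of [psi] times [tang], as the divergence of [tang] is
    [- (n - 1)] times the latitude. *)
Lemma integral_divergence :
  (\int[sigma]_(x in S) (chi x - (n%:R - 1) * dot x Phi * psi x)%:E = 0)%E.
Proof.
have mB1 := @measurable_punctured_ball R n.
have int_bounded (f : E -> R) C : measurable_fun setT f ->
    (forall x, S x -> `|f x| <= C) ->
    lam.-integrable B1 (fun x => (f (normalize x))%:E).
  move=> mf fC; apply: measurable_bounded_integrable => //.
  - exact: lebesgue_punctured_ball_fin.
  - apply/measurable_funTS/measurableT_comp => //; exact: measurable_normalize.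
  - exists C; split; first exact: num_real.
    move=> y Cy x /andP[x0 _]; apply: le_trans (fC _ _) (ltW Cy).
    by apply: normalize_sphere; rewrite -enorm_gt0.
have md := @measurable_dot R n Phi.
have mpd : measurable_fun setT (fun x : E => psi x * dot x Phi).
  exact: measurable_funM.
have pdM x : S x -> `|psi x * dot x Phi| <= M.
  by move=> Sx; rewrite normrM -[leRHS]mulr1 ler_pM// ?psiM// normr_dot_sphere.
have m1 : measurable_fun setT (fun x : E => chi x + 2 * (psi x * dot x Phi)).
  by apply: measurable_funD => //; exact: measurable_funM.
have i1 : lam.-integrable B1 (fun x => (chi (normalize x) +
    2 * (psi (normalize x) * dot (normalize x) Phi))%:E).
  apply: (int_bounded (fun x => chi x + 2 * (psi x * dot x Phi)) (M + 2 * M)) => // x Sx.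
  apply: (le_trans (ler_normD _ _)); rewrite lerD ?chiM//.
  by rewrite normrM ger0_norm// ler_wpM2l// pdM.
have i2 := int_bounded _ _ mpd pdM.
have [_] := intG.
(* On the ball, with c the latitude, G = (1 - |x|) (chi + 2 c psi) - c psi. By [integral_tent], the
   vanishing of its integral says that chi + 2 c psi has the same integral as (n + 1) c psi. *)
have -> : (\int[lam]_x (G x)%:E = \int[lam]_(x in B1)
   (((1 - enorm x) * (chi (normalize x) +
        2 * (psi (normalize x) * dot (normalize x) Phi)))%:E -
    (psi (normalize x) * dot (normalize x) Phi)%:E))%E.
  rewrite [RHS]integral_mkcond; apply: eq_integral => x _.
  rewrite patchE /G indicE; case: ifPn => _; last by rewrite mul0r.
  by rewrite mul1r -EFinB; congr EFin; ring.
rewrite integralB//; last first.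
  apply: (@le_integrable _ _ _ _ _ _ _ _ _ _ i1) => //.
    apply/measurable_EFinP/measurable_funTS/measurable_funM.
      by apply: measurable_funB => //; exact: measurable_enorm.
    by apply: (measurableT_comp m1); exact: measurable_normalize.
  move=> x /andP[x0 x1]; rewrite lee_fin normrM ler_piMl//.
  by rewrite ger0_norm ?subr_ge0// gerBl enorm_ge0.
rewrite (@integral_tent _ _ (fun x => chi x + 2 * (psi x * dot x Phi)))//.
have f1 := integrable_fin_num mB1 i1.
have f2 := integrable_fin_num mB1 i2.
move=> e0.
rewrite -integral_surface; last first.
  apply/measurable_EFinP; apply: measurable_funB => //; apply: measurable_funM => //.
  exact: measurable_funM.
have -> : (\int[lam]_(x in B1) (n%:R%:E * (chi (normalize x) - (n%:R - 1) *
    dot (normalize x) Phi * psi (normalize x))%:E) =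
  \int[lam]_(x in B1) (n%:R%:E * ((chi (normalize x) +
    2 * (psi (normalize x) * dot (normalize x) Phi))%:E -
    (n.+1%:R%:E * (psi (normalize x) * dot (normalize x) Phi)%:E))))%E.
  apply: eq_integral => x _; rewrite -!(EFinM, EFinB, EFinD); congr EFin.
  by rewrite -(natr1 n); ring.
rewrite integralZl//; last by apply: integrableB => //; exact: integrableZl.
rewrite integralB//; last exact: integrableZl.
rewrite integralZl//.
move: e0; rewrite -(fineK f1) -(fineK f2) -!(EFinM, EFinB) => -[/eqP].
rewrite subr_eq0 => /eqP e0; congr EFin.
rewrite -e0 mulrA mulfV ?mul1r ?subrr ?mulr0// pnatr_eq0//.
Qed.

End divergence.

(** * The conformal flow and the transported test functions *)

Section near_differentiable.
Context {R : realType} {V W : normedModType R}.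

Lemma near_eq_differentiable (f g : V -> W) (x : V) :
  (\near x, f x = g x) -> differentiable f x -> differentiable g x.
Proof.
move=> fg df; have fgx : f x = g x by exact: (nbhs_singleton fg).
have h : g \o shift x = cst (g x) + 'd f x +o_ 0 id.
  apply/eqaddoP => e e0; have /eqaddoP/(_ e e0) := diff_locally df.
  have fg0 : \forall h \near (0 : V), f (h + x) = g (h + x).
    by move: fg; rewrite (near_shift 0 x); apply: filterS => h /=; rewrite subr0.
  move=> H; apply: filterS2 fg0 H => h /= fgh.
  by rewrite !fctE /= fgh fgx.
have dfc : continuous ('d f x) by exact: diff_continuous.
have dE := diff_unique dfc h.
apply/diff_locallyP; split; first by rewrite dE.
by rewrite dE.
Qed.

End near_differentiable.

(** * Closure properties of smooth functions *)

Section smooth_closure.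
Context {R : realType} {n : nat}.
Local Notation E := 'rV[R]_n.
Variable U : set E.
Hypothesis oU : open U.
Implicit Types (f g : E -> R) (k : nat).

(** Form of [smooth_on] graded by order: the iterated partial derivatives of order at most [k] are
    differentiable on [U]. Here the derivative of [f] itself is taken first, so that the product and
    chain rules go by induction on [k]. *)
Fixpoint cdiff k f : Prop := (forall x, U x -> differentiable f x) /\
  (if k is k'.+1 then forall i, cdiff k' (partial i f) else True).

Lemma cdiff_diff k f x : cdiff k f -> U x -> differentiable f x.
Proof. by case: k => [|k] [h _]; exact: h. Qed.

Let nearU x f g : U x -> (forall x, U x -> f x = g x) -> \near x, f x = g x.
Proof.
move=> Ux fg; have : nbhs x U by apply: open_nbhs_nbhs; split.
by apply: filterS => y; exact: fg.
Qed.

(** Closed formulas for derivatives hold on [U] only; as [U] is open this determines all further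
    derivatives on [U]. *)
Lemma cdiff_eq k f g : (forall x, U x -> f x = g x) -> cdiff k f -> cdiff k g.
Proof.
elim: k f g => [|k IH] f g fg [df pf]; split => //.
- by move=> x Ux; apply: near_eq_differentiable (df x Ux); exact: nearU.
- by move=> x Ux; apply: near_eq_differentiable (df x Ux); exact: nearU.
move=> i; apply: IH (pf i) => x Ux.
apply: near_eq_derive; exact: nearU.
Qed.

Lemma cdiffS k f : cdiff k.+1 f -> cdiff k f.
Proof.
elim: k f => [|k IH] f [df pf]; split => //.
by move=> i; exact/IH/pf.
Qed.

Lemma smooth_on_cdiff f : (forall k, cdiff k f) -> smooth_on U f.
Proof.
move=> cf s; elim/last_ind: s f cf => [|s i IH] f cf x Ux.
  exact: cdiff_diff (cf 0%N) Ux.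
rewrite foldr_rcons; apply: IH => // k.
by have [_] := cf k.+1; exact.
Qed.

Lemma cdiff_cst k (a : R) : cdiff k (fun=> a).
Proof.
elim: k a => [|k IH] a; (split; first by move=> x _; exact: differentiable_cst) => // i.
apply: cdiff_eq (IH 0) => x _.
by rewrite /partial; have [_ ->] := der_cst x (delta_mx ord0 i : E) a.
Qed.

Lemma cdiff_coord k (j : 'I_n) : cdiff k (fun x => x ord0 j).
Proof.
case: k => [|k]; (split; first by move=> x _; exact: differentiable_coord) => // i.
apply: cdiff_eq (cdiff_cst k ((delta_mx ord0 i : E) ord0 j)) => x _.
by rewrite /partial; have [_ ->] := der_coord x (delta_mx ord0 i : E) j.
Qed.

Let pder k f x i : cdiff k f -> U x ->
  is_derive x (delta_mx ord0 i : E) f (partial i f x).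
Proof.
by move=> cf Ux; apply: derivableP; apply: diff_derivable; exact: cdiff_diff cf Ux.
Qed.

Lemma cdiffD k f g : cdiff k f -> cdiff k g -> cdiff k (fun x => f x + g x).
Proof.
elim: k f g => [|k IH] f g cf cg; (split; first by move=> x Ux;
  apply: differentiableD; [exact: cdiff_diff cf Ux|exact: cdiff_diff cg Ux]) => // i.
apply: cdiff_eq (IH _ _ (cf.2 i) (cg.2 i)) => x Ux.
by rewrite /partial; have [_ ->] := derD (pder i cf Ux) (pder i cg Ux).
Qed.

Lemma cdiffM k f g : cdiff k f -> cdiff k g -> cdiff k (fun x => f x * g x).
Proof.
elim: k f g => [|k IH] f g cf cg; (split; first by move=> x Ux;
  apply: differentiableM; [exact: cdiff_diff cf Ux|exact: cdiff_diff cg Ux]) => // i.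
apply: cdiff_eq (cdiffD (IH _ _ (cf.2 i) (cdiffS cg)) (IH _ _ (cdiffS cf) (cg.2 i))) => x Ux.
by rewrite /partial; have [_ ->] := derM (pder i cf Ux) (pder i cg Ux).
Qed.

Lemma cdiff_expR k f : cdiff k f -> cdiff k (fun x => expR (f x)).
Proof.
have dexp g x : differentiable g x -> differentiable (fun x => expR (g x)) x.
  move=> dg; apply: (@differentiable_comp _ _ _ _ g expR) => //.
  exact/derivable1_diffP.
elim: k f => [|k IH] f cf; (split; first by move=> x Ux;
  apply: dexp; exact: cdiff_diff cf Ux) => // i.
apply: cdiff_eq (cdiffM (IH _ (cdiffS cf)) (cf.2 i)) => x Ux.
by rewrite /partial; have [_ ->] := der_comp (pder i cf Ux) (is_derive_expR (f x)).
Qed.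

Lemma cdiffV k f : (forall x, U x -> f x != 0) -> cdiff k f ->
  cdiff k (fun x => (f x)^-1).
Proof.
move=> f0.
elim: k => [|k IH] cf; (split; first by move=> x Ux;
  apply: differentiableV; [exact: cdiff_diff cf Ux|exact: f0]) => // i.
have cV := IH (cdiffS cf).
apply: cdiff_eq (cdiffM (cdiffM (cdiff_cst k (-1)) (cf.2 i)) (cdiffM cV cV)) => x Ux.
rewrite /partial; have [_ ->] := derV (f0 x Ux) (pder i cf Ux).
by rewrite mulN1r -expr2 exprVn.
Qed.

Lemma cdiff_sum k m (h : 'I_m -> E -> R) : (forall i, cdiff k (h i)) ->
  cdiff k (fun x => \sum_i h i x).
Proof.
move=> ch; rewrite (_ : (fun x => _) = \sum_i h i); last first.
  by apply/funext => y; rewrite fct_sumE.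
elim/big_ind : _ => //; first exact: cdiff_cst.
by move=> f g; exact: cdiffD.
Qed.

Lemma cdiffX k f m : cdiff k f -> cdiff k (fun x => f x ^+ m).
Proof.
move=> cf; elim: m => [|m IH].
  by apply: cdiff_eq (cdiff_cst k 1) => x _; rewrite expr0.
by apply: cdiff_eq (cdiffM cf IH) => x _; rewrite exprS.
Qed.

End smooth_closure.

(** * Hyperbolic functions and the latitude along the flow *)

Section hyperbolic.
Context {R : realType}.
Implicit Types (s c : R).

Definition coshR s : R := (expR s + expR (- s)) / 2.
Definition sinhR s : R := (expR s - expR (- s)) / 2.

(** The flow is a Lorentz boost acting on light rays: the boost of rapidity [s] along [Phi] sends
    the vector (1, x), where c = x.Phi, to one with time component [flow_den s c] and [Phi]
    component [flow_dden s c]. Their quotient [flow_lat] is the new latitude, and the inverse of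
    [flow_den] is the conformal factor. *)
Definition flow_den s c : R := coshR s + c * sinhR s.
Definition flow_dden s c : R := sinhR s + c * coshR s.

Lemma coshR_sinhR s : coshR s ^+ 2 - sinhR s ^+ 2 = 1.
Proof.
rewrite /coshR /sinhR expRN; have := expR_gt0 s; set e := expR s => e0.
by field; rewrite gt_eqF.
Qed.

Lemma sinhR_sqr s : sinhR s ^+ 2 = coshR s ^+ 2 - 1.
Proof. by rewrite -(coshR_sinhR s); ring. Qed.

Lemma coshRN s : coshR (- s) = coshR s.
Proof. by rewrite /coshR opprK addrC. Qed.

Lemma sinhRN s : sinhR (- s) = - sinhR s.
Proof. by rewrite /sinhR opprK -mulNr opprB. Qed.

Lemma coshR0 : coshR 0 = 1.
Proof. by rewrite /coshR oppr0 expR0 -mulr2n -mulr_natr mul1r divff. Qed.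

Lemma sinhR0 : sinhR 0 = 0.
Proof. by rewrite /sinhR oppr0 subrr mul0r. Qed.

Lemma is_derive_expRN s : is_derive s 1 (fun s => expR (- s)) (- expR (- s)).
Proof.
apply: is_derive_eq (der_comp (derN (is_derive_id s 1)) (is_derive_expR _)) _.
by rewrite mulrN1.
Qed.

Lemma is_derive_coshR s : is_derive s 1 coshR (sinhR s).
Proof.
apply: is_derive_eq (derM (derD (is_derive_expR s) (is_derive_expRN s))
  (der_cst _ _ (2^-1))) _.
by rewrite mulr0 addr0.
Qed.

Lemma is_derive_sinhR s : is_derive s 1 sinhR (coshR s).
Proof.
apply: is_derive_eq (derM (derB (is_derive_expR s) (is_derive_expRN s))
  (der_cst _ _ (2^-1))) _.
by rewrite mulr0 addr0 opprK.
Qed.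

(** [flow_den s c] is the convex combination of [expR s] and [expR (- s)] with weights (1 + c) / 2
    and (1 - c) / 2. *)
Lemma flow_den_ge s c : `|c| <= 1 -> expR (- `|s|) <= flow_den s c.
Proof.
rewrite ler_norml => /andP[c1 c2].
rewrite (_ : flow_den s c = ((1 + c) * expR s + (1 - c) * expR (- s)) / 2); last first.
  by rewrite /flow_den /coshR /sinhR; field.
have h1 : expR (- `|s|) <= expR s by rewrite ler_expR lerNl -normrN ler_norm.
have h2 : expR (- `|s|) <= expR (- s) by rewrite ler_expR lerN2 ler_norm.
by nra.
Qed.

Lemma flow_den_gt0 s c : `|c| <= 1 -> 0 < flow_den s c.
Proof. by move=> c1; apply: lt_le_trans (flow_den_ge s c1); exact: expR_gt0. Qed.

Lemma flow_dden_le s c : `|c| <= 1 -> `|flow_dden s c| <= flow_den s c.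
Proof.
rewrite !ler_norml => /andP[c1 c2].
have h1 := expR_gt0 s; have h2 := expR_gt0 (- s).
rewrite /flow_den /flow_dden /coshR /sinhR; apply/andP; split; nra.
Qed.

Lemma flow_den0 c : flow_den 0 c = 1.
Proof. by rewrite /flow_den coshR0 sinhR0 mulr0 addr0. Qed.

Lemma flow_dden0 c : flow_dden 0 c = c.
Proof. by rewrite /flow_dden coshR0 sinhR0 mulr1 add0r. Qed.

Lemma is_derive_flow_den s c : is_derive s 1 (flow_den ^~ c) (flow_dden s c).
Proof.
apply: is_derive_eq (derD (is_derive_coshR s) (derM (der_cst _ _ c) (is_derive_sinhR s))) _.
by rewrite mul0r add0r.
Qed.

Lemma is_derive_flow_dden s c : is_derive s 1 (flow_dden ^~ c) (flow_den s c).
Proof.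
apply: is_derive_eq (derD (is_derive_sinhR s) (derM (der_cst _ _ c) (is_derive_coshR s))) _.
by rewrite mul0r add0r.
Qed.

Definition flow_lat s c : R := flow_dden s c / flow_den s c.

Lemma flow_lat_le1 s c : `|c| <= 1 -> `|flow_lat s c| <= 1.
Proof.
move=> c1; have h := flow_den_gt0 s c1.
by rewrite normrM normfV (gtr0_norm h) ler_pdivrMr// mul1r flow_dden_le.
Qed.

(** The conformal factor of a map at a point and that of the inverse map at the image are
    reciprocal. *)
Lemma flow_denN s c : `|c| <= 1 -> flow_den (- s) (flow_lat s c) = (flow_den s c)^-1.
Proof.
move=> c1; have h := flow_den_gt0 s c1.
rewrite {1}/flow_den coshRN sinhRN /flow_lat.
set d := flow_den s c in h *; have d0 := lt0r_neq0 h.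
rewrite (_ : _ + _ = (coshR s * d - flow_dden s c * sinhR s) / d); last by field.
rewrite (_ : _ - _ = 1) ?mul1r// -(coshR_sinhR s) /d /flow_den /flow_dden; ring.
Qed.

End hyperbolic.

Section flow.
Context {R : realType} (n : nat) (Phi : 'rV[R]_n).
Hypothesis n0 : (0 < n)%N.
Hypothesis Phi1 : dot Phi Phi = 1.
Local Notation E := 'rV[R]_n.
Local Notation S := (@sphere R n).
Local Notation lat x := (dot x Phi).
Implicit Types (x : E) (s : R).

(* The flow of the vector field [tang Phi] of the sphere, which is conformal,
   and its Jacobian determinant. *)
Definition flow s x : E :=
  (flow_den s (lat x))^-1 *: (x + (sinhR s + (coshR s - 1) * lat x) *: Phi).

Definition jac s x : R := (flow_den s (lat x))^-1 ^+ n.-1.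

Lemma lat_flow s x : lat (flow s x) = flow_lat s (lat x).
Proof.
rewrite /flow dotZl dotDl dotZl Phi1 mulr1 /flow_lat [RHS]mulrC; congr (_ * _).
by rewrite /flow_dden; ring.
Qed.

Lemma sphere_flow s x : S x -> S (flow s x).
Proof.
move=> Sx; apply/sphereE; have h := flow_den_gt0 s (normr_dot_sphere Phi1 Sx).
have xx : dot x x = 1 by apply/sphereE.
rewrite /flow dotZl dotZr !(dotDl, dotDr, dotZl, dotZr) Phi1 xx (dotC Phi x).
set c := dot x Phi in h *; set b := _ + _ * c.
rewrite mulrA -invfM -expr2 mulrC; apply: (mulIf (_ : flow_den s c ^+ 2 != 0)).
  by rewrite sqrf_eq0 gt_eqF.
rewrite mulfVK ?sqrf_eq0 ?gt_eqF// mul1r /flow_den /b.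
have e := sinhR_sqr s.
by ring: e.
Qed.

Lemma flowK s x : S x -> flow (- s) (flow s x) = x.
Proof.
move=> Sx; have c1 := normr_dot_sphere Phi1 Sx; have h := flow_den_gt0 s c1.
rewrite {1}/flow lat_flow flow_denN// invrK scalerDr !scalerA.
rewrite mulfV ?gt_eqF// scale1r -addrA -scalerDl.
rewrite [X in X *: Phi](_ : _ = 0) ?scale0r ?addr0// coshRN sinhRN /flow_lat.
rewrite mulrDr mulrCA [flow_den _ _ * (_ / _)]mulrC mulfVK ?gt_eqF//.
have e := sinhR_sqr s; rewrite /flow_den /flow_dden.
by ring: e.
Qed.

Lemma jac_gt0 s x : S x -> 0 < jac s x.
Proof. by move=> Sx; rewrite exprn_gt0// invr_gt0 flow_den_gt0// normr_dot_sphere. Qed.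

Lemma jac_le s x : S x -> jac s x <= expR (`|s| * n.-1%:R).
Proof.
move=> Sx; have h := flow_den_ge s (normr_dot_sphere Phi1 Sx).
have h0 := flow_den_gt0 s (normr_dot_sphere Phi1 Sx).
rewrite expRM_natr; apply: lerXn2r; rewrite ?nnegrE ?expR_ge0 ?invr_ge0 ?(ltW h0)//.
by rewrite -[leRHS]invrK -expRN lef_pV2// posrE expR_gt0.
Qed.

Lemma is_derive_flow_coord s x i : S x ->
  is_derive s 1 (fun s => flow s x ord0 i) (Phi ord0 i - flow_lat s (lat x) * flow s x ord0 i).
Proof.
move=> Sx; have h := flow_den_gt0 s (normr_dot_sphere Phi1 Sx); have h0 := lt0r_neq0 h.
rewrite (_ : (fun s => _) = fun s => (flow_den s (lat x))^-1 *
   (x ord0 i + (sinhR s + (coshR s - 1) * lat x) * Phi ord0 i)); last first.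
  by apply/funext => t; rewrite !mxE.
apply: is_derive_eq (derM (@derV _ _ (flow_den ^~ (lat x)) s 1 _ h0 (is_derive_flow_den s (lat x)))
  (derD (der_cst _ _ _) (derM (derD (is_derive_sinhR s)
     (derM (derB (is_derive_coshR s) (der_cst _ _ _)) (der_cst _ _ _))) (der_cst _ _ _)))) _.
rewrite /flow_lat !mxE; set d := flow_den _ _ in h0 *.
rewrite !(mulr0, addr0, add0r, subr0).
rewrite [X in d^-1 * (X * _)](_ : _ = d); last by rewrite /d /flow_den; ring.
by field.
Qed.

(** The differential of F_s preserves its generator: deriving along [tang Phi x] gives the same
    vector as deriving in time in [is_derive_flow_coord]. Hence, for a function composed with F_s,
    the derivative along X and the derivative in time agree. *)
Lemma is_derive_flow_coord_tang s x i : S x ->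
  is_derive x (tang Phi x) (fun y => flow s y ord0 i)
    (Phi ord0 i - flow_lat s (lat x) * flow s x ord0 i).
Proof.
move=> Sx; have h := flow_den_gt0 s (normr_dot_sphere Phi1 Sx); have h0 := lt0r_neq0 h.
rewrite (_ : (fun y => _) = fun y => (flow_den s (lat y))^-1 *
   (y ord0 i + (sinhR s + (coshR s - 1) * lat y) * Phi ord0 i)); last first.
  by apply/funext => t; rewrite !mxE.
have dl := der_dot x (tang Phi x) Phi.
apply: is_derive_eq (derM (@derV _ _ (fun y => flow_den s (lat y)) x _ _ h0
  (derD (der_cst _ _ (coshR s)) (derM dl (der_cst _ _ (sinhR s)))))
  (derD (der_coord x (tang Phi x) i) (derM (derD (der_cst _ _ (sinhR s))
     (derM (der_cst _ _ (coshR s - 1)) dl)) (der_cst _ _ (Phi ord0 i))))) _.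
have -> : lat (tang Phi x) = 1 - lat x ^+ 2.
  by rewrite /tang dotDl dotNl dotZl Phi1 expr2.
have -> : tang Phi x ord0 i = Phi ord0 i - lat x * x ord0 i by rewrite !mxE.
rewrite /flow_lat !mxE -/(flow_den s (lat x)).
rewrite /flow_dden /flow_den in h0 *.
by field.
Qed.

End flow.

Lemma der_invX {R : realType} {V : normedModType R} (f : V -> R) m (x v : V) (a : R) :
  f x != 0 -> is_derive x v f a ->
  is_derive x v (fun y => (f y)^-1 ^+ m) (- m%:R * (a / f x) * (f x)^-1 ^+ m).
Proof.
move=> fx df; apply: is_derive_eq (derX m (derV fx df)) _.
case: m => [|m]; first by rewrite !mul0r oppr0 !mul0r.
by rewrite [in RHS]exprS /=; field.
Qed.

Section bump.
Context {R : realType} {n : nat}.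
Local Notation E := 'rV[R]_n.
Variables (k : R) (a : E).
Implicit Types x y : E.

(* As k tends to infinity this tends to the indicator function of the open
   orthant of corner a, at every point and with values in [0, 1]. *)
Definition bump y : R := expR (- \sum_i expR (k - k ^+ 2 * (y ord0 i - a ord0 i))).

Lemma bump_gt0 y : 0 < bump y. Proof. exact: expR_gt0. Qed.

Lemma bump_le1 y : bump y <= 1.
Proof.
by rewrite expR_le1 oppr_le0 sumr_ge0// => i _; exact: expR_ge0.
Qed.

Lemma measurable_bump : measurable_fun setT bump.
Proof.
apply: measurableT_comp; first exact: measurable_expR.
apply: measurableT_comp => //; apply: measurable_sum => i.
apply: measurableT_comp; first exact: measurable_expR.
apply: measurable_funB => //; apply: measurable_funM => //.
by apply: measurable_funB => //; exact: measurable_rV_coord.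
Qed.

(** The logarithmic derivative of [bump] at [y] in the direction [w]. *)
Definition dbump y (w : 'I_n -> R) : R :=
  \sum_i k ^+ 2 * expR (k - k ^+ 2 * (y ord0 i - a ord0 i)) * w i.

Lemma der_bump (V : normedModType R) (F : V -> E) (t v : V) (w : 'I_n -> R) :
  (forall i, is_derive t v (fun t => F t ord0 i) (w i)) ->
  is_derive t v (fun t => bump (F t)) (bump (F t) * dbump (F t) w).
Proof.
move=> dF.
apply: is_derive_eq (der_comp (derN (der_sum (fun i => der_comp (derB (der_cst _ _ k)
  (derM (der_cst _ _ (k ^+ 2)) (derB (dF i) (der_cst _ _ (a ord0 i))))) (is_derive_expR _))))
  (is_derive_expR _)) _.
rewrite /bump /dbump; congr (_ * _); rewrite -sumrN; apply: eq_bigr => i _.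
by ring.
Qed.

Lemma normr_dbump_le y w : (forall i, `|y ord0 i| <= 1) -> (forall i, `|w i| <= 2) ->
  `|dbump y w| <= \sum_i k ^+ 2 * expR (`|k| + k ^+ 2 * (1 + `|a ord0 i|)) * 2.
Proof.
move=> y1 w2; apply: (le_trans (ler_norm_sum _ _ _)); apply: ler_sum => i _.
have e0 : 0 <= k ^+ 2 * expR (k - k ^+ 2 * (y ord0 i - a ord0 i)).
  by rewrite mulr_ge0 ?sqr_ge0 ?expR_ge0.
rewrite normrM (ger0_norm e0); apply: ler_pM => //.
rewrite ler_wpM2l ?sqr_ge0// ler_expR lerD ?ler_norm// -mulrN ler_wpM2l ?sqr_ge0//.
by have := y1 i; have := ler_norm (a ord0 i); rewrite ler_norml => ? /andP[]; lra.
Qed.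

End bump.

Section flow_test.
Context {R : realType} (n : nat) (Phi : 'rV[R]_n).
Hypothesis n0 : (0 < n)%N.
Hypothesis Phi1 : dot Phi Phi = 1.
Local Notation E := 'rV[R]_n.
Local Notation S := (@sphere R n).
Local Notation lat x := (dot x Phi).
Variables (k : R) (a : E).
Implicit Types (x y : E) (s : R).

(** The factor [jac] makes this a transported density: its time derivative [dflow_test] is the
    divergence of its product with [tang Phi], so pairing with a function can be differentiated in
    time through the weak derivative. *)
Definition flow_test s x : R := bump k a (flow Phi s x) * jac Phi s x.

Definition dflow_test s x : R := flow_test s x *
  (dbump k a (flow Phi s x)
     (fun i => Phi ord0 i - flow_lat s (lat x) * flow Phi s x ord0 i) -
   n.-1%:R * flow_lat s (lat x)).

Lemma is_derive_flow_test s x : S x ->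
  is_derive s 1 (flow_test ^~ x) (dflow_test s x).
Proof.
move=> Sx; have h0 := lt0r_neq0 (flow_den_gt0 s (normr_dot_sphere Phi1 Sx)).
apply: is_derive_eq (derM
  (der_bump k a (fun i => is_derive_flow_coord Phi1 s i Sx))
  (@der_invX _ _ (flow_den ^~ (lat x)) n.-1 s 1 _ h0 (is_derive_flow_den s (lat x)))) _.
rewrite /dflow_test /flow_test /jac -/(flow_lat s (lat x)); ring.
Qed.

(** The bump factor has the same derivative along X as in time, while for the Jacobian factor the
    two differ by [n.-1] times the latitude. That difference is what the divergence of X cancels. *)
Lemma is_derive_flow_test_tang s x : S x ->
  is_derive x (tang Phi x) (flow_test s)
    (dflow_test s x + n.-1%:R * lat x * flow_test s x).
Proof.
move=> Sx; have h0 := lt0r_neq0 (flow_den_gt0 s (normr_dot_sphere Phi1 Sx)).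
have dl := der_dot x (tang Phi x) Phi.
apply: is_derive_eq (derM
  (der_bump k a (fun i => is_derive_flow_coord_tang Phi1 s i Sx))
  (@der_invX _ _ (fun y => flow_den s (lat y)) n.-1 x _ _ h0
    (derD (der_cst _ _ (coshR s)) (derM dl (der_cst _ _ (sinhR s)))))) _.
have -> : lat (tang Phi x) = 1 - lat x ^+ 2.
  by rewrite /tang dotDl dotNl dotZl Phi1 expr2.
rewrite mulr0 addr0 add0r.
have -> : (1 - lat x ^+ 2) * sinhR s / flow_den s (lat x) = flow_lat s (lat x) - lat x.
  by rewrite /flow_lat /flow_dden; move: h0; rewrite /flow_den => h0; field.
rewrite /dflow_test /flow_test /jac; ring.
Qed.

Lemma cdiff_lat U m : open U -> cdiff U m (fun x => lat x).
Proof.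
move=> oU; apply: cdiff_sum => // i; apply: cdiffM => //; first exact: cdiff_coord.
exact: cdiff_cst.
Qed.

Lemma cdiff_tang U m i : open U -> cdiff U m (fun x => tang Phi x ord0 i).
Proof.
move=> oU.
apply: (@cdiff_eq _ _ U oU _ (fun x => Phi ord0 i + -1 * (lat x * x ord0 i))).
  by move=> x _; rewrite !mxE mulN1r.
apply: cdiffD => //; first exact: cdiff_cst.
apply: cdiffM => //; first exact: cdiff_cst.
apply: cdiffM => //; [exact: cdiff_lat|exact: cdiff_coord].
Qed.

(** A neighborhood of the sphere on which the formula of the flow has no pole, as smoothness of a
    test field is required on an open set. *)
Definition flow_dom s : set E := [set x | 0 < flow_den s (lat x)].

Lemma open_flow_dom s : open (flow_dom s).
Proof.
rewrite (_ : flow_dom s = (fun x => flow_den s (lat x)) @^-1` [set r | 0 < r])//.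
apply: open_comp; last exact: open_gt.
move=> x _; apply: differentiable_continuous.
apply: (@cdiff_diff _ _ setT 0%N) => //.
apply: cdiffD; [exact: openT|exact: cdiff_cst openT _ _|].
by apply: cdiffM; [exact: openT|exact: cdiff_lat openT|exact: cdiff_cst openT _ _].
Qed.

Lemma cdiff_flow_test s m : cdiff (flow_dom s) m (flow_test s).
Proof.
have oU := @open_flow_dom s.
have cc := cdiff_cst oU; have cl := fun m => @cdiff_lat (flow_dom s) m oU.
have cd j : cdiff (flow_dom s) j (fun x => (flow_den s (lat x))^-1).
  apply: cdiffV => //; first by move=> x; rewrite /flow_dom /= => /lt0r_neq0.
  by apply: cdiffD => //; exact: cdiffM.
have cF j i : cdiff (flow_dom s) j (fun x => flow Phi s x ord0 i).
  apply: (@cdiff_eq _ _ _ oU _ (fun x => (flow_den s (lat x))^-1 *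
   (x ord0 i + (sinhR s + (coshR s - 1) * lat x) * Phi ord0 i))).
    by move=> x _; rewrite !mxE.
  apply: cdiffM => //; apply: cdiffD => //; first exact: cdiff_coord.
  by apply: cdiffM => //; apply: cdiffD => //; exact: cdiffM.
apply: cdiffM => //; last exact: cdiffX.
apply: cdiff_expR => //.
apply: (@cdiff_eq _ _ _ oU _ (fun x => -1 * \sum_i expR (k +
   -1 * (k ^+ 2 * (flow Phi s x ord0 i + - a ord0 i))))).
  move=> x _; rewrite mulN1r; congr (- _); apply: eq_bigr => i _.
  by rewrite mulN1r.
apply: cdiffM => //; apply: cdiff_sum => // i; apply: cdiff_expR => //.
by apply: cdiffD => //; apply: cdiffM => //; apply: cdiffM => //; exact: cdiffD.
Qed.

Lemma sphere_flow_dom s : S `<=` flow_dom s.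
Proof. by move=> x Sx; exact/flow_den_gt0/normr_dot_sphere. Qed.

Lemma flow_test_ge0 s x : S x -> 0 <= flow_test s x.
Proof. by move=> Sx; rewrite mulr_ge0 ?(ltW (bump_gt0 _ _ _))// ltW// jac_gt0. Qed.

Lemma flow_test_le s x : S x -> flow_test s x <= expR (`|s| * n.-1%:R).
Proof.
move=> Sx; rewrite -[leRHS]mul1r ler_pM ?(ltW (bump_gt0 _ _ _)) ?bump_le1//.
  by rewrite ltW// jac_gt0.
exact: jac_le.
Qed.

Definition dflow_test_bound : R :=
  \sum_i k ^+ 2 * expR (`|k| + k ^+ 2 * (1 + `|a ord0 i|)) * 2 + n.-1%:R.

Lemma dflow_test_bound_ge0 : 0 <= dflow_test_bound.
Proof.
by rewrite addr_ge0// sumr_ge0// => i _; rewrite mulr_ge0// mulr_ge0 ?sqr_ge0 ?expR_ge0.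
Qed.

Lemma normr_dflow_test_le s x : S x ->
  `|dflow_test s x| <= expR (`|s| * n.-1%:R) * dflow_test_bound.
Proof.
move=> Sx; rewrite normrM (ger0_norm (flow_test_ge0 s Sx)).
rewrite ler_pM ?flow_test_ge0 ?flow_test_le//.
have le1 y i : S y -> `|y ord0 i| <= 1.
  by move=> Sy; have := le_coord_enorm y i; rewrite (Sy : enorm y = 1).
have lc := flow_lat_le1 s (normr_dot_sphere Phi1 Sx).
have SF := sphere_flow Phi1 s Sx.
apply: (le_trans (ler_normB _ _)); rewrite lerD//.
  apply: normr_dbump_le => i; first exact: le1.
  apply: (le_trans (ler_normB _ _)); rewrite normrM.
  have := mulr_ile1 (normr_ge0 _) (normr_ge0 _) lc (le1 _ i SF).
  by have := le1 Phi i (enorm_Phi Phi1); lra.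
by rewrite normrM ger0_norm// ler_piMr.
Qed.

End flow_test.

Lemma measurable_funV {R : realType} d (T : measurableType d) (D : set T) (f : T -> R) :
  measurable_fun D f -> measurable_fun D (fun x => (f x)^-1).
Proof.
move=> mf.
(* The inverse is expressed by the measurable real power; at a zero of [f] both sides are 0. *)
rewrite (_ : (fun x => _) = (fun x => f x * (`|f x| `^ (- 1)) ^+ 2)); last first.
  apply/funext => x; rewrite powR_inv1// -normfV real_normK ?num_real//.
  have [->|f0] := eqVneq (f x) 0; first by rewrite mul0r invr0.
  by rewrite expr2 mulrA mulfV// mul1r.
apply: measurable_funM => //; apply: measurable_funX.
apply: (measurableT_comp (measurable_powR _)).
by apply: (measurableT_comp (@normr_measurable R setT)).
Qed.

Section flow_measurable.
Context {R : realType} (n : nat) (Phi : 'rV[R]_n).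
Context d (T : measurableType d) (s : T -> R) (X : T -> 'rV[R]_n).
Hypotheses (ms : measurable_fun setT s) (mX : measurable_fun setT X).

Let mexp (f : T -> R) : measurable_fun setT f -> measurable_fun setT (fun t => expR (f t)).
Proof. by move=> mf; apply: measurableT_comp mf; exact: measurable_expR. Qed.

Lemma measurable_coshR : measurable_fun setT (fun t => coshR (s t)).
Proof.
apply: measurable_funM => //; apply: measurable_funD; first exact: mexp.
by apply: mexp; exact: measurableT_comp.
Qed.

Lemma measurable_sinhR : measurable_fun setT (fun t => sinhR (s t)).
Proof.
apply: measurable_funM => //; apply: measurable_funB; first exact: mexp.
by apply: mexp; exact: measurableT_comp.
Qed.

Lemma measurable_lat : measurable_fun setT (fun t => dot (X t) Phi).
Proof. exact: (measurableT_comp (measurable_dot Phi) mX). Qed.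

Lemma measurable_flow_den :
  measurable_fun setT (fun t => flow_den (s t) (dot (X t) Phi)).
Proof.
apply: measurable_funD; first exact: measurable_coshR.
by apply: measurable_funM; [exact: measurable_lat|exact: measurable_sinhR].
Qed.

Lemma measurable_flow_lat :
  measurable_fun setT (fun t => flow_lat (s t) (dot (X t) Phi)).
Proof.
apply: measurable_funM; last exact/measurable_funV/measurable_flow_den.
apply: measurable_funD; first exact: measurable_sinhR.
by apply: measurable_funM; [exact: measurable_lat|exact: measurable_coshR].
Qed.

Lemma measurable_jac : measurable_fun setT (fun t => jac Phi (s t) (X t)).
Proof. exact/measurable_funX/measurable_funV/measurable_flow_den. Qed.

(** Time and point are functions of a common parameter, which covers both a fixed time and the joint
    measurability needed for Fubini. *)
Lemma measurable_flow : measurable_fun setT (fun t => flow Phi (s t) (X t)).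
Proof.
apply: measurable_fun_rV => i.
rewrite (_ : (fun t => _) = fun t => (flow_den (s t) (dot (X t) Phi))^-1 *
   (X t ord0 i + (sinhR (s t) + (coshR (s t) - 1) * dot (X t) Phi) * Phi ord0 i)).
  apply: measurable_funM; first exact/measurable_funV/measurable_flow_den.
  apply: measurable_funD; first exact: (measurableT_comp (measurable_rV_coord i) mX).
  apply: measurable_funM => //; apply: measurable_funD; first exact: measurable_sinhR.
  apply: measurable_funM; last exact: measurable_lat.
  by apply: measurable_funB => //; exact: measurable_coshR.
by apply/funext => t; rewrite !mxE.
Qed.

End flow_measurable.

Lemma measurable_flow2 {R : realType} (n : nat) (Phi : 'rV[R]_n) :
  measurable_fun setT (fun z : 'rV[R]_n * measurableTypeR R => flow Phi z.2 z.1).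
Proof. by apply: measurable_flow; [exact: measurable_snd|exact: measurable_fst]. Qed.

Section flow_test_measurable.
Context {R : realType} (n : nat) (Phi : 'rV[R]_n).
Variables (k : R) (a : 'rV[R]_n) (s : R).
Local Notation E := 'rV[R]_n.

Let mid : measurable_fun setT (@id E). Proof. exact: measurable_id. Qed.
Let mcst : measurable_fun setT (fun _ : E => s). Proof. exact: measurable_cst. Qed.
Let mF := measurable_flow Phi mcst mid.

Lemma measurable_flow_test : measurable_fun setT (flow_test Phi k a s).
Proof.
apply: measurable_funM; last exact: (measurable_jac Phi mcst mid).
exact: (measurableT_comp (measurable_bump k a) mF).
Qed.

Lemma measurable_dflow_test : measurable_fun setT (dflow_test Phi k a s).
Proof.
have mFi i : measurable_fun setT (fun x : E => flow Phi s x ord0 i).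
  exact: (measurableT_comp (measurable_rV_coord i) mF).
have ml := measurable_flow_lat Phi mcst mid.
apply: measurable_funM; first exact: measurable_flow_test.
apply: measurable_funB; last exact: measurable_funM.
apply: measurable_sum => i; apply: measurable_funM.
  apply: measurable_funM => //; apply: measurableT_comp; first exact: measurable_expR.
  by apply: measurable_funB => //; apply: measurable_funM => //; exact: measurable_funB.
by apply: measurable_funB => //; exact: measurable_funM.
Qed.

End flow_test_measurable.

(** * The divergence of the test fields *)

Section tangent_divergence.
Context {R : realType} (n : nat) (Phi : 'rV[R]_n).
Hypothesis n0 : (0 < n)%N.
Hypothesis Phi1 : dot Phi Phi = 1.
Local Notation E := 'rV[R]_n.
Local Notation S := (@sphere R n).
Local Notation lat x := (dot x Phi).

Lemma dot_tang x : S x -> dot (tang Phi x) x = 0.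
Proof.
move=> /sphereE xx; rewrite /tang dotDl dotNl dotZl xx mulr1 dotC subrr//.
Qed.

(** In the sum over the projected basis vectors [v i], the derivatives of [psi] recombine into the
    one along [tang Phi x] because this vector is tangent; the derivatives of the field leave the
    trace [n.-1] of the tangential projection. *)
Lemma sphere_div_tang (psi : E -> R) x : S x -> differentiable psi x ->
  sphere_div (fun y => psi y *: tang Phi y) x =
  'D_(tang Phi x) psi x - n.-1%:R * lat x * psi x.
Proof.
move=> Sx dpsi; have xx : dot x x = 1 by apply/sphereE.
pose v i : E := delta_mx ord0 i - x ord0 i *: x.
have dv i : is_derive x (v i) (fun y => (psi y *: tang Phi y) ord0 i)
   ('D_(v i) psi x * tang Phi x ord0 i +
    psi x * - (dot (v i) Phi * x ord0 i + lat x * v i ord0 i)).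
  rewrite (_ : (fun y => _) = fun y => psi y * (Phi ord0 i - lat y * y ord0 i)); last first.
    by apply/funext => y; rewrite !mxE.
  apply: is_derive_eq (derM (derivableP (@diff_derivable _ _ _ psi x (v i) dpsi))
   (derB (der_cst _ _ (Phi ord0 i)) (derM (der_dot x (v i) Phi) (der_coord x (v i) i)))) _.
  by rewrite sub0r !mxE.
transitivity (\sum_i ('D_(v i) psi x * tang Phi x ord0 i +
    psi x * - (dot (v i) Phi * x ord0 i + lat x * v i ord0 i))).
  by apply: eq_bigr => i _; have [_ ->] := dv i.
rewrite big_split/=; congr (_ + _).
  transitivity (\sum_i 'd psi x (tang Phi x ord0 i *: v i)).
    by apply: eq_bigr => i _; rewrite deriveE// linearZ/= mulrC.
  rewrite deriveE// -linear_sum; congr ('d psi x _).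
  rewrite /v; under eq_bigr do rewrite scalerBr.
  rewrite big_split/= -row_sum_delta sumrN.
  under eq_bigr do rewrite scalerA.
  by rewrite -scaler_suml -/(dot (tang Phi x) x) dot_tang// scale0r subr0.
rewrite -mulr_sumr sumrN mulrN mulrC; congr (- (_ * _)).
rewrite big_split/= -mulr_sumr.
have dvE i : dot (v i) Phi = Phi ord0 i - x ord0 i * lat x.
  rewrite dotDl dotNl dotZl; congr (_ - _).
  rewrite /dot (bigD1 i)//= big1 => [|j ji]; rewrite mxE !eqxx/=.
    by rewrite mul1r addr0.
  by rewrite (negbTE ji) mul0r.
have -> : \sum_i dot (v i) Phi * x ord0 i = 0.
  under eq_bigr do rewrite dvE mulrBl mulrAC.
  by rewrite big_split/= sumrN -mulr_suml -/(dot x x) xx mul1r -/(dot Phi x) dotC subrr.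
have -> : \sum_i v i ord0 i = n.-1%:R.
  transitivity (\sum_(i < n) (1 - x ord0 i * x ord0 i)).
    by apply: eq_bigr => i _; rewrite !mxE !eqxx.
  rewrite big_split/= sumrN -/(dot x x) xx sumr_const card_ord.
  by rewrite -{1}(prednK n0) mulrSr addrK.
by rewrite add0r mulrC.
Qed.

End tangent_divergence.

Section sphere_Lp.
Context {R : realType} (n : nat).
Local Notation E := 'rV[R]_n.
Local Notation S := (@sphere R n).
Local Notation sigma := (@surface_measure R n).
Implicit Types f : E -> R.

Lemma sphere_LpP (p : R) f : 0 < p -> sphere_Lp p f <->
  measurable_fun setT (f \_ S) /\ (\int[sigma]_(x in S) (`|f x| `^ p)%:E < +oo)%E.
Proof.
move=> p0.
have e : (\int[sigma]_x (`|((f \_ S) x)%:E| `^ p) = \int[sigma]_(x in S) (`|f x| `^ p)%:E)%E.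
  rewrite [RHS]integral_mkcond; apply: eq_integral => x _ /=.
  rewrite !patchE; case: ifPn => _; first by [].
  by rewrite normr0 powR0// gt_eqF.
rewrite /sphere_Lp; split.
  rewrite inE => /andP[]; rewrite !inE/= => mf.
  rewrite /finite_norm => h; split => //.
  rewrite -e -(@poweR_Lnorm _ _ _ sigma (EFin \o (f \_ S)) p) ?gt_eqF//.
  by apply: poweR_lty.
move=> [mf h]; rewrite inE; apply/andP; split; rewrite inE//=.
by rewrite /finite_norm unlock; apply: poweR_lty; rewrite e.
Qed.

Lemma sphere_Lp1P f : sphere_Lp 1 f <->
  measurable_fun setT (f \_ S) /\ sigma.-integrable S (EFin \o f).
Proof.
rewrite sphere_LpP//; split => -[mf h]; split => //.
  apply/integrableP; split.
    apply/measurable_EFinP.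
    apply/(measurable_restrictT _ (@measurable_sphere R n)) => //.
  by under eq_integral do rewrite /= -(@powRr1 _ `|f _|)//.
move/integrableP : h => [_]; by under eq_integral do rewrite /= -(@powRr1 _ `|f _|)//.
Qed.

End sphere_Lp.

(** * Weak derivatives along the flow *)

Section lie_pair.
Context {R : realType} (n : nat) (Phi : 'rV[R]_n).
Hypothesis n0 : (0 < n)%N.
Hypothesis Phi1 : dot Phi Phi = 1.
Local Notation E := 'rV[R]_n.
Local Notation S := (@sphere R n).
Local Notation sigma := (@surface_measure R n).
Local Notation lat x := (dot x Phi).
Local Notation mS := (@measurable_sphere R n).

(* [g] is the weak derivative of [f] along [tang Phi], tested only against the
   [flow_test]s, for which [dflow_test] is the divergence of the test field. *)
Definition lie_pair (f g : E -> R) := [/\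
  measurable_fun setT f /\ measurable_fun setT g,
  sigma.-integrable S (EFin \o f), sigma.-integrable S (EFin \o g) &
  forall k a s, (\int[sigma]_(x in S) (g x * flow_test Phi k a s x)%:E =
    - \int[sigma]_(x in S) (f x * dflow_test Phi k a s x)%:E)%E].

Lemma integrable_bounded (f h : E -> R) C :
  sigma.-integrable S (EFin \o f) -> measurable_fun setT h ->
  (forall x, S x -> `|h x| <= C) ->
  sigma.-integrable S (fun x => (f x * h x)%:E).
Proof.
move=> fi mh hC.
apply: (@integrableMl _ _ _ sigma S mS (EFin \o f) h) => //; first exact: measurable_funTS.
exists C; split; first exact: num_real.
by move=> y Cy x Sx; apply: le_trans (hC _ Sx) (ltW Cy).
Qed.

Lemma surface_sphere_fin : (sigma S < +oo)%E.
Proof.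
apply: le_lt_trans (@surface_measure_fin R n).
by apply: le_measure; rewrite ?inE//; exact: mS.
Qed.

Lemma integrable_cst_sphere (c : R) : sigma.-integrable S (EFin \o cst c).
Proof.
apply: measurable_bounded_integrable => //; [exact: mS|exact: surface_sphere_fin|].
exists `|c|; split; first exact: num_real.
by move=> y cy x _ /=; exact: ltW.
Qed.

(** The divergence theorem for [flow_test] times [tang Phi]. It makes the integral of [flow_test]
    constant in time, whence [jac] is the Jacobian of the flow for the surface measure. *)
Lemma lie_pair_cst : lie_pair (cst 1) (cst 0).
Proof.
split; [by []|exact: integrable_cst_sphere..|].
move=> k a s.
rewrite integral0_eq; last by move=> x _; rewrite mul0r.
have mt := measurable_flow_test Phi k a s.
have md := measurable_dflow_test Phi k a s.
have tle x : S x -> `|flow_test Phi k a s x| <= expR (`|s| * n.-1%:R).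
  by move=> Sx; rewrite ger0_norm ?flow_test_ge0 ?flow_test_le.
pose M := expR (`|s| * n.-1%:R) * (dflow_test_bound k a + n.-1%:R + 1).
have := @integral_divergence _ _ Phi n0 Phi1 (flow_test Phi k a s)
  (fun x => dflow_test Phi k a s x + n.-1%:R * lat x * flow_test Phi k a s x) M mt.
have B0 := dflow_test_bound_ge0 k a.
have -> : n%:R - 1 = n.-1%:R :> R by rewrite -{1}(prednK n0) mulrSr addrK.
move=> H; rewrite (_ : (\int[sigma]_(x in S) (cst 1 x * dflow_test Phi k a s x)%:E = 0)%E) ?oppe0//.
rewrite -[RHS]H.
- by apply: eq_integral => x _; rewrite addrK mul1r.
- apply: measurable_funD => //; apply: measurable_funM => //.
  by apply: measurable_funM => //; exact: measurable_dot.
- move=> x Sx; apply: (@cdiff_diff _ _ _ 0%N _ _ (cdiff_flow_test Phi k a s 0)).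
  exact: sphere_flow_dom.
- by move=> x Sx; have [_ ->] := is_derive_flow_test_tang Phi1 k a s Sx.
- move=> x Sx; apply: (le_trans (tle x Sx)); rewrite /M ler_peMr ?expR_ge0//.
  by rewrite lerDr addr_ge0.
move=> x Sx; rewrite /M mulrDr mulrDr mulr1 -addrA.
apply: (le_trans (ler_normD _ _)); apply: lerD; first exact: normr_dflow_test_le.
apply: ler_wpDr; first exact: expR_ge0.
rewrite normrM mulrC ler_pM ?tle// normrM ger0_norm// ler_piMr//.
exact: normr_dot_sphere.
Qed.

(** [flow_test] times [tang Phi] is an admissible smooth tangent field, with divergence [dflow_test]
    on the sphere. Extension by 0 makes both functions measurable on the whole space. *)
Lemma lie_pair_sobolev (u : E -> R) Psi : is_sphere_grad u Psi ->
  lie_pair (u \_ S) ((fun x => dot (Psi x) (tang Phi x)) \_ S).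
Proof.
move=> [/sphere_Lp1P[mu iu] LPsi _ wk].
have mPsi i : measurable_fun setT ((fun x => Psi x ord0 i) \_ S).
  by have /sphere_Lp1P[] := LPsi i.
have iPsi i : sigma.-integrable S (EFin \o (fun x => Psi x ord0 i)).
  by have /sphere_Lp1P[] := LPsi i.
have mti i : measurable_fun setT (fun x : E => tang Phi x ord0 i).
  rewrite (_ : (fun x => _) = fun x : E => Phi ord0 i - lat x * x ord0 i).
    apply: measurable_funB => //; apply: measurable_funM; first exact: measurable_dot.
    exact: measurable_rV_coord.
  by apply/funext => x; rewrite !mxE.
have tle x i : S x -> `|tang Phi x ord0 i| <= 2.
  move=> Sx; rewrite !mxE; apply: (le_trans (ler_normB _ _)); rewrite normrM.
  have := mulr_ile1 (normr_ge0 _) (normr_ge0 _) (normr_dot_sphere Phi1 Sx)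
    (le_trans (le_coord_enorm x i) _).
  rewrite (Sx : enorm x = 1) lexx => /(_ isT).
  by have := le_coord_enorm Phi i; rewrite enorm_Phi//; lra.
have wE : (fun x => dot (Psi x) (tang Phi x)) \_ S =
    fun x => \sum_i ((fun x => Psi x ord0 i) \_ S) x * tang Phi x ord0 i.
  apply/funext => x; rewrite patchE; case: ifPn => xS.
    by apply: eq_bigr => i _; rewrite patchE xS.
  by rewrite big1// => i _; rewrite patchE (negbTE xS) mul0r.
have eS (f : E -> R) : {in S, f \_ S =1 f} by move=> x xS; rewrite patchE xS.
split.
- split => //; rewrite wE; apply: measurable_sum => i; exact: measurable_funM.
- by apply: eq_integrable iu => // [|x xS]; [exact: mS|rewrite /= eS].
- have : sigma.-integrable S (fun x => \sum_(i < n) (Psi x ord0 i * tang Phi x ord0 i)%:E)%E.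
    apply: integrable_sum => [|i _]; first exact: mS.
    by apply: integrable_bounded => // x; exact: tle.
  apply: eq_integrable => [|x xS]; first exact: mS.
  by rewrite /= eS// sumEFin.
move=> k a s.
pose V (x : E) : E := flow_test Phi k a s x *: tang Phi x.
have oU := @open_flow_dom _ _ Phi s.
have sV : smooth_tangent_field V.
  split.
    exists (flow_dom Phi s); first by split => //; exact: sphere_flow_dom.
    move=> i; apply: smooth_on_cdiff => // m.
    apply: (@cdiff_eq _ _ _ oU _ (fun x => flow_test Phi k a s x * tang Phi x ord0 i)).
      by move=> x _; rewrite !mxE.
    by apply: cdiffM => //; [exact: cdiff_flow_test|exact: cdiff_tang].
  by move=> x Sx; rewrite dotZl dot_tang// mulr0.
transitivity (\int[sigma]_(x in S) (dot (Psi x) (V x))%:E)%E.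
  apply: eq_integral => x xS; rewrite eS//; congr EFin.
  by rewrite /V dotZr mulrC.
rewrite (wk V sV); congr (- _)%E; apply: eq_integral => x xS; rewrite eS//.
have Sx : S x by rewrite inE in xS.
rewrite sphere_div_tang//; last first.
  apply: (@cdiff_diff _ _ _ 0%N _ _ (cdiff_flow_test Phi k a s 0)).
  exact: sphere_flow_dom.
have [_ ->] := is_derive_flow_test_tang Phi1 k a s Sx.
by rewrite addrK.
Qed.

End lie_pair.

(** * Time integration of the weak derivative *)

Section duhamel.
Context {R : realType} (n : nat) (Phi : 'rV[R]_n).
Hypothesis n0 : (0 < n)%N.
Hypothesis Phi1 : dot Phi Phi = 1.
Local Notation E := 'rV[R]_n.
Local Notation S := (@sphere R n).
Local Notation sigma := (@surface_measure R n).
Local Notation mS := (@measurable_sphere R n).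

Lemma flow_test0 k a x : flow_test Phi k a 0 x = bump k a x.
Proof.
rewrite /flow_test /jac /flow flow_den0 sinhR0 coshR0 subrr mul0r addr0 scale0r addr0.
by rewrite invr1 scale1r expr1n mulr1.
Qed.

Lemma normr_flow_test_le k a s x : S x -> `|flow_test Phi k a s x| <= expR (`|s| * n.-1%:R).
Proof. by move=> Sx; rewrite ger0_norm ?flow_test_ge0 ?flow_test_le. Qed.

Lemma integrable_flow_test f k a s : sigma.-integrable S (EFin \o f) ->
  sigma.-integrable S (fun x => (f x * flow_test Phi k a s x)%:E).
Proof.
move=> fi; apply: integrable_bounded => //; first exact: measurable_flow_test.
by move=> x; exact: normr_flow_test_le.
Qed.

Lemma is_derive_integral_flow_test (f : E -> R) k a (s : R) :
  sigma.-integrable S (EFin \o f) ->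
  is_derive s 1 (fun r => \int[sigma]_(x in S) (f x * flow_test Phi k a r x))
    (\int[sigma]_(x in S) (f x * dflow_test Phi k a s x)).
Proof.
move=> fi.
pose F r x := f x * flow_test Phi k a r x.
(* Bounds [dflow_test] at all times within distance 1 of [s], for differentiation under the
   integral. *)
pose C := expR ((`|s| + 1) * n.-1%:R) * dflow_test_bound k a.
have C0 : 0 <= C by rewrite mulr_ge0 ?expR_ge0// dflow_test_bound_ge0.
have dF (r : R) x : S x -> is_derive r 1 (F ^~ x) (f x * dflow_test Phi k a r x).
  move=> Sx; apply: is_derive_eq (derM (der_cst _ _ (f x)) (is_derive_flow_test Phi1 k a r Sx)) _.
  by rewrite mul0r add0r.
have dFE r x : S x -> partial1of2 F r x = f x * dflow_test Phi k a r x.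
  by move=> Sx; rewrite partial1of2E; have [_ ->] := dF r x Sx.
have sI : `](s - 1), (s + 1)[%classic s by rewrite /= in_itv/=; apply/andP; split; lra.
have iF r : `](s - 1), (s + 1)[%classic r -> sigma.-integrable S (EFin \o F r).
  by move=> _; exact: integrable_flow_test.
have derF r x : `](s - 1), (s + 1)[%classic r -> S x -> derivable (F ^~ x) r 1.
  by move=> _ Sx; have [] := dF r x Sx.
have iG : sigma.-integrable S (EFin \o (fun x => `|f x| * C)).
  apply: (@integrable_bounded _ _ (fun x => `|f x|) (cst C) `|C|) => //.
  exact: integrable_norm.
have GF r x : `](s - 1), (s + 1)[%classic r -> S x -> `|partial1of2 F r x| <= `|f x| * C.
  rewrite /= in_itv/= => /andP[r1 r2] Sx; rewrite dFE// normrM ler_wpM2l//.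
  apply: (le_trans (normr_dflow_test_le Phi1 k a r Sx)).
  rewrite ler_wpM2r ?dflow_test_bound_ge0// ler_expR ler_wpM2r//.
  rewrite ler_norml; have := ler_norm s; have := ler_norm (- s); rewrite normrN => ? ?.
  by apply/andP; split; lra.
have G0 x : 0 <= `|f x| * C by rewrite mulr_ge0.
apply: DeriveDef.
  exact: (derivable_under_integral mS sI iF derF G0 iG GF).
rewrite -derive1E (differentiation_under_integral mS sI iF derF G0 iG GF).
by apply: eq_Rintegral => x xS; apply: dFE; rewrite inE in xS.
Qed.

(** Weak form of f o F_t - f = int_0^t g o F_s ds: by the change of variables F_s, pairing a
    function with [flow_test] at time [- s] is pairing its composition with F_s with [bump]. *)
Lemma duhamel (f g : E -> R) k a (t : R) : lie_pair Phi f g -> 0 < t ->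
  (\int[lebesgue_measure]_(s in `[0%R, t])
     (\int[sigma]_(x in S) (g x * flow_test Phi k a (- s) x))%R%:E =
   (\int[sigma]_(x in S) (f x * flow_test Phi k a (- t) x) -
    \int[sigma]_(x in S) (f x * bump k a x))%R%:E)%E.
Proof.
move=> [_ fi gi fg] t0.
have dN (K : R -> R) (s d : R) : is_derive (- s) 1 K d -> is_derive s 1 (fun r => K (- r)) (- d).
  move=> dK; apply: is_derive_eq (der_comp (derN (is_derive_id s 1)) dK) _.
  by rewrite mulrN1.
have dK (s : R) : is_derive s 1
   (fun r => \int[sigma]_(x in S) (f x * flow_test Phi k a (- r) x))
   (\int[sigma]_(x in S) (g x * flow_test Phi k a (- s) x)).
  apply: is_derive_eq (dN (fun r => \int[sigma]_(x in S) (f x * flow_test Phi k a r x)) _ _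
    (is_derive_integral_flow_test k a (- s) fi)) _.
  by rewrite /Rintegral fg fineN.
(* The fundamental theorem needs a continuous derivative. As [g] is integrable too, its pairing with
   [flow_test] is itself derivable in time. *)
rewrite (integral_derive t0 dK); last first.
  apply: is_derive_continuous => s.
  exact: (dN (fun r => \int[sigma]_(x in S) (g x * flow_test Phi k a r x)) _ _
    (is_derive_integral_flow_test k a (- s) gi)).
congr (_ - _)%:E; apply: eq_Rintegral => x _.
by rewrite oppr0 flow_test0.
Qed.

(** By [lie_pair_cst] the time derivative of the left-hand side vanishes. *)
Lemma integral_flow_test_cst k a t :
  (\int[sigma]_(x in S) (flow_test Phi k a t x)%:E =
   \int[sigma]_(x in S) (bump k a x)%:E)%E.
Proof.
have [_ fi gi fg] := lie_pair_cst n0 Phi1.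
have dK (s : R) : is_derive s 1
    (fun r => \int[sigma]_(x in S) (cst 1 x * flow_test Phi k a r x)) 0.
  apply: is_derive_eq (is_derive_integral_flow_test k a s fi) _.
  have := fg k a s; rewrite integral0_eq; last by move=> x _; rewrite mul0r.
  by rewrite /Rintegral => /esym/eqP; rewrite eqe_oppLR oppe0 => /eqP ->.
have e0 := is_derive_0_is_cst t 0 dK.
have i1 s := @integrable_flow_test (cst 1) k a s fi.
have ft := integrable_fin_num mS (i1 t); have f0 := integrable_fin_num mS (i1 0).
have e : (\int[sigma]_(x in S) (cst 1 x * flow_test Phi k a t x)%:E =
    \int[sigma]_(x in S) (cst 1 x * flow_test Phi k a 0 x)%:E)%E.
  by rewrite -(fineK ft) -(fineK f0); exact: (congr1 EFin e0).
transitivity (\int[sigma]_(x in S) (cst 1 x * flow_test Phi k a t x)%:E)%E.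
  by apply: eq_integral => x _; rewrite mul1r.
by rewrite e; apply: eq_integral => x _; rewrite mul1r flow_test0.
Qed.

End duhamel.

(** * Measures determined by the bump functions *)

Section orthants.
Context {R : realType} (n : nat).
Local Notation E := 'rV[R]_n.

Definition orthant (a : E) : set E := [set x | forall i, a ord0 i < x ord0 i].

Definition orthants : set (set E) := range orthant.

Lemma orthantI : setI_closed orthants.
Proof.
move=> _ _ [a _ <-] [b _ <-]; exists (\row_i Num.max (a ord0 i) (b ord0 i)) => //.
apply/seteqP; split => x /=.
  by move=> h; split => i; have := h i; rewrite !mxE gt_max => /andP[].
by move=> [h1 h2] i; rewrite !mxE gt_max h1 h2.
Qed.

Lemma bigcup_orthant : \bigcup_j orthant (const_mx (- j%:R)) = setT.
Proof.
apply/seteqP; split => // x _.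
exists (Num.Def.truncn (\sum_i `|x ord0 i|)).+1 => // i; rewrite mxE ltrNl.
apply: (@le_lt_trans _ _ `|x ord0 i|); first by rewrite -normrN ler_norm.
apply: (@le_lt_trans _ _ (\sum_i `|x ord0 i|)).
  by rewrite (bigD1 i)//= lerDl sumr_ge0.
by have := truncnS_gt (\sum_i `|x ord0 i|).
Qed.

Lemma nd_orthant : {homo (fun j : nat => orthant (const_mx (- j%:R))) :
  i j / (i <= j)%N >-> (i <= j)%O}.
Proof.
move=> i j ij; apply/subsetPset => x /= h l; apply: le_lt_trans (h l).
by rewrite !mxE lerN2 ler_nat.
Qed.

Lemma measurable_rV_orthants : (@measurable _ E) = <<s orthants >>.
Proof.
have mO : orthants `<=` @measurable _ E.
  move=> _ [a _ <-].
  rewrite (_ : orthant a = \big[setI/setT]_(i <- enum 'I_n)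
    (rV_coord i @^-1` `]a ord0 i, +oo[)).
    apply: bigsetI_measurable => i _.
    by rewrite -[X in measurable X]setTI; apply: measurable_rV_coord.
  rewrite -bigcap_seq; apply/seteqP; split => x /=.
    by move=> h i _; rewrite /= in_itv/= andbT; exact: h.
  by move=> h i; have /= := h i (mem_enum _ _); rewrite in_itv/= andbT.
apply/seteqP; split; last first.
  by apply: smallest_sub => //; exact: sigma_algebra_measurable.
have mc (i : 'I_n) : measurable_fun setT (rV_coord i : g_sigma_algebraType orthants -> R).
  apply: (measurability _ (@RGenOInfty.measurableE R)).
  move=> _ [_ [r ->] <-]; rewrite setTI.
  (* The half-space is the union of the orthants whose other corner coordinates tend to minus
     infinity. *)
  pose O j : E := \row_l (if l == i then r else - j%:R).
  rewrite (_ : _ @^-1` _ = \bigcup_j orthant (O j)).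
    apply: bigcup_measurable => j _; apply: sub_sigma_algebra.
    by exists (O j).
  apply/seteqP; split => x /=.
    rewrite in_itv/= andbT => rx.
    have [j _ xj] : (\bigcup_j orthant (const_mx (- j%:R))) x by rewrite bigcup_orthant.
    exists j => // l; have := xj l; rewrite !mxE.
    by case: eqP => [->|].
  move=> [j _ /(_ i)]; rewrite !mxE eqxx => h.
  by rewrite in_itv/= andbT.
apply: smallest_sub; first exact: smallest_sigma_algebra.
rewrite -bigcup_seq => A [i _ [B mB <-]].
exact: (mc i measurableT B mB).
Qed.

Lemma cvg_expRN : (expR (- j%:R) : R) @[j --> \oo] --> (0 : R).
Proof.
apply: (@squeeze_cvgr _ _ _ _ (cst 0) _ _ _ _ _ (@cvg_harmonic R)); last exact: cvg_cst.
apply: nearW => j; rewrite expR_ge0/= expRN lef_pV2 ?posrE ?expR_gt0//.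
by rewrite -natr1 addrC expR_ge1Dx.
Qed.

Lemma cvg_bump (a x : E) : bump j%:R a x @[j --> \oo] --> (\1_(orthant a) x : R).
Proof.
have [ax|] := pselect (orthant a x).
  rewrite indicE mem_set//= -[X in _ --> X]expR0 -oppr0.
  apply: continuous_cvg; first exact: continuous_expR.
  apply: cvgN.
  rewrite -[X in _ --> X](@big1 _ 0 +%R 'I_n (index_enum 'I_n) xpredT (fun=> 0))//.
  apply: (@cvg_big _ _ +%R 0 xpredT add_continuous) => i _.
  have d0 : 0 < x ord0 i - a ord0 i by rewrite subr_gt0.
  set d := x ord0 i - a ord0 i in d0 *.
  apply: (@squeeze_cvgr _ _ _ _ (cst 0) (fun j : nat => expR (- j%:R) : R)); [|exact: cvg_cst|exact: cvg_expRN].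
  near=> j; rewrite expR_ge0 /= ler_expR.
  (* Then [j ^+ 2 * d >= 2 * j], so the exponent [j - j ^+ 2 * d] is at most [- j]. *)
  have j1 : 2 / d <= j%:R.
    by near: j; exact: nbhs_infty_ger.
  rewrite ler_pdivrMr// in j1.
  have : 0 <= j%:R :> R by [].
  nra.
move=> /existsNP[i /negP]; rewrite -leNgt => xa.
rewrite indicE memNset; last by move=> /(_ i); rewrite ltNge xa.
apply: (@squeeze_cvgr _ _ _ _ (cst 0) (fun j : nat => expR (- j%:R) : R)); [|exact: cvg_cst|exact: cvg_expRN].
(* Off the orthant, the exponent of the coordinate [i] is at least [j], so the sum is at least
   [expR j], hence at least [j]. *)
apply: nearW => j; rewrite expR_ge0 /= ler_expR lerN2 (bigD1 i)//=.
apply: ler_wpDr; first by apply: sumr_ge0 => l _; exact: expR_ge0.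
apply: (@le_trans _ _ (expR j%:R)).
  by have := expR_ge1Dx (j%:R : R); lra.
rewrite ler_expR lerBrDr -lerBrDl subrr -oppr_ge0 -mulrN mulr_ge0 ?sqr_ge0//.
by rewrite opprB subr_ge0.
Unshelve. all: by end_near. Qed.

End orthants.

Section determination.
Context {R : realType} (n : nat).
Local Notation E := 'rV[R]_n.
Context d1 d2 (T1 : measurableType d1) (T2 : measurableType d2).
Variables (mu1 : {measure set T1 -> \bar R}) (mu2 : {measure set T2 -> \bar R}).
Variables (D1 : set T1) (D2 : set T2) (g1 : T1 -> E) (g2 : T2 -> E).
Variables (f1 : T1 -> R) (f2 : T2 -> R).
Hypotheses (mD1 : measurable D1) (mD2 : measurable D2).
Hypotheses (mg1 : measurable_fun setT g1) (mg2 : measurable_fun setT g2).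
Hypotheses (if1 : mu1.-integrable D1 (EFin \o f1)) (if2 : mu2.-integrable D2 (EFin \o f2)).
Hypothesis f12 : forall k a,
  (\int[mu1]_(x in D1) (f1 x * bump k a (g1 x))%:E =
   \int[mu2]_(x in D2) (f2 x * bump k a (g2 x))%:E)%E.

Let orthant_lim d (T : measurableType d) (mu : {measure set T -> \bar R}) D (g : T -> E) f a :
  measurable D -> measurable_fun setT g -> mu.-integrable D (EFin \o f) ->
  (\int[mu]_(x in D) (f x * bump j%:R a (g x))%:E)%E @[j --> \oo] -->
  (\int[mu]_(x in D `&` g @^-1` orthant a) (f x)%:E)%E.
Proof.
move=> mD mg fi.
have mf : measurable_fun D f by apply/measurable_EFinP; exact: measurable_int fi.
have mO : measurable (orthant a).
  by rewrite measurable_rV_orthants; apply: sub_sigma_algebra; exists a.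
rewrite integral_mkcondr.
have E1 x : ((fun x => (f x)%:E) \_ (g @^-1` orthant a)) x = (f x * \1_(orthant a) (g x))%:E.
  rewrite patchE indicE; case: ifPn => [|/negP]; rewrite inE => h.
    by rewrite mem_set// mulr1.
  by rewrite memNset// mulr0.
under [X in _ --> X]eq_integral do rewrite E1.
have [] := @dominated_convergence _ _ _ mu D mD
  (fun j x => (f x * bump j%:R a (g x))%:E) (fun x => (f x * \1_(orthant a) (g x))%:E)
  (fun x => `|f x|%:E).
- move=> j; apply/measurable_EFinP/measurable_funM => //.
  by apply/measurable_funTS/measurableT_comp => //; exact: measurable_bump.
- apply/measurable_EFinP/measurable_funM => //.
  by apply/measurable_funTS/measurableT_comp => //; exact: measurable_indic.
- apply: aeW => x _; apply: cvg_EFin; first exact: nearW.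
  by apply: cvgM; [exact: cvg_cst|exact: cvg_bump].
- exact: integrable_norm.
- apply: aeW => x j _; rewrite lee_fin normrM ler_piMr//.
  by rewrite ger0_norm ?bump_le1 ?(ltW (bump_gt0 _ _ _)).
by [].
Qed.

Let int_preimage d (T : measurableType d) (mu : {measure set T -> \bar R}) D (g : T -> E) f A :
  measurable D -> measurable_fun setT g -> mu.-integrable D (EFin \o f) -> measurable A ->
  mu.-integrable (D `&` g @^-1` A) (EFin \o f).
Proof.
move=> mD mg fi mA; apply: integrableS fi => //.
by apply: measurableI => //; rewrite -[X in measurable X]setTI; exact: mg.
Qed.

Let mpre d (T : measurableType d) (D : set T) (g : T -> E) A :
  measurable D -> measurable_fun setT g -> measurable A -> measurable (D `&` g @^-1` A).
Proof.
move=> mD mg mA.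
by apply: measurableI => //; rewrite -[X in measurable X]setTI; exact: mg.
Qed.

Let cube (j : nat) : set E := orthant (const_mx (- j%:R)).

Let set_lim d (T : measurableType d) (mu : {measure set T -> \bar R}) D (g : T -> E) f :
  measurable D -> measurable_fun setT g -> mu.-integrable D (EFin \o f) ->
  (\int[mu]_(x in D `&` g @^-1` cube j) (f x)%:E)%E @[j --> \oo] -->
  (\int[mu]_(x in D `&` g @^-1` setT) (f x)%:E)%E.
Proof.
move=> mD mg fi; rewrite preimage_setT setIT.
have mf : measurable_fun D f by apply/measurable_EFinP; exact: measurable_int fi.
have mO (a : E) : measurable (orthant a).
  by rewrite measurable_rV_orthants; apply: sub_sigma_algebra; exists a.
have mC j : measurable (cube j) := mO _.
have E1 j x : ((fun x => (f x)%:E) \_ (g @^-1` cube j)) x =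
    (f x * \1_(cube j) (g x))%:E.
  rewrite patchE indicE; case: ifPn => [|/negP]; rewrite inE => h.
    by rewrite mem_set// mulr1.
  by rewrite memNset// mulr0.
rewrite (_ : (fun j : nat => _) = fun j : nat =>
  (\int[mu]_(x in D) (f x * \1_(cube j) (g x))%:E)%E); last first.
  by apply/funext => j; rewrite integral_mkcondr; apply: eq_integral => x _; rewrite E1.
have [] := @dominated_convergence _ _ _ mu D mD
  (fun j x => (f x * \1_(cube j) (g x))%:E) (fun x => (f x)%:E)
  (fun x => `|f x|%:E).
- move=> j; apply/measurable_EFinP/measurable_funM => //.
  by apply/measurable_funTS/measurableT_comp => //; exact: measurable_indic.
- exact/measurable_EFinP.
- apply: aeW => x _; apply: cvg_EFin; first exact: nearW.
  have [j _ xj] : (\bigcup_j cube j) (g x) by rewrite bigcup_orthant.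
  apply: cvg_near_cst; exists j => // m /= jm.
  rewrite indicE mem_set ?mulr1//.
  by have /subsetPset := @nd_orthant R n j m jm; exact.
- exact: integrable_norm.
- apply: aeW => x j _; rewrite lee_fin normrM ler_piMr//.
  by rewrite ger0_norm// indicE lern1 leq_b1.
by [].
Qed.

(** The images under [g1] and [g2] of the signed measures f1 mu1 and f2 mu2 agree on orthants, as
    limits of bumps, and then on all measurable sets by Dynkin's theorem. The source spaces differ
    because one application compares the sphere with its product with time. *)
Lemma integral_determined A : measurable A ->
  (\int[mu1]_(x in D1 `&` g1 @^-1` A) (f1 x)%:E =
   \int[mu2]_(x in D2 `&` g2 @^-1` A) (f2 x)%:E)%E.
Proof.
have PO a : (\int[mu1]_(x in D1 `&` g1 @^-1` orthant a) (f1 x)%:E =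
    \int[mu2]_(x in D2 `&` g2 @^-1` orthant a) (f2 x)%:E)%E.
  have h1 := orthant_lim (a := a) mD1 mg1 if1; have h2 := orthant_lim (a := a) mD2 mg2 if2.
  move: h1; under eq_fun do rewrite f12.
  by move=> h1; apply: cvg_unique h1 h2.
(* Equality of the total masses, for complements: the whole space is not an orthant, but the
   increasing union of the orthants [cube j]. *)
have PT : (\int[mu1]_(x in D1 `&` g1 @^-1` setT) (f1 x)%:E =
    \int[mu2]_(x in D2 `&` g2 @^-1` setT) (f2 x)%:E)%E.
  have h1 := set_lim mD1 mg1 if1; have h2 := set_lim mD2 mg2 if2.
  move: h1; under eq_fun do rewrite PO.
  by move=> h1; apply: cvg_unique h1 h2.
rewrite measurable_rV_orthants.
apply: (dynkin_induction (P := fun A => (\int[mu1]_(x in D1 `&` g1 @^-1` A) (f1 x)%:E =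
   \int[mu2]_(x in D2 `&` g2 @^-1` A) (f2 x)%:E)%E)) => //.
- exact: measurable_rV_orthants.
- exact: orthantI.
- by move=> _ [a _ <-]; exact: PO.
- move=> B mB PB.
  have split_int d (T : measurableType d) (mu : {measure set T -> \bar R}) D (g : T -> E) f :
      measurable D -> measurable_fun setT g -> mu.-integrable D (EFin \o f) ->
      (\int[mu]_(x in D `&` g @^-1` (~` B)) (f x)%:E =
       \int[mu]_(x in D `&` g @^-1` setT) (f x)%:E -
       \int[mu]_(x in D `&` g @^-1` B) (f x)%:E)%E.
    move=> mD mg fi; have mC := measurableC mB.
    have fB : (\int[mu]_(x in D `&` g @^-1` B) (f x)%:E)%E \is a fin_num.
      apply: integrable_fin_num; [exact: mpre|exact: int_preimage].
    rewrite -(setvU B) preimage_setU setIUr integral_setU//; last 4 first.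
    + exact: mpre.
    + exact: mpre.
    + rewrite -setIUr -preimage_setU; apply: measurable_int.
      by apply: (int_preimage mD mg fi); exact: measurableU.
    + by apply/disj_setPS => x [[_ h1] [_ h2]]; exact: h1.
    by rewrite addeK.
  by rewrite !split_int// PT PB.
move=> F mF tF PF.
rewrite !preimage_bigcup !setI_bigcupr !integral_bigcup//.
- by apply: eq_eseriesr => i _; exact: PF.
- apply/trivIsetP => i j _ _ ij; rewrite -subset0 => x [[_ Fi] [_ Fj]].
  move/trivIsetP : tF => /(_ _ _ Logic.I Logic.I ij) e.
  by have := conj Fi Fj : (F i `&` F j) _; rewrite e.
- by move=> i; exact: mpre.
- rewrite -setI_bigcupr -preimage_bigcup; apply: int_preimage => //.
  exact: bigcup_measurable.
- apply/trivIsetP => i j _ _ ij; rewrite -subset0 => x [[_ Fi] [_ Fj]].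
  move/trivIsetP : tF => /(_ _ _ Logic.I Logic.I ij) e.
  by have := conj Fi Fj : (F i `&` F j) _; rewrite e.
- by move=> i; exact: mpre.
- rewrite -setI_bigcupr -preimage_bigcup; apply: int_preimage => //.
  exact: bigcup_measurable.
Qed.

End determination.

HB.instance Definition _ (R : realType) n :=
  @Measure_isFinite.Build _ _ _ (@surface_measure R n)
    (lty_fin_num_fun (@surface_measure_fin R n)).

(** * Change of variables along the flow *)

Section change_of_variables.
Context {R : realType} (n : nat) (Phi : 'rV[R]_n).
Hypothesis n0 : (0 < n)%N.
Hypothesis Phi1 : dot Phi Phi = 1.
Local Notation E := 'rV[R]_n.
Local Notation S := (@sphere R n).
Local Notation sigma := (@surface_measure R n).
Local Notation mS := (@measurable_sphere R n).

Lemma measurable_flow_fix s : measurable_fun setT (flow Phi s).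
Proof. by apply: (@measurable_flow _ _ Phi _ E (fun=> s) id) => //. Qed.

Lemma measurable_jac_fix s : measurable_fun setT (jac Phi s).
Proof. by apply: (@measurable_jac _ _ Phi _ E (fun=> s) id) => //. Qed.

Lemma integrable_jac s : sigma.-integrable S (EFin \o jac Phi s).
Proof.
have [_ i1 _ _] := lie_pair_cst n0 Phi1.
have := @integrable_bounded _ _ (cst 1) (jac Phi s) (expR (`|s| * n.-1%:R)) i1
  (measurable_jac_fix s).
move=> H; apply: eq_integrable (H _); [exact: mS|by move=> x _; rewrite /= mul1r|].
by move=> x Sx; rewrite ger0_norm ?jac_le// ltW// jac_gt0.
Qed.

(** The surface measure is compared with the image under the flow of [jac] times itself; on bumps
    they agree by [integral_flow_test_cst]. *)
Let jac_transfer s A : measurable A ->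
  (\int[sigma]_(x in S) (jac Phi s x * \1_A (flow Phi s x))%:E = sigma (A `&` S))%E.
Proof.
move=> mA.
have [_ i1 _ _] := lie_pair_cst n0 Phi1.
have mid : measurable_fun setT (@id E) by exact: measurable_id.
have := @integral_determined R n _ _ E E sigma sigma S S (flow Phi s) id (jac Phi s) (cst 1)
  mS mS (measurable_flow_fix s) mid (integrable_jac s) i1 _ A mA.
have -> : (\int[sigma]_(x in S `&` id @^-1` A) (cst 1 x)%:E = sigma (A `&` S))%E.
  rewrite preimage_id setIC -[RHS]mul1e -integral_cst//.
  by apply: measurableI => //; exact: mS.
move=> <-.
  rewrite integral_mkcondr; apply: eq_integral => x _; rewrite patchE indicE.
  case: ifPn => [|/negP]; rewrite inE => h; first by rewrite mem_set// mulr1.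
  by rewrite memNset// mulr0.
move=> k a; rewrite [RHS](_ : _ = (\int[sigma]_(x in S) (bump k a x)%:E)%E); last first.
  by apply: eq_integral => x _; rewrite mul1r.
rewrite -(integral_flow_test_cst n0 Phi1 k a s).
by apply: eq_integral => x _; rewrite mulrC.
Qed.

Lemma integral_flow s (h : E -> \bar R) : measurable_fun setT h ->
  (\int[sigma]_(x in S) ((jac Phi s x)%:E * h (flow Phi s x)) = \int[sigma]_(x in S) h x)%E.
Proof.
move=> mh; apply: integral_transfer => //.
- exact: mS.
- exact: mS.
- exact: measurable_flow_fix.
- exact: measurable_jac_fix.
- by move=> x Sx; rewrite ltW// jac_gt0.
- exact: jac_transfer.
Qed.

Lemma integrable_flow s (h : E -> \bar R) : measurable_fun setT h ->
  sigma.-integrable S (fun x => (jac Phi s x)%:E * h (flow Phi s x))%E <->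
  sigma.-integrable S h.
Proof.
move=> mh; apply: integrable_transfer => //.
- exact: mS.
- exact: mS.
- exact: measurable_flow_fix.
- exact: measurable_jac_fix.
- by move=> x Sx; rewrite ltW// jac_gt0.
- exact: jac_transfer.
Qed.

Lemma flowNK s x : S x -> flow Phi s (flow Phi (- s) x) = x.
Proof. by move=> Sx; rewrite -{1}(opprK s) flowK. Qed.

Lemma integral_flow_comp s (h : E -> \bar R) : measurable_fun setT h ->
  (\int[sigma]_(x in S) h (flow Phi s x) =
   \int[sigma]_(x in S) ((jac Phi (- s) x)%:E * h x))%E.
Proof.
move=> mh.
rewrite -(@integral_flow (- s) (h \o flow Phi s)); last first.
  by apply: measurableT_comp => //; exact: measurable_flow_fix.
by apply: eq_integral => x xS; rewrite inE in xS; rewrite /= flowNK.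
Qed.

Lemma integrable_flow_comp s (h : E -> R) : measurable_fun setT h ->
  sigma.-integrable S (EFin \o h) ->
  sigma.-integrable S (fun x => (h (flow Phi s x))%:E).
Proof.
move=> mh ih.
apply/(integrable_flow (- s)).
  by apply/measurable_EFinP; apply: (measurableT_comp mh); exact: measurable_flow_fix.
have := @integrable_bounded _ _ h (jac Phi (- s)) (expR (`|- s| * n.-1%:R)) ih
  (measurable_jac_fix (- s)).
move=> H; apply: eq_integrable (H _); [exact: mS| |].
  by move=> x xS; rewrite inE in xS; rewrite flowNK// EFinM muleC.
by move=> x Sx; rewrite ger0_norm ?jac_le// ltW// jac_gt0.
Qed.

End change_of_variables.

Section time_interval.
Context {R : realType} (n : nat) (t : R).

Lemma measurable_indic2 : measurable_fun setT
  (fun z : 'rV[R]_n * measurableTypeR R => \1_(sphere n) z.1 * \1_`[0, t] z.2 : R).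
Proof.
have m1 : measurable_fun setT (\1_(sphere n) : 'rV[R]_n -> R).
  by apply: measurable_indic; exact: measurable_sphere.
have mI : measurable (`[0, t]%classic : set (measurableTypeR R)) by exact: measurable_itv.
have m2 : measurable_fun setT (\1_`[0, t] : measurableTypeR R -> R) by exact: measurable_indic.
apply: measurable_funM; first exact: (measurableT_comp m1 measurable_fst).
exact: (measurableT_comp m2 measurable_snd).
Qed.

Lemma lebesgue_itv0 : 0 < t -> lebesgue_measure `[0, t]%classic = t%:E.
Proof. by move=> t0; rewrite lebesgue_measure_itv/= lte_fin t0 -EFinB subr0. Qed.

End time_interval.

(** * Absolute continuity along the flow *)

Section lie_pair_flow.
Context {R : realType} (n : nat) (Phi : 'rV[R]_n).
Hypothesis n0 : (0 < n)%N.
Hypothesis Phi1 : dot Phi Phi = 1.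
Local Notation E := 'rV[R]_n.
Local Notation S := (@sphere R n).
Local Notation sigma := (@surface_measure R n).
Local Notation mS := (@measurable_sphere R n).
Local Notation leb := (@lebesgue_measure R).
Variables (f g : E -> R) (t : R).
Hypothesis fg : lie_pair Phi f g.
Hypothesis t0 : 0 < t.

Let mf : measurable_fun setT f. Proof. by have [[]] := fg. Qed.
Let mg : measurable_fun setT g. Proof. by have [[]] := fg. Qed.
Let fi : sigma.-integrable S (EFin \o f). Proof. by have [_ ? _ _] := fg. Qed.
Let gi : sigma.-integrable S (EFin \o g). Proof. by have [_ _ ? _] := fg. Qed.

Let f2 (z : E * measurableTypeR R) : R :=
  \1_S z.1 * \1_`[0, t] z.2 * g (flow Phi z.2 z.1).

Let mf2 : measurable_fun setT f2.
Proof.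
by apply: measurable_funM; [exact: measurable_indic2|exact: (measurableT_comp mg (measurable_flow2 Phi))].
Qed.

Let C := expR (t * n.-1%:R).

(** A bound uniform in time, which makes [f2] integrable on the product of the sphere with
    [[0, t]]. *)
Let absg_flow s : 0 <= s <= t ->
  (\int[sigma]_(x in S) `|g (flow Phi s x)|%:E <= C%:E * \int[sigma]_(x in S) `|g x|%:E)%E.
Proof.
move=> /andP[s0 st].
have mag : measurable_fun setT (fun x => `|g x|%:E).
  by apply/measurable_EFinP; exact: measurableT_comp.
rewrite (@integral_flow_comp _ _ _ n0 Phi1 s (fun x => `|g x|%:E) mag).
rewrite -ge0_integralZl//; last 3 first.
- exact: mS.
- exact: measurable_funTS.
- by rewrite lee_fin expR_ge0.
apply: ge0_le_integral => //.
- exact: mS.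
- by move=> x Sx; rewrite mule_ge0// lee_fin ltW// jac_gt0.
- apply: emeasurable_funM; last exact: measurable_funTS.
  by apply/measurable_EFinP/measurable_funTS; exact: measurable_jac_fix.
- by apply: emeasurable_funM => //; exact: measurable_funTS.
move=> x Sx; rewrite lee_wpmul2r// lee_fin; apply: (le_trans (jac_le Phi1 _ Sx)).
by rewrite ler_expR ler_wpM2r// normrN ger0_norm.
Qed.

Let if2 : (sigma \x leb)%E.-integrable setT (EFin \o f2).
Proof.
apply/integrable21ltyP; first exact/measurable_EFinP.
have H : (\int[leb]_s \int[sigma]_x `|(f2 (x, s))%:E| <=
    \int[leb]_(s in `[0%R, t]) (C%:E * \int[sigma]_(x in S) `|g x|%:E))%E.
  rewrite [leRHS]integral_mkcond; apply: ge0_le_integral => //.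
  - by move=> s _; exact: integral_ge0.
  - apply: (@measurable_fun_fubini_tonelli_G _ _ _ _ _ sigma (fun z => `|(f2 z)%:E|%E)) => //.
    by apply: measurableT_comp => //; exact/measurable_EFinP.
  - by apply/(measurable_restrictT _ _).1; [exact: measurable_itv|exact: measurable_cst].
  move=> s _; rewrite patchE; case: ifPn => [|/negP]; rewrite inE/= => sI.
    have st : (0 <= s <= t)%R by move: sI; rewrite in_itv.
    apply: le_trans (absg_flow st).
    rewrite [leRHS]integral_mkcond le_eqVlt; apply/orP; left; apply/eqP.
    apply: eq_integral => x _; rewrite /f2 /= patchE !indicE.
    rewrite (mem_set (A := `[0, t]%classic))// mulr1.
    by case: ifPn => _; rewrite ?mul1r ?mul0r ?normr0.
  rewrite integral0_eq// => x _.
  by rewrite /f2 /= [\1_`[_, _] _]indicE memNset// mulr0 mul0r normr0.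
apply: le_lt_trans H _; rewrite integral_cst//.
apply: lte_mul_pinfty.
- by rewrite mule_ge0 ?lee_fin ?expR_ge0//; apply: integral_ge0.
- apply: fin_numM => //.
  by have := integrable_fin_num mS (integrable_norm gi).
by rewrite [X in (X < _)%E](lebesgue_itv0 t0) ltry.
Qed.

Let Q := fubini_F leb (EFin \o f2).

(** This is [duhamel] after undoing the transport at each time: the test function becomes
    independent of time and Fubini applies. *)
Let identity k a : (\int[sigma]_(x in S) ((f (flow Phi t x) - f x) * bump k a x)%:E =
  \int[sigma \x leb]_z (f2 z * bump k a z.1)%:E)%E.
Proof.
have mb := measurable_bump k a.
have bM (x : E) : `|bump k a x| <= 1.
  by rewrite ger0_norm ?bump_le1// ltW// bump_gt0.
have flow_bump (h : E -> R) s : measurable_fun setT h ->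
    (\int[sigma]_(x in S) (h (flow Phi s x) * bump k a x)%:E =
     \int[sigma]_(x in S) (h x * flow_test Phi k a (- s) x)%:E)%E.
  move=> mh.
  rewrite -(@integral_flow _ _ _ n0 Phi1 (- s) (fun x => (h (flow Phi s x) * bump k a x)%:E)).
    apply: eq_integral => x xS; rewrite inE in xS; rewrite flowNK// -EFinM.
    by congr EFin; rewrite /flow_test; ring.
  apply/measurable_EFinP/measurable_funM => //.
  by apply: (measurableT_comp mh); exact: measurable_flow_fix.
have i2 : (sigma \x leb)%E.-integrable setT (fun z => (f2 z * bump k a z.1)%:E).
  have mb2 : measurable_fun setT (fun z : E * measurableTypeR R => bump k a z.1).
    exact: (measurableT_comp mb measurable_fst).
  have := @integrableMl _ _ _ (sigma \x leb)%E setT measurableT (EFin \o f2) _ if2 mb2.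
  apply; exists 1; split; first exact: num_real.
  by move=> y y1 z _; apply: le_trans (bM _) (ltW y1).
rewrite -integral21_prod_meas1//.
have D := duhamel Phi1 k a fg t0.
transitivity (\int[leb]_(s in `[0%R, t])
   (\int[sigma]_(x in S) (g x * flow_test Phi k a (- s) x))%R%:E)%E; last first.
  rewrite [LHS]integral_mkcond; apply: eq_integral => s _; rewrite patchE.
  case: ifPn => [|/negP]; rewrite inE/= => sI.
    have ig := @integrable_flow_test _ _ Phi Phi1 g k a (- s) gi.
    rewrite /Rintegral fineK ?integrable_fin_num//; last exact: mS.
    rewrite -flow_bump// [LHS]integral_mkcond; apply: eq_integral => x _.
    rewrite /f2 patchE !indicE /= (mem_set (A := `[0, t]%classic))// mulr1.
    by case: ifPn => _; rewrite ?mul1r ?mul0r.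
  rewrite /fubini_G integral0_eq// => x _.
  by rewrite /f2 /= [\1_`[_, _] _]indicE memNset// mulr0 !mul0r.
rewrite D EFinB.
have ift := @integrable_flow_test _ _ Phi Phi1 f k a (- t) fi.
have ifb : sigma.-integrable S (fun x => (f x * bump k a x)%:E).
  exact: (@integrable_bounded _ _ f (bump k a) 1).
rewrite /Rintegral !fineK ?integrable_fin_num//; try exact: mS.
rewrite -flow_bump//.
have ift2 : sigma.-integrable S (fun x => (f (flow Phi t x) * bump k a x)%:E).
  apply: (@integrable_bounded _ _ (fun x => f (flow Phi t x)) (bump k a) 1) => //.
  exact: integrable_flow_comp.
rewrite -integralB//; last exact: mS.
by apply: eq_integral => x _; rewrite -EFinB mulrBl.
Qed.

Let mdiff : measurable_fun setT (fun x => f (flow Phi t x) - f x).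
Proof.
apply: measurable_funB => //; apply: (measurableT_comp mf); exact: measurable_flow_fix.
Qed.

Let idiff : sigma.-integrable S (fun x => (f (flow Phi t x) - f x)%:E).
Proof.
have i1 : sigma.-integrable S (fun x => (f (flow Phi t x))%:E).
  exact: integrable_flow_comp.
apply: eq_integrable (integrableB mS i1 fi) => [|x _]; first exact: mS.
by rewrite /= -EFinB.
Qed.

Let mQ : measurable_fun setT Q.
Proof. exact: (measurable_fubini_F if2). Qed.

(** By [identity] both sides have the same pairing with every bump, hence by [integral_determined]
    the same integral on every measurable subset of the sphere. *)
Let diffQ : ae_eq sigma S (fun x => (f (flow Phi t x) - f x)%:E) Q.
Proof.
apply: integral_ae_eq => //; [exact: mS|exact: measurable_funTS|].
move=> A AS mA.
have mid : measurable_fun setT (@id E) by exact: measurable_id.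
have mfst : measurable_fun setT (fun z : E * measurableTypeR R => z.1) by exact: measurable_fst.
have := @integral_determined R n _ _ E (E * measurableTypeR R)%type sigma (sigma \x leb)%E
  S setT id (fun z => z.1) (fun x => f (flow Phi t x) - f x) f2 mS measurableT
  mid mfst idiff if2 identity A mA.
rewrite preimage_id (setIidr AS) => ->.
rewrite setTI.
have m1A : measurable_fun setT (\1_A : E -> R) by exact: measurable_indic.
have mA2 : measurable_fun setT (fun z : E * measurableTypeR R => \1_A z.1 : R).
  exact: (measurableT_comp m1A measurable_fst).
have i2 : (sigma \x leb)%E.-integrable setT (fun z => (f2 z * \1_A z.1)%:E).
  have := @integrableMl _ _ _ (sigma \x leb)%E setT measurableT (EFin \o f2) _ if2 mA2.
  apply; exists 1; split; first exact: num_real.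
  move=> y y1 z _ /=; rewrite ger0_norm//; apply: le_trans _ (ltW y1).
  by rewrite indicE lern1 leq_b1.
transitivity (\int[sigma \x leb]_z (f2 z * \1_A z.1)%:E)%E.
  rewrite integral_mkcond; apply: eq_integral => z _; rewrite patchE indicE.
  case: ifPn => [|/negP]; rewrite inE => h; first by rewrite mem_set// mulr1.
  by rewrite memNset// mulr0.
rewrite -(integral12_prod_meas1 i2) [RHS]integral_mkcond.
apply: eq_integral => x _.
rewrite /fubini_F patchE /=.
case: ifPn => xA; first by apply: eq_integral => s _; rewrite indicE xA mulr1.
by rewrite integral0_eq// => s _; rewrite indicE (negbTE xA) mulr0.
Qed.

Lemma lie_pair_flow_le : {ae sigma, forall x, S x ->
  (`|f (flow Phi t x)|%:E <=
   `|f x|%:E + \int[leb]_(s in `[0%R, t]) `|g (flow Phi s x)|%:E)%E}.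
Proof.
move: diffQ; apply: filterS => x + Sx => /(_ Sx) dQ.
apply: (@le_trans _ _ (`|f x|%:E + `|f (flow Phi t x) - f x|%:E)%E).
  by rewrite -EFinD lee_fin; have := ler_normD (f x) (f (flow Phi t x) - f x); rewrite addrC subrK.
apply: leeD => //.
rewrite -abse_EFin dQ /Q /fubini_F.
apply: (le_trans (le_abse_integral _ measurableT _)).
  by apply: measurableT_comp; [exact/measurable_EFinP|exact: measurable_pair1].
rewrite [leRHS]integral_mkcond le_eqVlt; apply/orP; left; apply/eqP.
apply: eq_integral => s _; rewrite /f2 /= patchE !indicE (mem_set (A := S))// mul1r.
by case: ifPn => _; rewrite ?mul1r ?mul0r ?normr0.
Qed.

End lie_pair_flow.

(** * The inequality on a hemisphere *)

Section young.
Context {R : realType} (p : R).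
Hypothesis p_gt1 : 1 < p.
Implicit Types x y : R.

Let p_gt0 : 0 < p. Proof. exact: lt_trans ltr01 p_gt1. Qed.

(** Young's inequality for [y] and the power p - 1 of [x], with the conjugate exponents [p] and
    [p / (p - 1)]. *)
Lemma powR_young x y : 0 <= x -> 0 <= y ->
  p * (x `^ (p - 1) * y) <= (p - 1) * x `^ p + y `^ p.
Proof.
move=> x0 y0.
have p1 : 0 < p - 1 by rewrite subr_gt0.
have := @conjugate_powR R y (x `^ (p - 1)) p (p / (p - 1)) y0 (powR_ge0 _ _) p_gt0.
rewrite divr_gt0// => /(_ isT).
have -> : p^-1 + (p / (p - 1))^-1 = 1.
  by rewrite invf_div; field; rewrite gt_eqF.
move=> /(_ erefl).
rewrite -powRrM (_ : (p - 1) * (p / (p - 1)) = p); last by field; rewrite gt_eqF.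
move=> h; have := ler_wpM2l (ltW p_gt0) h.
rewrite mulrDr invf_div.
rewrite (_ : p * (y `^ p / p) = y `^ p); last by field; rewrite gt_eqF.
rewrite (_ : p * (x `^ p * ((p - 1) / p)) = (p - 1) * x `^ p); last by field; rewrite gt_eqF.
by rewrite (mulrC y) [X in _ <= X]addrC.
Qed.

(** Convexity of the power [p], here a rearrangement of Young's inequality. *)
Lemma powR_sub_le x y : 0 <= x -> 0 <= y ->
  x `^ p - y `^ p <= p * x `^ (p - 1) * (x - y).
Proof.
move=> x0 y0; have := powR_young x0 y0.
have -> : p * x `^ (p - 1) * (x - y) = p * (x `^ (p - 1) * x) - p * (x `^ (p - 1) * y).
  ring.
have -> : x `^ (p - 1) * x = x `^ p.
  have [->|x_neq0] := eqVneq x 0; first by rewrite mulr0 powR0// gt_eqF.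
  by rewrite -{2}(powRr1 x0) -powRD ?subrK ?x_neq0 ?implybT.
lra.
Qed.

End young.

Lemma ae_integral_le_split d (T : measurableType d) (R : realType)
    (mu : {measure set T -> \bar R}) (D : set T) (mD : measurable D) (c : R)
    (f1 f2 f3 f4 : T -> \bar R) : 0 <= c ->
  measurable_fun setT f1 -> measurable_fun setT f2 ->
  measurable_fun setT f3 -> measurable_fun setT f4 ->
  (forall x, 0 <= f1 x)%E -> (forall x, 0 <= f2 x)%E ->
  (forall x, 0 <= f3 x)%E -> (forall x, 0 <= f4 x)%E ->
  {ae mu, forall x, D x -> (c%:E * f1 x <= c%:E * f2 x + (f3 x + f4 x))%E} ->
  (c%:E * \int[mu]_(x in D) f1 x <= c%:E * \int[mu]_(x in D) f2 x +
    (\int[mu]_(x in D) f3 x + \int[mu]_(x in D) f4 x))%E.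
Proof.
move=> c0 m1 m2 m3 m4 f10 f20 f30 f40 le1.
have cE : (0 <= c%:E)%E by rewrite lee_fin.
have [{}m1 {}m2 {}m3 {}m4] : [/\ measurable_fun D f1, measurable_fun D f2,
    measurable_fun D f3 & measurable_fun D f4] by split; exact: measurable_funTS.
rewrite -!ge0_integralZl// -!ge0_integralD//; first last.
- exact: emeasurable_funD.
- by move=> x _; rewrite adde_ge0.
- exact: measurable_funeM.
- by move=> x _; rewrite mule_ge0.
apply: ae_ge0_le_integral => //.
- by move=> x _; rewrite mule_ge0.
- exact: measurable_funeM.
- by move=> x _; rewrite adde_ge0 ?mule_ge0// adde_ge0.
- by apply: emeasurable_funD; [exact: measurable_funeM|exact: emeasurable_funD].
Qed.

Section hemisphere_upper.
Context {R : realType} (n : nat) (Phi : 'rV[R]_n).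
Hypothesis n0 : (0 < n)%N.
Hypothesis Phi1 : dot Phi Phi = 1.
Local Notation E := 'rV[R]_n.
Local Notation S := (@sphere R n).
Local Notation sigma := (@surface_measure R n).
Local Notation mS := (@measurable_sphere R n).
Local Notation leb := (@lebesgue_measure R).
Local Notation lat x := (dot x Phi).
Variables (p alpha : R) (f g : E -> R) (a b : R -> R).
Hypothesis p_gt1 : 1 < p.
Hypothesis alpha_gt0 : 0 < alpha.
Hypothesis fg : lie_pair Phi f g.
Hypotheses (ma : measurable_fun setT a) (mb : measurable_fun setT b).
Hypotheses (a_ge0 : forall c, 0 <= a c) (b_ge0 : forall c, 0 <= b c).
Hypothesis nda : forall c c', -1 <= c' -> c' <= c -> c <= 1 -> a c' <= a c.
Hypothesis ndb : forall c c', -1 <= c' -> c' <= c -> c <= 1 -> b c' <= b c.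

Let h c := a c `^ (p - 1) * b c.

Let p_ge0 : 0 <= p. Proof. exact: ltW (lt_trans ltr01 p_gt1). Qed.

Let p1_ge0 : 0 <= p - 1. Proof. by rewrite subr_ge0 ltW. Qed.

Let mf : measurable_fun setT f. Proof. by have [[]] := fg. Qed.
Let mg : measurable_fun setT g. Proof. by have [[]] := fg. Qed.

Let mlat : measurable_fun setT (fun x : E => lat x).
Proof. exact: measurable_dot. Qed.

Let mal : measurable_fun setT (fun x : E => a (lat x)).
Proof. exact: (measurableT_comp ma mlat). Qed.

Let mbl : measurable_fun setT (fun x : E => b (lat x)).
Proof. exact: (measurableT_comp mb mlat). Qed.

Let mpow (k : E -> R) r : measurable_fun setT k -> measurable_fun setT (fun x => `|k x| `^ r).
Proof.
move=> mk; apply: (measurableT_comp (measurable_powR r)).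
exact: measurableT_comp.
Qed.

Let sphereZl (k : R) (F : E -> \bar R) : 0 <= k -> measurable_fun setT F ->
  (forall x, (0 <= F x)%E) ->
  (\int[sigma]_(x in S) (k%:E * F x) = k%:E * \int[sigma]_(x in S) F x)%E.
Proof.
move=> k0 mF F0; apply: ge0_integralZl => //; [exact: mS|exact: measurable_funTS].
Qed.

Let mwk (w : R -> R) (k : E -> R) : measurable_fun setT w -> measurable_fun setT k ->
  measurable_fun setT (fun x : E => (w (lat x) `^ p * `|k x| `^ p)%:E).
Proof.
move=> mw mk; apply/measurable_EFinP/measurable_funM; last exact: mpow.
by apply: (measurableT_comp (measurable_powR p)); exact: (measurableT_comp mw mlat).
Qed.

Let wk_ge0 (w : R -> R) (k : E -> R) x : (0 <= (w (lat x) `^ p * `|k x| `^ p)%:E)%E.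
Proof. by rewrite lee_fin mulr_ge0 ?powR_ge0. Qed.

(** Flowing back lowers the latitude: the difference is [(1 - c ^+ 2) * sinhR s] divided by the
    positive denominator. *)
Lemma flow_lat_le (s c : R) : 0 <= s -> -1 <= c <= 1 -> flow_lat (- s) c <= c.
Proof.
move=> s0 /andP[c1 c2]; have cc : `|c| <= 1 by rewrite ler_norml c1.
rewrite /flow_lat ler_pdivrMr ?flow_den_gt0//.
rewrite /flow_dden /flow_den coshRN sinhRN.
have sh0 : 0 <= sinhR s.
  by rewrite /sinhR divr_ge0// subr_ge0 ler_expR; lra.
have : 0 <= (1 - c) * (1 + c) * sinhR s.
  by apply: mulr_ge0 => //; apply: mulr_ge0; lra.
by lra.
Qed.

(** The change of variables moves the flow from [k] to the weight, which is then evaluated at a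
    lower latitude and only gets smaller; the Jacobian costs the exponential factor. *)
Let weight_flow (w : R -> R) (k : E -> R) s t : 0 <= s <= t ->
  measurable_fun setT w -> (forall c, 0 <= w c) ->
  (forall c c', -1 <= c' -> c' <= c -> c <= 1 -> w c' <= w c) ->
  measurable_fun setT k ->
  (\int[sigma]_(x in S) (w (lat x) `^ p * `|k (flow Phi s x)| `^ p)%:E <=
   (expR (t * n.-1%:R))%:E * \int[sigma]_(x in S) (w (lat x) `^ p * `|k x| `^ p)%:E)%E.
Proof.
move=> /andP[s0 st] mw w0 ndw mk.
have mwl : measurable_fun setT (fun x : E => w (lat x) `^ p).
  by apply: (measurableT_comp (measurable_powR p)); exact: (measurableT_comp mw mlat).
have mks : measurable_fun setT (fun x : E => `|k (flow Phi s x)| `^ p).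
  apply: (@mpow (k \o flow Phi s)); apply: (measurableT_comp mk).
  exact: measurable_flow_fix.
rewrite -(@integral_flow _ _ _ n0 Phi1 (- s)
   (fun x => (w (lat x) `^ p * `|k (flow Phi s x)| `^ p)%:E)); last first.
  exact/measurable_EFinP/measurable_funM.
rewrite -(sphereZl (expR_ge0 _) (mwk mw mk) (wk_ge0 w k)).
apply: ge0_le_integral => //.
- exact: mS.
- by move=> x Sx; rewrite mule_ge0// lee_fin ?mulr_ge0 ?powR_ge0// ltW// jac_gt0.
- apply: emeasurable_funM.
    by apply/measurable_EFinP/measurable_funTS; exact: measurable_jac_fix.
  apply/measurable_EFinP/measurable_funTS.
  have mfl := @measurable_flow_fix _ _ Phi (- s).
  exact: (measurableT_comp (measurable_funM mwl mks) mfl).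
- by apply: emeasurable_funM => //; exact: (measurable_funTS (mwk mw mk)).
move=> x Sx; rewrite flowNK// lat_flow// -!EFinM lee_fin.
have lx := normr_dot_sphere Phi1 Sx; have lx' := lx; rewrite ler_norml in lx'.
have lf := flow_lat_le1 (- s) lx; rewrite ler_norml in lf.
case/andP: lf => lf1 lf2; case/andP: (lx') => l1 l2.
rewrite ler_pM ?mulr_ge0 ?powR_ge0//; first by rewrite ltW// jac_gt0.
  apply: (le_trans (jac_le Phi1 _ Sx)).
  by rewrite ler_expR ler_wpM2r// normrN ger0_norm.
rewrite ler_wpM2r ?powR_ge0//; apply: ge0_ler_powR => //; rewrite ?nnegrE//.
by apply: ndw => //; exact: flow_lat_le.
Qed.

(** The increase over time [t] is at most [t] times the final right-hand side, up to a factor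
    tending to 1 with [t], so nothing is lost after division by [t]. *)
Lemma hemisphere_upper t : 0 < t ->
  ((alpha `^ (p - 1))%:E * \int[sigma]_(x in S) (h (lat x) * `|f (flow Phi t x)| `^ p)%:E <=
   (alpha `^ (p - 1))%:E * \int[sigma]_(x in S) (h (lat x) * `|f x| `^ p)%:E +
   (t * expR (t * n.-1%:R))%:E *
   (((p - 1) * alpha `^ p)%:E * \int[sigma]_(x in S) (a (lat x) `^ p * `|f x| `^ p)%:E +
     \int[sigma]_(x in S) (b (lat x) `^ p * `|g x| `^ p)%:E))%E.
Proof.
move=> t0.
have h0 c : 0 <= h c by rewrite mulr_ge0 ?powR_ge0.
have mhl : measurable_fun setT (fun x : E => h (lat x)).
  by apply: measurable_funM => //; exact: (measurableT_comp (measurable_powR _) mal).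
have mapl : measurable_fun setT (fun x : E => a (lat x) `^ p).
  exact: (measurableT_comp (measurable_powR _) mal).
have mbpl : measurable_fun setT (fun x : E => b (lat x) `^ p).
  exact: (measurableT_comp (measurable_powR _) mbl).
have mft : measurable_fun setT (fun x => f (flow Phi t x)).
  by apply: (measurableT_comp mf); exact: measurable_flow_fix.
have mI : measurable (`[0, t]%classic : set (measurableTypeR R)) by exact: measurable_itv.
pose H1 x := (h (lat x) * `|f (flow Phi t x)| `^ p)%:E.
pose H2 x := (h (lat x) * `|f x| `^ p)%:E.
pose H3 x := (t * ((p - 1) * alpha `^ p) * (a (lat x) `^ p * `|f (flow Phi t x)| `^ p))%:E.
pose F4 (z : E * measurableTypeR R) : \bar R :=
  (\1_S z.1 * \1_`[0, t] z.2 * (b (lat z.1) `^ p * `|g (flow Phi z.2 z.1)| `^ p))%:E.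
have mF4 : measurable_fun setT F4.
  apply/measurable_EFinP/measurable_funM.
    exact: measurable_indic2.
  apply: measurable_funM; first exact: (measurableT_comp mbpl measurable_fst).
  apply: (measurableT_comp (measurable_powR p)); apply: measurableT_comp => //.
  exact: (measurableT_comp mg (measurable_flow2 Phi)).
have F40 z : (0 <= F4 z)%E by rewrite lee_fin !mulr_ge0 ?powR_ge0.
pose H4 x := (\int[leb]_s F4 (x, s))%E.
have mH1 : measurable_fun setT H1.
  by apply/measurable_EFinP/measurable_funM => //; exact: mpow.
have mH2 : measurable_fun setT H2.
  by apply/measurable_EFinP/measurable_funM => //; exact: mpow.
have mH3 : measurable_fun setT H3.
  apply/measurable_EFinP/measurable_funM => //; apply: measurable_funM => //; exact: mpow.
have mH4 : measurable_fun setT H4 by exact: measurable_fun_fubini_tonelli_F.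
have c0 : 0 <= alpha `^ (p - 1) by exact: powR_ge0.
have H10 x : (0 <= H1 x)%E by rewrite lee_fin mulr_ge0 ?powR_ge0.
have H20 x : (0 <= H2 x)%E by rewrite lee_fin mulr_ge0 ?powR_ge0.
have H30 x : (0 <= H3 x)%E.
  by rewrite lee_fin !mulr_ge0 ?powR_ge0// ltW.
have H40 x : (0 <= H4 x)%E by exact: integral_ge0.
have key : {ae sigma, forall x, S x ->
   ((alpha `^ (p - 1))%:E * H1 x <= (alpha `^ (p - 1))%:E * H2 x + (H3 x + H4 x))%E}.
  have := lie_pair_flow_le n0 Phi1 fg t0; apply: filterS => x fle Sx.
  have {}fle := fle Sx.
  have [ltf|gtf] := leP (`|f (flow Phi t x)|) (`|f x|).
    apply: (@le_trans _ _ ((alpha `^ (p - 1))%:E * H2 x)%E).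
      by rewrite lee_wpmul2l ?lee_fin// ler_wpM2l// ge0_ler_powR ?nnegrE.
    by rewrite leeDl// adde_ge0.
  have e4 : H4 x = (\int[leb]_(s in `[0%R, t]) (b (lat x) `^ p * `|g (flow Phi s x)| `^ p)%:E)%E.
    rewrite [RHS]integral_mkcond; apply: eq_integral => s _.
    rewrite /F4 /= patchE !indicE (mem_set (A := S))// mul1r.
    by case: ifPn => _; rewrite ?mul1r ?mul0r.
  have mgs : measurable_fun setT (fun s : measurableTypeR R => g (flow Phi s x)).
    exact: (measurableT_comp mg (measurableT_comp (measurable_flow2 Phi) (measurable_pair1 x))).
  pose K := p * (alpha `^ (p - 1) * h (lat x) * `|f (flow Phi t x)| `^ (p - 1)).
  have K0 : 0 <= K by rewrite !mulr_ge0 ?powR_ge0.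
  (* Convexity bounds the increase of |f|^p by p |f o F_t|^(p-1) times the increase of |f|, which is
     at most the time integral of |g o F_s|. *)
  have e1 : ((alpha `^ (p - 1))%:E * H1 x <= (alpha `^ (p - 1))%:E * H2 x +
     K%:E * (`|f (flow Phi t x)| - `|f x|)%:E)%E.
    rewrite -!EFinM -EFinD lee_fin.
    have := powR_sub_le p_gt1 (normr_ge0 (f (flow Phi t x))) (normr_ge0 (f x)).
    move=> /(ler_wpM2l (mulr_ge0 c0 (h0 (lat x)))).
    by rewrite /K; lra.
  apply: (le_trans e1); apply: leeD => //.
  apply: (@le_trans _ _ (K%:E * \int[leb]_(s in `[0%R, t]) `|g (flow Phi s x)|%:E)%E).
    rewrite lee_wpmul2l//; move: fle; rewrite EFinB leeBlDr// addeC; exact.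
  rewrite -ge0_integralZl//; last first.
    by apply/measurable_EFinP/measurable_funTS; exact: measurableT_comp.
  apply: (@le_trans _ _ (\int[leb]_(s in `[0%R, t])
     (((p - 1) * alpha `^ p * (a (lat x) `^ p * `|f (flow Phi t x)| `^ p))%:E +
      (b (lat x) `^ p * `|g (flow Phi s x)| `^ p)%:E))%E).
    apply: ge0_le_integral; [exact: mI| | | |].
    - by move=> s _; rewrite mule_ge0// lee_fin.
    - apply: emeasurable_funM; first exact: measurable_cst.
      by apply/measurable_EFinP/measurable_funTS; exact: measurableT_comp.
    - apply/measurable_EFinP/measurable_funTS/measurable_funD => //.
      apply: measurable_funM => //; apply: (measurableT_comp (measurable_powR p)).
      exact: measurableT_comp.
    move=> s _; rewrite -EFinM -EFinD lee_fin.
    (* Young's inequality is applied to x = alpha a |f o F_t| and y = b |g o F_s|; since h = a^(p-1)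
       b, the product p x^(p-1) y is K |g o F_s|. *)
    have x0 : 0 <= alpha * a (lat x) * `|f (flow Phi t x)| by rewrite !mulr_ge0// ltW.
    have y0 : 0 <= b (lat x) * `|g (flow Phi s x)| by rewrite mulr_ge0.
    have := powR_young p_gt1 x0 y0.
    rewrite !powRM ?mulr_ge0 ?(ltW alpha_gt0)// /K /h; lra.
  rewrite ge0_integralD; [|exact: mI| |exact: measurable_cst| |]; last 3 first.
  - by move=> s _; rewrite lee_fin !mulr_ge0 ?powR_ge0.
  - by move=> s _; rewrite lee_fin mulr_ge0 ?powR_ge0.
  - apply/measurable_EFinP/measurable_funTS/measurable_funM => //.
    by apply: (measurableT_comp (measurable_powR p)); exact: measurableT_comp.
  rewrite e4; apply: leeD => //.
  rewrite integral_cst// [X in (_ * X <= _)%E](lebesgue_itv0 t0) -EFinM lee_fin.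
  by rewrite le_eqVlt; apply/orP; left; apply/eqP; ring.
have key2 : ((alpha `^ (p - 1))%:E * \int[sigma]_(x in S) H1 x <=
    (alpha `^ (p - 1))%:E * \int[sigma]_(x in S) H2 x +
    (\int[sigma]_(x in S) H3 x + \int[sigma]_(x in S) H4 x))%E.
  exact: (@ae_integral_le_split _ _ _ sigma S mS _ H1 H2 H3 H4).
apply: (le_trans key2); apply: leeD => //.
have [t0' pa0] : 0 <= t /\ 0 <= (p - 1) * alpha `^ p.
  by split; [exact: ltW|rewrite mulr_ge0 ?powR_ge0].
have A0 : (0 <= \int[sigma]_(x in S) (a (lat x) `^ p * `|f x| `^ p)%:E)%E.
  by apply: integral_ge0 => x _; rewrite lee_fin mulr_ge0 ?powR_ge0.
have B0 : (0 <= \int[sigma]_(x in S) (b (lat x) `^ p * `|g x| `^ p)%:E)%E.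
  by apply: integral_ge0 => x _; rewrite lee_fin mulr_ge0 ?powR_ge0.
have pA0 : (0 <= ((p - 1) * alpha `^ p)%:E *
    \int[sigma]_(x in S) (a (lat x) `^ p * `|f x| `^ p)%:E)%E.
  by apply: mule_ge0; [rewrite lee_fin; exact: pa0|exact: A0].
rewrite (ge0_muleDr _ pA0 B0); apply: leeD.
  rewrite /H3; under eq_integral do rewrite EFinM.
  rewrite (sphereZl (mulr_ge0 t0' pa0) (mwk ma mft) (wk_ge0 a (f \o flow Phi t))).
  have tt : 0 <= t <= t by rewrite t0' lexx.
  have := weight_flow tt ma a_ge0 nda mf.
  move=> /(lee_wpmul2l (_ : (0 <= (t * ((p - 1) * alpha `^ p))%:E)%E)).
  rewrite lee_fin mulr_ge0// => /(_ isT) W; apply: (le_trans W).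
  rewrite !muleA -!EFinM; apply: (lee_wpmul2r A0); rewrite lee_fin; lra.
rewrite [leLHS](_ : _ = \int[leb]_s \int[sigma]_x F4 (x, s))%E; last first.
  rewrite -(fubini_tonelli (m1 := sigma) (m2 := leb))// [LHS]integral_mkcond.
  apply: eq_integral => x _; rewrite patchE; case: ifPn => // xS.
  by rewrite integral0_eq// => s _; rewrite /F4 /= indicE (negbTE xS) !mul0r.
apply: (@le_trans _ _ (\int[leb]_(s in `[0%R, t]) ((expR (t * n.-1%:R))%:E *
   \int[sigma]_(x in S) (b (lat x) `^ p * `|g x| `^ p)%:E))%E).
  rewrite [leRHS]integral_mkcond; apply: ge0_le_integral => //.
  - by move=> s _; exact: integral_ge0.
  - exact: (@measurable_fun_fubini_tonelli_G _ _ _ _ _ sigma).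
  - by apply/(measurable_restrictT _ _).1; [exact: measurable_itv|exact: measurable_cst].
  move=> s _; rewrite patchE; case: ifPn => [|/negP]; rewrite inE/= => sI.
    have st : (0 <= s <= t)%R by move: sI; rewrite in_itv.
    apply: le_trans (weight_flow st mb b_ge0 ndb mg).
    rewrite [leRHS]integral_mkcond le_eqVlt; apply/orP; left; apply/eqP.
    apply: eq_integral => x _; rewrite /F4 /= patchE !indicE.
    rewrite (mem_set (A := `[0, t]%classic))// mulr1.
    by case: ifPn => _; rewrite ?mul1r ?mul0r.
  rewrite integral0_eq// => x _.
  by rewrite /F4 /= [\1_`[_, _] _]indicE memNset// mulr0 mul0r.
have lebt : leb `[0, t]%classic = t%:E by exact: lebesgue_itv0.
rewrite (integral_cst _ mI) [X in (_ * X <= _)%E]lebt muleC muleA -EFinM; exact: lexx.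
Qed.

End hemisphere_upper.

(** * Transport of functions of the latitude *)

Section latitude_flow.
Context {R : realType}.
Implicit Types (s c t : R).

Lemma is_derive_flow_lat s c : `|c| <= 1 ->
  is_derive s 1 (fun s => flow_lat (- s) c) (- (1 - flow_lat (- s) c ^+ 2)).
Proof.
move=> c1; have h := flow_den_gt0 (- s) c1; have h0 := lt0r_neq0 h.
have d : is_derive (- s) 1 (fun s => flow_lat s c) (1 - flow_lat (- s) c ^+ 2).
  apply: is_derive_eq (derM (is_derive_flow_dden (- s) c)
    (@derV _ _ (flow_den ^~ c) (- s) 1 _ h0 (is_derive_flow_den (- s) c))) _.
  by rewrite /flow_lat; field.
apply: is_derive_eq (der_comp (derN (is_derive_id s 1)) d) _.
by rewrite mulrN1.
Qed.

Lemma is_derive_flow_den_inv m s c : `|c| <= 1 ->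
  is_derive s 1 (fun s => (flow_den (- s) c)^-1 ^+ m)
    (m%:R * flow_lat (- s) c * (flow_den (- s) c)^-1 ^+ m).
Proof.
move=> c1; have h0 := lt0r_neq0 (flow_den_gt0 (- s) c1).
have d := @der_invX _ _ (flow_den ^~ c) m (- s) 1 _ h0 (is_derive_flow_den (- s) c).
apply: is_derive_eq (der_comp (derN (is_derive_id s 1)) d) _.
by rewrite /flow_lat; field.
Qed.

Lemma flow_den_inv_le m s c : `|c| <= 1 -> 0 <= s ->
  0 <= (flow_den (- s) c)^-1 ^+ m <= expR (s * m%:R).
Proof.
move=> c1 s0; have h := flow_den_gt0 (- s) c1.
rewrite exprn_ge0 ?invr_ge0 ?(ltW h)//= expRM_natr.
have h2 := flow_den_ge (- s) c1; rewrite normrN ger0_norm// expRN in h2.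
apply: lerXn2r; rewrite ?nnegrE ?expR_ge0 ?invr_ge0 ?(ltW h)//.
by rewrite -[leRHS]invrK lef_pV2// posrE invr_gt0 expR_gt0.
Qed.

Lemma flow_dden_nonincr s t c : `|c| <= 1 -> s <= t ->
  flow_dden (- t) c <= flow_dden (- s) c.
Proof.
move=> c1 st.
have d r : r \in `]s, t[ -> is_derive r 1 (fun r => flow_dden (- r) c) (- flow_den (- r) c).
  move=> _; apply: is_derive_eq (der_comp (derN (is_derive_id r 1)) (is_derive_flow_dden (- r) c)) _.
  by rewrite mulrN1.
have cont : {within `[s, t], continuous (fun r => flow_dden (- r) c)}.
  apply: continuous_subspaceT.
  apply: (is_derive_continuous (f := fun r => - flow_den (- r) c)) => r.
  apply: is_derive_eq (der_comp (derN (is_derive_id r 1)) (is_derive_flow_dden (- r) c)) _.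
  by rewrite mulrN1.
have [r _ e] := MVT_segment st d cont.
rewrite -subr_le0 e mulNr oppr_le0 mulr_ge0 ?subr_ge0//.
exact/ltW/flow_den_gt0.
Qed.

(** The sign of the latitude is that of [flow_dden], which decreases backwards in time: a point
    still in the open hemisphere at time [- t] was there at all times in between. *)
Lemma flow_lat_gt0 s t c : `|c| <= 1 -> s <= t ->
  0 < flow_lat (- t) c -> 0 < flow_lat (- s) c.
Proof.
move=> c1 st; rewrite /flow_lat !pmulr_lgt0 ?invr_gt0 ?flow_den_gt0// => h.
exact: lt_le_trans h (flow_dden_nonincr c1 st).
Qed.

Lemma sinhR_le t : 0 <= t <= 1 -> sinhR t <= expR 1 * t.
Proof.
move=> /andP[t0 t1].
have d r : r \in `]0, t[ -> is_derive r 1 (@sinhR R) (coshR r).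
  by move=> _; exact: is_derive_sinhR.
have cont : {within `[0, t], continuous (@sinhR R)}.
  apply: continuous_subspaceT; exact: (is_derive_continuous (@is_derive_sinhR R)).
have [r] := MVT_segment t0 d cont.
rewrite in_itv/= => /andP[r0 rt]; rewrite sinhR0 !subr0 => ->.
rewrite ler_wpM2r// /coshR ler_pdivrMr// mulr_natr mulr2n lerD// ler_expR; lra.
Qed.

Lemma coshR_ge1 t : 1 <= coshR t.
Proof.
have := coshR_sinhR t.
have c0 : 0 <= coshR t by rewrite /coshR divr_ge0// addr_ge0 ?expR_ge0.
have := sqr_ge0 (sinhR t); nra.
Qed.

End latitude_flow.

Section latitude_weight.
Context {R : realType} (m : nat) (h dh G : R -> R) (C : R).
Hypothesis h0 : forall c, -1 <= c <= 0 -> h c = 0.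
Hypothesis dhE : forall c : R, 0 < c <= 1 -> is_derive c 1 h (dh c).
(* [G] is minus the divergence of the field [tang Phi] weighted by [h] of the
   latitude. *)
Hypothesis GE : forall c, 0 < c <= 1 -> G c = m%:R * c * h c - (1 - c ^+ 2) * dh c.
Hypothesis G0 : forall c, -1 <= c <= 0 -> G c = 0.
Hypothesis GC : forall c, -1 <= c <= 1 -> `|G c| <= C.
Hypothesis hC : forall c, 0 <= c <= 1 -> 0 <= h c <= C * c.

(** With [m = n.-1], integrating |f|^p against this function of the latitude amounts to integrating
    |f o F_t|^p against [h]: the time dependence is carried by an explicit function. *)
Definition flow_weight (t c : R) : R := h (flow_lat (- t) c) * (flow_den (- t) c)^-1 ^+ m.

Lemma flow_weight0 c : flow_weight 0 c = h c.
Proof.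
by rewrite /flow_weight oppr0 /flow_lat flow_den0 flow_dden0 invr1 expr1n !mulr1.
Qed.

Let C0 : 0 <= C.
Proof. by apply: le_trans (normr_ge0 (G 0)) (GC _); apply/andP; split; lra. Qed.

Lemma is_derive_flow_weight s c : `|c| <= 1 -> 0 < flow_lat (- s) c ->
  is_derive s 1 (flow_weight ^~ c) (G (flow_lat (- s) c) * (flow_den (- s) c)^-1 ^+ m).
Proof.
move=> c1 l0; have l1 := flow_lat_le1 (- s) c1.
have lI : 0 < flow_lat (- s) c <= 1 by rewrite l0 (le_trans (ler_norm _) l1).
apply: is_derive_eq (derM (@der_comp _ _ (fun s => flow_lat (- s) c) h s 1 _ _
  (is_derive_flow_lat s c1) (dhE lI)) (is_derive_flow_den_inv m s c1)) _.
rewrite GE//; ring.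
Qed.

(** Three cases for the backward path from [c]. If [c <= 0], both weights are zero. If it reaches
    the equator or crosses it, [c] is at most of order [t] and [h c <= C * c] suffices. Otherwise it
    stays where [h] is derivable and the mean value theorem applies. *)
Lemma flow_weight_lip t c : 0 < t <= 1 -> -1 <= c <= 1 ->
  `|flow_weight t c - flow_weight 0 c| <= C * expR (1 + m%:R) * t.
Proof.
move=> /andP[t0 t1] /andP[cl cr].
have c1 : `|c| <= 1 by rewrite ler_norml cl.
have K0 : 0 <= C * expR (1 + m%:R) * t.
  by apply: mulr_ge0; [apply: mulr_ge0 => //; exact: expR_ge0|exact: ltW].
have lt1 s := flow_lat_le1 (- s) c1.
have [c_le0|c_gt0] := leP c 0.
  rewrite flow_weight0 h0 ?cl//.
  rewrite /flow_weight h0 ?mul0r ?subrr ?normr0//.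
  have := lt1 t; rewrite ler_norml => /andP[-> _] /=.
  by apply: le_trans c_le0; apply: flow_lat_le; [exact: ltW|rewrite cl].
have [ct_le0|ct_gt0] := leP (flow_lat (- t) c) 0.
  rewrite flow_weight0 /flow_weight h0; last first.
    by have := lt1 t; rewrite ler_norml => /andP[-> _].
  rewrite mul0r sub0r normrN.
  have /andP[hc0 hcC] : 0 <= h c <= C * c by apply: hC; rewrite ltW.
  rewrite ger0_norm//; apply: (le_trans hcC); rewrite -mulrA ler_wpM2l//.
  have sh := @sinhR_le R t; rewrite ltW//= in sh; have {}sh := sh t1.
  have ch := coshR_ge1 t.
  have : flow_dden (- t) c <= 0.
    by move: ct_le0; rewrite /flow_lat pmulr_lle0 ?invr_gt0 ?flow_den_gt0.
  rewrite /flow_dden sinhRN coshRN => hd.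
  (* From [c * coshR t <= sinhR t] and [1 <= coshR t]. *)
  have cs : c <= sinhR t by nra.
  apply: (le_trans cs); apply: (le_trans sh); rewrite ler_wpM2r ?(ltW t0)//.
  by rewrite ler_expR lerDl.
have der s : s \in `[0, t] -> is_derive s 1 (flow_weight ^~ c)
    (G (flow_lat (- s) c) * (flow_den (- s) c)^-1 ^+ m).
  rewrite in_itv/= => /andP[s0 st]; apply: is_derive_flow_weight => //.
  exact: flow_lat_gt0 st ct_gt0.
have [s sI ->] := MVT_segment (ltW t0) (fun s (sI : s \in `]0, t[) =>
   der s (subset_itv_oo_cc sI)) (derivable_within_continuous (fun s sI =>
     (let: DeriveDef h _ := der s sI in h))).
have /andP[s0 st] : 0 <= s <= t by move: sI; rewrite in_itv.
rewrite subr0 normrM (gtr0_norm t0) ler_wpM2r ?(ltW t0)// normrM.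
have /andP[J0 J1] := flow_den_inv_le m c1 s0.
rewrite (ger0_norm J0); apply: ler_pM => //.
  by apply: GC; rewrite -ler_norml lt1.
apply: (le_trans J1); rewrite ler_expR.
have m0 : 0 <= m%:R :> R by [].
nra.
Qed.

Lemma cvg_flow_weight c : -1 <= c <= 1 ->
  (flow_weight (harmonic j) c - flow_weight 0 c) / harmonic j @[j --> \oo] --> G c.
Proof.
move=> /andP[cl cr].
have c1 : `|c| <= 1 by rewrite ler_norml cl.
have [c_le0|c_gt0] := leP c 0.
  rewrite G0 ?cl//; apply: cvg_near_cst; apply: nearW => j.
  rewrite flow_weight0 h0 ?cl// /flow_weight h0 ?mul0r ?subrr ?mul0r//.
  have := flow_lat_le1 (- harmonic j) c1; rewrite ler_norml => /andP[-> _] /=.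
  by apply: le_trans c_le0; apply: flow_lat_le; [rewrite invr_ge0|rewrite cl].
have l0 : flow_lat (- 0) c = c.
  by rewrite oppr0 /flow_lat flow_den0 flow_dden0 invr1 mulr1.
have d : is_derive (0 : R) (1 : R) (flow_weight ^~ c)
    (G (flow_lat (- 0) c) * (flow_den (- 0) c)^-1 ^+ m).
  by apply: is_derive_flow_weight; rewrite ?l0.
have := cvg_difference_quotient d.
rewrite l0 oppr0 flow_den0 invr1 expr1n mulr1.
rewrite (_ : (fun j => _) = (fun j => (flow_weight (harmonic j) c - flow_weight 0 c) / harmonic j))//.
by apply/funext => j; rewrite add0r /GRing.scale/= mulr1.
Qed.

End latitude_weight.

Section limit_of_quotients.
Local Open Scope ereal_scope.
Context {R : realType}.

Lemma quotient_le (c t e : R) (A1 A0 K : \bar R) : A1 \is a fin_num ->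
  A0 \is a fin_num -> K \is a fin_num -> (0 < t)%R ->
  c%:E * A1 <= c%:E * A0 + (t * e)%:E * K ->
  c%:E * (t^-1%:E * (A1 - A0)) <= e%:E * K.
Proof.
move: A1 A0 K => [A1| |] [A0| |] [K| |]// _ _ _ t0.
rewrite -!(EFinM, EFinD, EFinB) !lee_fin => U.
by rewrite mulrCA ler_pdivrMl// mulrA mulrBr lerBlDl.
Qed.

Lemma limit_le (c : R) (u : (\bar R)^nat) (e : R^nat) (l K : \bar R) :
  u @ \oo --> l -> (e @ \oo --> (1 : R))%R -> K \is a fin_num ->
  (forall j, c%:E * u j <= (e j)%:E * K) -> c%:E * l <= K.
Proof.
move: K => [K| |]// ul e1 _ ue.
have h1 : c%:E * u j @[j --> \oo] --> c%:E * l by apply: cvgeZl.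
have h2 : (e j * K)%:E @[j --> \oo] --> K%:E.
  rewrite -[X in _ --> X%:E]mul1r; apply: cvg_EFin; first exact: nearW.
  by apply: cvgM; [exact: e1|exact: cvg_cst].
by apply: lee_cvg_to h1 h2 _; apply: nearW => j; rewrite EFinM.
Qed.

End limit_of_quotients.

Section hemisphere.
Context {R : realType} (n : nat) (Phi : 'rV[R]_n).
Hypothesis n0 : (0 < n)%N.
Hypothesis Phi1 : dot Phi Phi = 1.
Local Notation E := 'rV[R]_n.
Local Notation S := (@sphere R n).
Local Notation sigma := (@surface_measure R n).
Local Notation mS := (@measurable_sphere R n).
Local Notation lat x := (dot x Phi).
Variables (p alpha : R) (f g : E -> R) (a b dh G : R -> R) (C : R).
Hypothesis p_gt1 : 1 < p.
Hypothesis alpha_gt0 : 0 < alpha.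
Hypothesis fg : lie_pair Phi f g.
Hypothesis f_Lp : (\int[sigma]_(x in S) (`|f x| `^ p)%:E < +oo)%E.
Hypotheses (ma : measurable_fun setT a) (mb : measurable_fun setT b).
Hypothesis mG : measurable_fun setT G.
Hypotheses (a_ge0 : forall c, 0 <= a c) (b_ge0 : forall c, 0 <= b c).
Hypothesis nda : forall c c', -1 <= c' -> c' <= c -> c <= 1 -> a c' <= a c.
Hypothesis ndb : forall c c', -1 <= c' -> c' <= c -> c <= 1 -> b c' <= b c.
Let h c := a c `^ (p - 1) * b c.
Hypothesis h0 : forall c, -1 <= c <= 0 -> h c = 0.
Hypothesis dhE : forall c : R, 0 < c <= 1 -> is_derive c 1 h (dh c).
Hypothesis GE : forall c, 0 < c <= 1 ->
  G c = n.-1%:R * c * h c - (1 - c ^+ 2) * dh c.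
Hypothesis G0 : forall c, -1 <= c <= 0 -> G c = 0.
Hypothesis GC : forall c, -1 <= c <= 1 -> `|G c| <= C.
Hypothesis hC : forall c, 0 <= c <= 1 -> 0 <= h c <= C * c.

Let mf : measurable_fun setT f. Proof. by have [[]] := fg. Qed.

Let mfp : measurable_fun setT (fun x => `|f x| `^ p).
Proof. by apply: (measurableT_comp (measurable_powR p)); exact: measurableT_comp. Qed.

Let ifp : sigma.-integrable S (fun x => (`|f x| `^ p)%:E).
Proof.
apply/integrableP; split; first exact/measurable_EFinP/measurable_funTS.
by under eq_integral do rewrite gee0_abs ?lee_fin ?powR_ge0//.
Qed.

Let mlat : measurable_fun setT (fun x : E => lat x).
Proof. exact: measurable_dot. Qed.

Let mh : measurable_fun setT h.
Proof.
by apply: measurable_funM => //; exact: (measurableT_comp (measurable_powR _) ma).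
Qed.

Let W t (x : E) := flow_weight n.-1 h t (lat x).

Let mW t : measurable_fun setT (W t).
Proof.
have mx : measurable_fun setT (fun _ : E => - t) by exact: measurable_cst.
have mid : measurable_fun setT (@id E) by exact: measurable_id.
apply: measurable_funM; last exact: (measurable_jac Phi mx mid).
exact: (measurableT_comp mh (measurable_flow_lat Phi mx mid)).
Qed.

Let latI (x : E) : S x -> -1 <= lat x <= 1.
Proof. by move=> Sx; rewrite -ler_norml normr_dot_sphere. Qed.

Let hbound c : -1 <= c <= 1 -> `|h c| <= C.
Proof.
move=> /andP[cl cr]; have [c0|c0] := leP c 0.
  rewrite h0 ?cl// normr0; apply: (le_trans (normr_ge0 (G 0))); apply: GC.
  by apply/andP; split; lra.
have /andP[h1 h2] : 0 <= h c <= C * c by apply: hC; rewrite ltW.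
rewrite ger0_norm//; apply: (le_trans h2).
rewrite ler_piMr//; apply: (le_trans (normr_ge0 (G 0))); apply: GC.
by apply/andP; split; lra.
Qed.

Let iWf t : 0 <= t <= 1 -> sigma.-integrable S (fun x => (`|f x| `^ p * W t x)%:E).
Proof.
move=> /andP[t0 t1].
apply: (@integrable_bounded _ _ (fun x => `|f x| `^ p) (W t) (C + C * expR (1 + n.-1%:R) * t)) => //.
move=> x Sx; rewrite /W.
have [->|tn0] := eqVneq t 0.
  by rewrite flow_weight0 mulr0 addr0 hbound// latI.
have tI : 0 < t <= 1 by rewrite lt_neqAle eq_sym tn0 t0.
have := flow_weight_lip h0 dhE GE GC hC tI (latI Sx).
rewrite flow_weight0 => l1; have l2 := hbound (latI Sx).
have := ler_normD (h (lat x)) (flow_weight n.-1 h t (lat x) - h (lat x)).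
rewrite addrC subrK => l3; apply: (le_trans l3); exact: lerD.
Qed.

Let intW t : (\int[sigma]_(x in S) (`|f x| `^ p * W t x)%:E =
  \int[sigma]_(x in S) (h (lat x) * `|f (flow Phi t x)| `^ p)%:E)%E.
Proof.
have mft : measurable_fun setT (fun x => f (flow Phi t x)).
  by apply: (measurableT_comp mf); exact: measurable_flow_fix.
rewrite -(@integral_flow _ _ _ n0 Phi1 (- t)
   (fun x => (h (lat x) * `|f (flow Phi t x)| `^ p)%:E)); last first.
  apply/measurable_EFinP/measurable_funM; first exact: (measurableT_comp mh mlat).
  by apply: (measurableT_comp (measurable_powR p)); exact: measurableT_comp.
apply: eq_integral => x xS; rewrite inE in xS.
rewrite flowNK// lat_flow// -EFinM; congr EFin.
by rewrite /W /flow_weight /jac; ring.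
Qed.

(** After the change of variables, time enters only through the weight, which is Lipschitz in time
    uniformly in the latitude. The difference quotients thus pass to the limit by dominated
    convergence, with |f|^p as the only dominating datum. *)
Lemma hemisphere :
  ((alpha `^ (p - 1))%:E * \int[sigma]_(x in S) (`|f x| `^ p * G (lat x))%:E <=
   ((p - 1) * alpha `^ p)%:E * \int[sigma]_(x in S) (a (lat x) `^ p * `|f x| `^ p)%:E +
     \int[sigma]_(x in S) (b (lat x) `^ p * `|g x| `^ p)%:E)%E.
Proof.
set K := (X in (_ <= X)%E).
have K0 : (0 <= K)%E.
  apply: adde_ge0; last by apply: integral_ge0 => x _; rewrite lee_fin mulr_ge0 ?powR_ge0.
  apply: mule_ge0; first by rewrite lee_fin mulr_ge0 ?powR_ge0// subr_ge0 ltW.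
  by apply: integral_ge0 => x _; rewrite lee_fin mulr_ge0 ?powR_ge0.
(* The power [p] of [|g|] need not be integrable here; a finite right-hand side is what the
   subtraction and division by time require. *)
have [->|Koo] := eqVneq K +oo%E; first by rewrite leey.
have fK : K \is a fin_num by rewrite ge0_fin_numE// ltey.
have mS' := mS.
have C0 : 0 <= C by apply: (le_trans (normr_ge0 (G 0))); apply: GC; apply/andP; split; lra.
pose F j x := (`|f x| `^ p * ((W (harmonic j) x - W 0 x) / harmonic j))%:E.
have hj0 j : 0 < @harmonic R j by rewrite invr_gt0.
have hj1 j : @harmonic R j <= 1 by rewrite invf_le1// ler1n.
have mF j : measurable_fun S (F j).
  apply/measurable_funTS/measurable_EFinP/measurable_funM => //.
  by apply: measurable_funM => //; exact: measurable_funB.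
have mGf : measurable_fun S (fun x => (`|f x| `^ p * G (lat x))%:E).
  apply/measurable_funTS/measurable_EFinP/measurable_funM => //.
  exact: (measurableT_comp mG mlat).
have FG : {ae sigma, forall x, S x -> F j x @[j --> \oo] --> (`|f x| `^ p * G (lat x))%:E}.
  apply: aeW => x Sx; apply: cvg_EFin; first exact: nearW.
  apply: cvgM; first exact: cvg_cst.
  exact: (cvg_flow_weight h0 dhE GE G0 (latI Sx)).
pose D := C * expR (1 + n.-1%:R).
have iD : sigma.-integrable S (fun x => (`|f x| `^ p * D)%:E).
  exact: (@integrable_bounded _ _ (fun x => `|f x| `^ p) (cst D) `|D|).
have FD : {ae sigma, forall x j, S x -> (`|F j x| <= (`|f x| `^ p * D)%:E)%E}.
  apply: aeW => x j Sx; rewrite lee_fin normrM ger0_norm ?powR_ge0//.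
  rewrite ler_wpM2l ?powR_ge0// normrM normfV (gtr0_norm (hj0 j)) ler_pdivrMr//.
  by apply: (flow_weight_lip h0 dhE GE GC hC); rewrite ?hj0 ?hj1 ?latI.
have [iG _ cvgF] := dominated_convergence mS' mF mGf FG iD FD.
have fG := integrable_fin_num mS' iG.
have step j : ((alpha `^ (p - 1))%:E * \int[sigma]_(x in S) F j x <=
    (expR (harmonic j * n.-1%:R))%:E * K)%E.
  have := hemisphere_upper n0 Phi1 p_gt1 alpha_gt0 fg ma mb a_ge0 b_ge0 nda ndb (hj0 j).
  rewrite -/K -/h -intW.
  have -> : (\int[sigma]_(x in S) (a (lat x) `^ (p - 1) * b (lat x) * `|f x| `^ p)%:E =
     \int[sigma]_(x in S) (`|f x| `^ p * W 0 x)%:E)%E.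
    by apply: eq_integral => x _; rewrite /W flow_weight0 mulrC.
  have I1 : sigma.-integrable S (fun x => (`|f x| `^ p * W (harmonic j) x)%:E).
    by apply: iWf; rewrite hj1 ltW.
  have I0 : sigma.-integrable S (fun x => (`|f x| `^ p * W 0 x)%:E).
    by apply: iWf; rewrite lexx ler01.
  have f1 := integrable_fin_num mS' I1.
  have f0 := integrable_fin_num mS' I0.
  have -> : (\int[sigma]_(x in S) F j x = (harmonic j)^-1%:E *
      (\int[sigma]_(x in S) (`|f x| `^ p * W (harmonic j) x)%:E -
       \int[sigma]_(x in S) (`|f x| `^ p * W 0 x)%:E))%E.
    rewrite -integralB// -integralZl//; last exact: integrableB.
    apply: eq_integral => x _; rewrite -EFinB -EFinM; congr EFin.
    by rewrite mulrA -mulrBr mulrC.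
  by move=> U; exact: (quotient_le f1 f0 fK (hj0 j) U).
apply: (limit_le cvgF _ fK step).
rewrite -[X in _ --> X](expR0 R); apply: continuous_cvg; first exact: continuous_expR.
rewrite -[X in _ --> X](mul0r n.-1%:R); apply: cvgM; last exact: cvg_cst.
exact: cvg_harmonic.
Qed.

End hemisphere.

(** * The weights *)

Section concrete_weights.
Context {R : realType} (m : nat) (p eps ea eb r : R).
Hypothesis p_gt1 : 1 < p.
Hypothesis eps_gt0 : 0 < eps.
Hypotheses (ea_ge0 : 0 <= ea) (eb_ge0 : 0 <= eb).
Hypothesis rE : r = ea * (p - 1) + eb.
Hypothesis r_ge1 : 1 <= r.
Implicit Types c : R.

Let p_gt0 : 0 < p. Proof. exact: lt_trans ltr01 p_gt1. Qed.

Definition sin2_eps c : R := 1 - c ^+ 2 + eps.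

(** The exponents of the two weights are parameters: [(ea, eb) = (0, 1)] leads to the inequality for
    the sine and [(1, 0)] to that for the tangent. *)
Definition weight (k c : R) : R :=
  if 0 < c then c `^ k * sin2_eps c `^ (- 2^-1) else 0.

Definition weight_dh c : R := r * c `^ (r - 1) * sin2_eps c `^ (- (p / 2)) +
  p * c `^ (r + 1) * sin2_eps c `^ (- (p / 2) - 1).

Definition weight_h c : R := weight ea c `^ (p - 1) * weight eb c.

Definition weight_G c : R :=
  if 0 < c then m%:R * c * weight_h c - (1 - c ^+ 2) * weight_dh c else 0.

Lemma sin2_eps_ge c : -1 <= c <= 1 -> eps <= sin2_eps c.
Proof.
by move=> /andP[c1 c2]; rewrite /sin2_eps; nra.
Qed.

Lemma sin2_eps_gt0 c : -1 <= c <= 1 -> 0 < sin2_eps c.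
Proof. by move=> /sin2_eps_ge; exact: lt_le_trans. Qed.

Lemma measurable_sin2_eps : measurable_fun setT sin2_eps.
Proof.
by apply: measurable_funD => //; apply: measurable_funB => //.
Qed.

Lemma measurable_weight k : measurable_fun setT (weight k).
Proof.
apply: measurable_fun_ifT => //; first exact: measurable_fun_ltr.
apply: measurable_funM; first exact: measurable_powR.
exact: (measurableT_comp (measurable_powR _) measurable_sin2_eps).
Qed.

Lemma weight_ge0 k c : 0 <= weight k c.
Proof. by rewrite /weight; case: ifPn => // _; rewrite mulr_ge0 ?powR_ge0. Qed.

Lemma powRN_le (x y s : R) : 0 <= s -> 0 < x -> x <= y -> y `^ (- s) <= x `^ (- s).
Proof.
move=> s0 x0 xy; have y0 : 0 < y by exact: lt_le_trans xy.
rewrite !powRN lef_pV2 ?posrE ?powR_gt0//.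
by apply: ge0_ler_powR; rewrite ?nnegrE ?(ltW x0) ?(ltW y0).
Qed.

Lemma powRD_gt0 (x s t : R) : 0 < x -> x `^ (s + t) = x `^ s * x `^ t.
Proof. by move=> x0; rewrite powRD// (gt_eqF x0) implybT. Qed.

Lemma weight_nd k c c' : 0 <= k -> -1 <= c' -> c' <= c -> c <= 1 -> weight k c' <= weight k c.
Proof.
move=> k0 c'1 cc c1; have [c'0|c'0] := ltP 0 c'; last first.
  by rewrite {1}/weight ltNge c'0/= weight_ge0.
have c0 : 0 < c by exact: lt_le_trans cc.
rewrite /weight c'0 c0; apply: ler_pM; rewrite ?powR_ge0//.
  by apply: ge0_ler_powR; rewrite ?nnegrE ?(ltW c0) ?(ltW c'0).
apply: powRN_le => //; first by apply: sin2_eps_gt0; apply/andP; split; lra.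
by rewrite /sin2_eps; nra.
Qed.

Lemma weight_powR k c s : 0 < c <= 1 -> weight k c `^ s =
  c `^ (k * s) * sin2_eps c `^ (- (s / 2)).
Proof.
move=> /andP[c0 c1]; rewrite /weight c0.
rewrite powRM ?powR_ge0// -!powRrM; congr (_ * _ `^ _).
by rewrite mulNr mulrC.
Qed.

Lemma weight_hE c : 0 < c <= 1 -> weight_h c = c `^ r * sin2_eps c `^ (- (p / 2)).
Proof.
move=> cI; have /andP[c0 c1] := cI.
have w0 : 0 < sin2_eps c by apply: sin2_eps_gt0; apply/andP; split; lra.
rewrite /weight_h weight_powR// /weight c0 mulrACA -!powRD_gt0//.
rewrite rE; congr (_ * _ `^ _); lra.
Qed.

Lemma weight_h0 c : c <= 0 -> weight_h c = 0.
Proof. by move=> c0; rewrite /weight_h {2}/weight ltNge c0 mulr0. Qed.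

Lemma is_derive_weight_h c : 0 < c <= 1 -> is_derive c 1 weight_h (weight_dh c).
Proof.
move=> cI; have /andP[c0 c1] := cI.
have w0 : 0 < sin2_eps c by apply: sin2_eps_gt0; apply/andP; split; lra.
(* Near a positive [c] the test in [weight] is constant, so [weight_h] is given by its closed
   form. *)
apply: (@near_eq_is_derive _ _ _ (fun c => c `^ r * sin2_eps c `^ (- (p / 2)))).
  near=> d.
  have d0 : 0 < d by near: d; exact: lt_nbhsr.
  have wd : 0 < sin2_eps d.
    near: d; apply: (cvgr_gt (sin2_eps c)) => //.
    apply: differentiable_continuous; apply/derivable1_diffP.
    have [] := derD (derB (der_cst c 1 (1 : R)) (derX 2 (is_derive_id c (1:R)))) (der_cst c 1 eps).
    by [].
  rewrite /weight_h /weight d0 powRM ?powR_ge0// -!powRrM mulrACA -!powRD_gt0//.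
  rewrite rE; congr (_ * _ `^ _); lra.
have dw : is_derive c 1 sin2_eps (- (2 * c)).
  apply: is_derive_eq (derD (derB (der_cst c 1 (1 : R)) (derX 2 (is_derive_id c (1:R)))) (der_cst c 1 eps)) _.
  by rewrite /= expr1 mulr1 addr0 sub0r.
apply: is_derive_eq (derM (is_derive1_powR r c0) (der_comp dw (is_derive1_powR (- (p / 2)) w0))) _.
rewrite /weight_dh; congr (_ + _).
rewrite [in RHS]powRD_gt0// powRr1 ?(ltW c0)//.
by field.
Unshelve. all: by end_near. Qed.

(** One constant for both [|G| <= C] and [h c <= C * c]: powers of [c] are bounded by 1, and
    [sin2_eps] is bounded below by [eps]. *)
Definition weight_bound : R :=
  (m%:R + r + 1) * eps `^ (- (p / 2)) + p * eps `^ (- (p / 2) - 1).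

Let powR_itv c s : 0 < c <= 1 -> 0 <= s -> 0 <= c `^ s <= 1.
Proof.
move=> /andP[c0 c1] s0; rewrite powR_ge0/=.
have := @ge0_ler_powR R s s0 c 1; rewrite !nnegrE powR1 ltW//; exact.
Qed.

Let w_le c s : 0 < c <= 1 -> 0 <= s -> 0 <= sin2_eps c `^ (- s) <= eps `^ (- s).
Proof.
move=> /andP[c0 c1] s0; rewrite powR_ge0/=; apply: powRN_le => //.
by apply: sin2_eps_ge; apply/andP; split; lra.
Qed.

Let ip2 : 0 <= p / 2. Proof. by rewrite divr_ge0// ltW. Qed.

(** First-order vanishing at the equator comes from [r_ge1], which gives c^r <= c. *)
Lemma weight_h_bound c : 0 <= c <= 1 -> 0 <= weight_h c <= weight_bound * c.
Proof.
move=> /andP[c0 c1]; rewrite /weight_h mulr_ge0 ?powR_ge0 ?weight_ge0//= -/(weight_h c).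
have B0 : 0 <= weight_bound.
  by rewrite addr_ge0// mulr_ge0 ?powR_ge0 ?(ltW p_gt0)// !addr_ge0// (le_trans ler01).
move: c0; rewrite le_eqVlt => /orP[/eqP <-|c0].
  by rewrite weight_h0// mulr0.
have cI : 0 < c <= 1 by rewrite c0.
rewrite weight_hE// mulrC; apply: ler_pM; rewrite ?powR_ge0//.
  have /andP[_ h] := w_le cI ip2; apply: (le_trans h).
  apply: ler_wpDr; first by rewrite mulr_ge0 ?powR_ge0// ltW.
  rewrite ler_peMl ?powR_ge0//.
  by rewrite lerDr addr_ge0 ?ler0n ?(le_trans ler01 r_ge1).
rewrite (_ : r = r - 1 + 1); last by rewrite subrK.
rewrite powRD_gt0//.
rewrite powRr1 ?(ltW c0)// ler_piMl ?(ltW c0)//.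
have r1 : 0 <= r - 1 by rewrite subr_ge0.
by have /andP[] := powR_itv cI r1.
Qed.

Lemma weight_G_bound c : -1 <= c <= 1 -> `|weight_G c| <= weight_bound.
Proof.
move=> /andP[cl cr]; rewrite /weight_G; case: ifPn => [c0|_]; last first.
  rewrite normr0 addr_ge0// mulr_ge0 ?powR_ge0 ?(ltW p_gt0)// !addr_ge0// (le_trans ler01)//.
have cI : 0 < c <= 1 by rewrite c0.
have r1 : 0 <= r - 1 by rewrite subr_ge0.
have r0 : 0 <= r by exact: le_trans r_ge1.
have rp : 0 <= r + 1 by exact: addr_ge0.
have ip3 : 0 <= p / 2 + 1 by exact: addr_ge0.
have /andP[x10 x11] := powR_itv cI r0; have /andP[x20 x21] := powR_itv cI r1.
have /andP[x30 x31] := powR_itv cI rp.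
have /andP[w10 w11] := w_le cI ip2; have := w_le cI ip3; rewrite opprD => /andP[w20 w21].
rewrite weight_hE// /weight_dh /weight_bound.
set X1 := c `^ r in x10 x11 *; set X2 := c `^ (r - 1) in x20 x21 *.
set X3 := c `^ (r + 1) in x30 x31 *.
set W1 := sin2_eps c `^ (- (p / 2)) in w10 w11 *.
set W2 := sin2_eps c `^ (- (p / 2) - 1) in w20 w21 *.
set V1 := eps `^ (- (p / 2)) in w11 *; set V2 := eps `^ (- (p / 2) - 1) in w21 *.
have s0 : 0 <= 1 - c ^+ 2 <= 1 by apply/andP; split; nra.
case/andP: s0 => s0 s1.
have m0 : 0 <= m%:R :> R by [].
have V10 : 0 <= V1 by exact: le_trans w11.
have V20 : 0 <= V2 by exact: le_trans w21.
have c01 : 0 <= c by exact: ltW.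
have le1 x y : 0 <= x -> 0 <= y -> x <= 1 -> y <= 1 -> x * y <= 1.
  by move=> ? ? ? ?; exact: mulr_ile1.
have A1 : m%:R * c * (X1 * W1) <= m%:R * V1.
  rewrite -mulrA ler_wpM2l// mulrA -[leRHS]mul1r ler_pM ?mulr_ge0// le1//.
have A2 : (1 - c ^+ 2) * (r * X2 * W1) <= r * V1.
  rewrite mulrC -!mulrA ler_wpM2l// mulrCA -[leRHS]mulr1 ler_pM ?mulr_ge0// le1//.
have A3 : (1 - c ^+ 2) * (p * X3 * W2) <= p * V2.
  rewrite mulrC -!mulrA ler_wpM2l ?(ltW p_gt0)// mulrCA -[leRHS]mulr1 ler_pM ?mulr_ge0// le1//.
have B1 : 0 <= m%:R * c * (X1 * W1) by rewrite !mulr_ge0.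
have B2 : 0 <= (1 - c ^+ 2) * (r * X2 * W1).
  by apply: mulr_ge0 => //; apply: mulr_ge0 => //; exact: mulr_ge0.
have B3 : 0 <= (1 - c ^+ 2) * (p * X3 * W2).
  by apply: mulr_ge0 => //; apply: mulr_ge0 => //; apply: mulr_ge0 => //; exact: ltW.
have mV : 0 <= m%:R * V1 by exact: mulr_ge0.
have rV : 0 <= r * V1 by exact: mulr_ge0.
have pV : 0 <= p * V2 by apply: mulr_ge0 => //; exact: ltW.
rewrite [(1 - c ^+ 2) * (_ + _)]mulrDr !mulrDl mul1r ler_norml; apply/andP; split; lra.
Qed.

(** In the term of [weight_dh] with factor [p], write 1 - c^2 as [sin2_eps c - eps]: the difference
    of the two sides is then p eps c^(r+1) times the power - p/2 - 1 of [sin2_eps c], which is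
    nonnegative. *)
Lemma weight_G_ge c : 0 < c <= 1 ->
  ((m%:R - p) * c `^ (r + 1) - r * (1 - c ^+ 2) * c `^ (r - 1)) *
    sin2_eps c `^ (- (p / 2)) <= weight_G c.
Proof.
move=> cI; have /andP[c0 c1] := cI.
have w0 : 0 < sin2_eps c by apply: sin2_eps_gt0; apply/andP; split; lra.
rewrite /weight_G c0 weight_hE// /weight_dh.
have -> : c `^ (r + 1) = c * c `^ r.
  by rewrite powRD_gt0// powRr1 ?(ltW c0)// mulrC.
have -> : sin2_eps c `^ (- (p / 2)) = sin2_eps c * sin2_eps c `^ (- (p / 2) - 1).
  rewrite -{2}(powRr1 (ltW w0)) -powRD_gt0//; congr (_ `^ _); ring.
set X := c `^ r; set Y := c `^ (r - 1); set W := sin2_eps c `^ _.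
have : 0 <= p * eps * (c * X * W).
  by rewrite !mulr_ge0 ?powR_ge0 ?(ltW p_gt0) ?(ltW eps_gt0) ?(ltW c0).
rewrite /sin2_eps; lra.
Qed.

Lemma measurable_weight_G : measurable_fun setT weight_G.
Proof.
have mw := measurable_sin2_eps.
apply: measurable_fun_ifT => //; first exact: measurable_fun_ltr.
have mh : measurable_fun setT weight_h.
  apply: measurable_funM; last exact: measurable_weight.
  exact: (measurableT_comp (measurable_powR _) (measurable_weight ea)).
have mk s : measurable_fun setT (fun c => sin2_eps c `^ s).
  exact: (measurableT_comp (measurable_powR _) mw).
apply: measurable_funB; first by do 2 apply: measurable_funM => //.
apply: measurable_funM; first by apply: measurable_funB => //; exact: measurable_funX.
apply: measurable_funD; apply: measurable_funM => //; apply: measurable_funM => //;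
  exact: measurable_powR.
Qed.

End concrete_weights.

(** * Limits of the weighted inequalities *)

Section integral_lemmas.
Context d (T : measurableType d) {R : realType} (mu : {measure set T -> \bar R}).
Variables (D : set T) (mD : measurable D).
Local Open Scope ereal_scope.

(** Integrates q A - K <= G and moves the multiple [c2] of the integral of [A] to the left, which is
    legitimate because that integral is finite; [B] may be infinite. *)
Lemma integral_absorb (A K G : T -> R) (B : \bar R) (q c1 c2 c3 : R) :
  mu.-integrable D (EFin \o A) -> mu.-integrable D (EFin \o K) ->
  mu.-integrable D (EFin \o G) ->
  (forall x, D x -> (q * A x - K x <= G x)%R) -> (0 <= c1)%R ->
  (c3 = c1 * q - c2)%R ->
  c1%:E * \int[mu]_(x in D) (G x)%:E <= c2%:E * \int[mu]_(x in D) (A x)%:E + B ->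
  c3%:E * \int[mu]_(x in D) (A x)%:E <= c1%:E * \int[mu]_(x in D) (K x)%:E + B.
Proof.
move=> iA iK iG GE c10 ->.
have : \int[mu]_(x in D) (q * A x - K x)%:E <= \int[mu]_(x in D) (G x)%:E.
  apply: le_integral => //; last by move=> x /[!inE] Dx; rewrite lee_fin GE.
  by apply: (integrableB mD (integrableZl mD q iA) iK).
have -> : \int[mu]_(x in D) (q * A x - K x)%:E =
    q%:E * \int[mu]_(x in D) (A x)%:E - \int[mu]_(x in D) (K x)%:E.
  rewrite -integralZl// -integralB//; exact: integrableZl.
have := integrable_fin_num mD iA; have := integrable_fin_num mD iK.
have := integrable_fin_num mD iG.
case: (\int[mu]_(x in D) (G x)%:E) => [g| |]// _.
case: (\int[mu]_(x in D) (K x)%:E) => [k| |]// _.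
case: (\int[mu]_(x in D) (A x)%:E) => [a| |]// _.
case: B => [b| |]; last 2 first.
- by move=> _ _; rewrite -!EFinM addey// leey.
- by move=> _; rewrite -!EFinM !addeNy leeNy_eq.
rewrite -!(EFinM, EFinB, EFinD) !lee_fin => h1 h2.
have : (c1 * (q * a - k) <= c1 * g)%R by apply: ler_wpM2l.
lra.
Qed.

Lemma integral_le_cvg (F : (T -> \bar R)^nat) f M :
  (forall j, measurable_fun D (F j)) -> (forall j x, D x -> 0 <= F j x) ->
  (forall x, D x -> F j x @[j --> \oo] --> f x) ->
  (forall j, \int[mu]_(x in D) F j x <= M) -> \int[mu]_(x in D) f x <= M.
Proof.
move=> mF F0 Ff FM.
have -> : \int[mu]_(x in D) f x = \int[mu]_(x in D) limn_einf (F ^~ x).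
  by apply: eq_integral => x /[!inE] Dx; have [-> _] := cvg_limn_einf_sup (Ff x Dx).
apply: (le_trans (fatou mu mD mF F0)); rewrite limn_einf_lim.
apply: lime_le; first exact: is_cvg_einfs.
by apply: nearW => j; apply: le_trans (FM j); rewrite /einfs/=; apply: ereal_inf_lbound; exists j => /=.
Qed.

(** The set is cut according to the sign of [c]. The part [c = 0], later the equator, is handled by
    a pointwise inequality instead of being shown negligible. *)
Lemma integral_le_split (F H : T -> R) (c : T -> R) : measurable_fun setT c ->
  measurable_fun setT F -> measurable_fun setT H ->
  (forall x, D x -> (0 <= F x)%R) -> (forall x, D x -> (0 <= H x)%R) ->
  (forall x, D x -> c x = 0%R -> (F x <= H x)%R) ->
  \int[mu]_(x in D) (if (0 < c x)%R then F x else 0%R)%:E <=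
    \int[mu]_(x in D) (if (0 < c x)%R then H x else 0%R)%:E ->
  \int[mu]_(x in D) (if (0 < - c x)%R then F x else 0%R)%:E <=
    \int[mu]_(x in D) (if (0 < - c x)%R then H x else 0%R)%:E ->
  \int[mu]_(x in D) (F x)%:E <= \int[mu]_(x in D) (H x)%:E.
Proof.
move=> mc mF mH F0 H0 FH pos neg.
have ml (G : T -> R) (b : T -> bool) : measurable_fun setT G -> measurable_fun setT b ->
    measurable_fun setT (fun x => (if b x then G x else 0%R)%:E).
  by move=> mG mb; apply/measurable_EFinP/measurable_fun_ifT.
have mp : measurable_fun setT (fun x => 0 < c x)%R by exact: measurable_fun_ltr.
have mn : measurable_fun setT (fun x => 0 < - c x)%R.
  by apply: measurable_fun_ltr => //; exact: measurableT_comp.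
have mz : measurable_fun setT (fun x => c x == 0%R).
  exact: measurable_fun_eqr.
have split (G : T -> R) : measurable_fun setT G -> (forall x, D x -> (0 <= G x)%R) ->
    \int[mu]_(x in D) (G x)%:E =
    \int[mu]_(x in D) (if (0 < c x)%R then G x else 0%R)%:E +
    \int[mu]_(x in D) (if (0 < - c x)%R then G x else 0%R)%:E +
    \int[mu]_(x in D) (if c x == 0%R then G x else 0%R)%:E.
  move=> mG G0.
  have g0 (b : T -> bool) x : D x -> 0 <= (if b x then G x else 0%R)%:E.
    by move=> Dx; rewrite lee_fin; case: ifP => // _; exact: G0.
  rewrite -ge0_integralD//; first last.
  - exact/measurable_funTS/ml.
  - exact: g0 (fun x => 0 < - c x)%R.
  - exact/measurable_funTS/ml.
  - exact: g0 (fun x => 0 < c x)%R.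
  rewrite -ge0_integralD//; first last.
  - exact/measurable_funTS/ml.
  - exact: g0 (fun x => c x == 0%R).
  - by apply: emeasurable_funD; exact/measurable_funTS/ml.
  - by move=> x Dx; apply: adde_ge0; [exact: g0 (fun x => 0 < c x)%R _ Dx|
      exact: g0 (fun x => 0 < - c x)%R _ Dx].
  apply: eq_integral => x _; rewrite -!EFinD; congr EFin.
  by rewrite oppr_gt0; case: ltgtP => _; rewrite ?addr0 ?add0r.
rewrite (split F)// (split H)// leeD//; first exact: leeD.
apply: ge0_le_integral => //.
- by move=> x Dx; rewrite lee_fin; case: ifP => // _; exact: F0.
- exact/measurable_funTS/ml.
- exact/measurable_funTS/ml.
- by move=> x Dx; rewrite lee_fin; case: ifP => // /eqP; exact: FH.
Qed.

End integral_lemmas.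

Lemma measurable_sin_lat {R : realType} n (Phi : 'rV[R]_n) :
  measurable_fun setT (fun x => Num.sqrt (1 - dot x Phi ^+ 2)).
Proof.
rewrite (_ : (fun x => _) = (fun x => Num.max 0 (1 - dot x Phi ^+ 2) `^ 2^-1)).
  apply: (measurableT_comp (measurable_powR _)); apply: measurable_maxr => //.
  by apply: measurable_funB => //; apply: measurable_funX; exact: measurable_dot.
apply/funext => x; have [h|h] := leP 0 (1 - dot x Phi ^+ 2); first by rewrite powR12_sqrt.
by rewrite ltr0_sqrtr// powR0.
Qed.

Lemma powRV {R : realType} (x p : R) : 0 <= x -> x^-1 `^ p = (x `^ p)^-1.
Proof. by move=> x0; rewrite -(powR_inv1 x0) -powRrM mulN1r powRN. Qed.

Definition sin_powN {R : realType} (p eps c : R) : R := sin2_eps eps c `^ (- (p / 2)).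

Section weighted_inequality.
Context {R : realType} (n : nat).
Hypothesis n0 : (0 < n)%N.
Local Notation E := 'rV[R]_n.
Local Notation S := (@sphere R n).
Local Notation sigma := (@surface_measure R n).
Local Notation mS := (@measurable_sphere R n).
Variables (p alpha : R) (f N : E -> R).
Hypothesis p_gt1 : 1 < p.
Hypothesis alpha_gt0 : 0 < alpha.
Hypothesis alphaE : p * alpha = n.-1%:R - p.
Hypothesis f_Lp : (\int[sigma]_(x in S) (`|f x| `^ p)%:E < +oo)%E.
Hypothesis mf : measurable_fun setT f.
Hypotheses (mN : measurable_fun setT N) (N0 : forall x, 0 <= N x).

Let p_gt0 : 0 < p. Proof. exact: lt_trans ltr01 p_gt1. Qed.

Let mfp : measurable_fun setT (fun x => `|f x| `^ p).
Proof. by apply: (measurableT_comp (measurable_powR p)); exact: measurableT_comp. Qed.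

Let ifp : sigma.-integrable S (EFin \o (fun x => `|f x| `^ p)).
Proof.
apply/integrableP; split; first exact/measurable_EFinP/measurable_funTS.
by under eq_integral do rewrite gee0_abs ?lee_fin ?powR_ge0//.
Qed.

(** The length sin d of X compensates the singular weight, as sin^2 d <= sin^2 d + eps. *)
Lemma sin_powN_le eps c (N1 : R) : 0 < eps -> -1 <= c <= 1 -> 0 <= N1 ->
  sin_powN p eps c * (Num.sqrt (1 - c ^+ 2) * N1) `^ p <= N1 `^ p.
Proof.
move=> e0 cI N10; have w0 := sin2_eps_gt0 e0 cI.
have s0 : 0 <= 1 - c ^+ 2 by case/andP: cI => *; nra.
rewrite powRM ?sqrtr_ge0// mulrA ler_piMl ?powR_ge0//.
rewrite -powR12_sqrt// -powRrM /sin_powN powRN mulrC ler_pdivrMr ?powR_gt0//.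
rewrite mul1r (_ : 2^-1 * p = p / 2); last by rewrite mulrC.
have ip2 : 0 <= p / 2 by rewrite divr_ge0// ltW.
apply: (ge0_ler_powR ip2); rewrite ?nnegrE ?(ltW w0)//.
by rewrite /sin2_eps lerDl ltW.
Qed.

Section pole.
Variables (Phi : E) (g : E -> R).
Hypothesis Phi1 : dot Phi Phi = 1.
Hypothesis fg : lie_pair Phi f g.
Local Notation lat x := (dot x Phi).
Hypothesis gN : forall x, S x -> `|g x| <= Num.sqrt (1 - lat x ^+ 2) * N x.
Variables (eps ea eb r : R) (K : R -> R) (D : R).
Hypothesis eps_gt0 : 0 < eps.
Hypotheses (ea_ge0 : 0 <= ea) (eb_ge0 : 0 <= eb).
Hypothesis rE : r = ea * (p - 1) + eb.
Hypothesis r_ge1 : 1 <= r.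
Hypothesis mK : measurable_fun setT K.
Hypothesis K_itv : forall c, 0 < c <= 1 -> 0 <= K c <= D.
Hypothesis K_le : forall c, 0 < c <= 1 -> p * alpha * (c `^ (ea * p) * sin_powN p eps c) - K c <=
  (p * alpha * c `^ (r + 1) - r * (1 - c ^+ 2) * c `^ (r - 1)) * sin_powN p eps c.

Let latI (x : E) : S x -> -1 <= lat x <= 1.
Proof. by move=> Sx; rewrite -ler_norml normr_dot_sphere. Qed.

Let mlat : measurable_fun setT (fun x : E => lat x).
Proof. exact: measurable_dot. Qed.

(** By [K_le], the lower bound of [weight_G] is split into a multiple of the weight on the left,
    which absorbs the Young term, and the less singular remainder [K]. *)
Lemma hemisphere_weight :
  (\int[sigma]_(x in S) (if 0 < lat x then
     alpha `^ p * (lat x `^ (ea * p) * sin_powN p eps (lat x) * `|f x| `^ p) else 0)%:E <=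
   \int[sigma]_(x in S) (if 0 < lat x then
     alpha `^ (p - 1) * (K (lat x) * `|f x| `^ p) + lat x `^ (eb * p) * N x `^ p else 0)%:E)%E.
Proof.
have p1 : 0 <= p - 1 by rewrite subr_ge0 ltW.
have weight0 k c : c <= 0 -> weight eps k c = 0 by move=> c0; rewrite /weight ltNge c0.
pose G := weight_G n.-1 p eps ea eb r.
pose K' c := if 0 < c then K c else 0.
have mK' : measurable_fun setT K'.
  by apply: measurable_fun_ifT => //; exact: measurable_fun_ltr.
have H : ((alpha `^ (p - 1))%:E * \int[sigma]_(x in S) (`|f x| `^ p * G (lat x))%:E <=
   ((p - 1) * alpha `^ p)%:E * \int[sigma]_(x in S) (weight eps ea (lat x) `^ p * `|f x| `^ p)%:E +
     \int[sigma]_(x in S) (weight eps eb (lat x) `^ p * `|g x| `^ p)%:E)%E.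
  apply: (@hemisphere _ _ _ n0 Phi1 p alpha f g (weight eps ea) (weight eps eb)
    (weight_dh p eps r) G (weight_bound n.-1 p eps r)) => //.
  - exact: measurable_weight.
  - exact: measurable_weight.
  - exact: measurable_weight_G.
  - exact: weight_ge0.
  - exact: weight_ge0.
  - by move=> c c'; exact: weight_nd.
  - by move=> c c'; exact: weight_nd.
  - by move=> c /andP[_ c0]; exact: weight_h0.
  - by move=> c; exact: is_derive_weight_h.
  - by move=> c /andP[c0 _]; rewrite /G /weight_G c0.
  - by move=> c /andP[_ c0]; rewrite /G /weight_G ltNge c0.
  - by move=> c; exact: weight_G_bound.
  - by move=> c; exact: weight_h_bound.
have wE k c : 0 < c <= 1 -> weight eps k c `^ p = c `^ (k * p) * sin_powN p eps c.
  by move=> cI; exact: weight_powR.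
have D0 : 0 <= D.
  have : 0 <= K 1 <= D by apply: K_itv; rewrite ltr01 lexx.
  by case/andP; exact: le_trans.
have iK : sigma.-integrable S (EFin \o (fun x => `|f x| `^ p * K' (lat x))).
  apply: (@integrable_bounded _ _ (fun x => `|f x| `^ p) (fun x => K' (lat x)) D) => //.
    exact: (measurableT_comp mK' mlat).
  move=> x /latI /andP[_ c1]; rewrite /K'; case: ifPn => c0; last by rewrite normr0.
  have I1 : 0 < lat x <= 1 by rewrite c0. by case/andP: (K_itv I1) => h1 h2; rewrite ger0_norm.
have iG : sigma.-integrable S (EFin \o (fun x => `|f x| `^ p * G (lat x))).
  apply: (@integrable_bounded _ _ (fun x => `|f x| `^ p) (fun x => G (lat x)) (weight_bound n.-1 p eps r)) => //.
    exact: (measurableT_comp (measurable_weight_G _ _ _ _ _ _) mlat).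
  by move=> x Sx; apply: weight_G_bound => //; exact: latI.
have iA : sigma.-integrable S (EFin \o (fun x => weight eps ea (lat x) `^ p * `|f x| `^ p)).
  rewrite (_ : _ \o _ = (fun x => (`|f x| `^ p * weight eps ea (lat x) `^ p)%:E)); last first.
    by apply/funext => x /=; rewrite mulrC.
  apply: (@integrable_bounded _ _ (fun x => `|f x| `^ p) (fun x => weight eps ea (lat x) `^ p) (weight eps ea 1 `^ p)) => //.
    apply: (measurableT_comp (measurable_powR p)).
    exact: (measurableT_comp (measurable_weight _ _) mlat).
  move=> x /latI /andP[c1 c2]; rewrite ger0_norm; last exact: powR_ge0.
  by apply: (ge0_ler_powR (ltW p_gt0)); [exact: weight_ge0|exact: weight_ge0|exact: weight_nd].
have GE x : S x -> p * alpha * (weight eps ea (lat x) `^ p * `|f x| `^ p) -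
    `|f x| `^ p * K' (lat x) <= `|f x| `^ p * G (lat x).
  move=> /latI /andP[_ c1].
  rewrite [X in _ <= X]mulrC mulrA [X in _ - X]mulrC -mulrBl ler_wpM2r ?powR_ge0//.
  rewrite /K' /G; case: ifPn => c0; last first.
    by rewrite /weight /weight_G (negPf c0) powR0 ?gt_eqF// mulr0 subr0.
  have cI : 0 < lat x <= 1 by rewrite c0.
  by rewrite wE// (le_trans (K_le cI))// alphaE weight_G_ge.
have alp : alpha `^ p = alpha `^ (p - 1) * alpha.
  by rewrite -{1}(subrK 1 p) (powRD_gt0 (p - 1) 1 alpha_gt0) (powRr1 (ltW alpha_gt0)).
(* By [alphaE], [p * alpha] is the coefficient [n.-1 - p] of [weight_G_ge]. Subtracting the Young
   term leaves exactly alpha^p, the constant of the theorem. *)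
have cE : alpha `^ p = alpha `^ (p - 1) * (p * alpha) - (p - 1) * alpha `^ p.
  by rewrite alp; ring.
have := integral_absorb mS iA iK iG GE (powR_ge0 _ _) cE H.
rewrite -(integralZl mS iA) -(integralZl mS iK) => {H}H.
have K'0 x : S x -> 0 <= K' (lat x).
  move=> /latI /andP[_ c1]; rewrite /K'; case: ifPn => // c0.
  have : 0 <= K (lat x) <= D by apply: K_itv; rewrite c0.
  by case/andP.
have mK1 : measurable_fun setT (fun x => alpha `^ (p - 1) * (`|f x| `^ p * K' (lat x))).
  by apply: measurable_funM => //; apply: measurable_funM => //; exact: (measurableT_comp mK' mlat).
have mw k : measurable_fun setT (fun x => weight eps k (lat x) `^ p).
  apply: (measurableT_comp (measurable_powR p)).
  exact: (measurableT_comp (measurable_weight _ _) mlat).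
have mgp : measurable_fun setT (fun x => `|g x| `^ p).
  by apply: (measurableT_comp (measurable_powR p)); have [[_ mg] _ _ _] := fg; exact: measurableT_comp.
have mg1 : measurable_fun setT (fun x => weight eps eb (lat x) `^ p * `|g x| `^ p).
  by apply: measurable_funM.
have w0p k c : ~~ (0 < c) -> weight eps k c `^ p = 0.
  by move=> /negPf c0; rewrite /weight c0 powR0// gt_eqF.
move: H; rewrite -ge0_integralD; first last.
- exact/measurable_funTS/measurable_EFinP.
- by move=> x _; rewrite lee_fin mulr_ge0// powR_ge0.
- exact/measurable_funTS/measurable_EFinP.
- by move=> x Sx; rewrite lee_fin; apply: mulr_ge0; [|apply: mulr_ge0; [|exact: K'0]]; exact: powR_ge0.
- exact: mS.
move=> H.
rewrite (_ : \int[sigma]_(x in S) _ = \int[sigma]_(x in S)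
    ((alpha `^ p)%:E * (weight eps ea (lat x) `^ p * `|f x| `^ p)%:E))%E; last first.
  apply: eq_integral => x /[!inE] /latI /andP[_ c1]; rewrite /= -EFinM; congr EFin.
  by case: ifPn => c0; [rewrite wE// c0|rewrite w0p// mul0r mulr0].
apply: (le_trans H); apply: ge0_le_integral.
- exact: mS.
- move=> x Sx; rewrite -EFinM -EFinD lee_fin; apply: addr_ge0; last by rewrite mulr_ge0 ?powR_ge0.
  by apply: mulr_ge0; [|apply: mulr_ge0; [|exact: K'0]]; exact: powR_ge0.
- by apply/measurable_funTS/emeasurable_funD; exact/measurable_EFinP.
- apply/measurable_funTS/measurable_EFinP/measurable_fun_ifT => //.
    exact: measurable_fun_ltr.
  apply: measurable_funD.
    by apply: measurable_funM => //; apply: measurable_funM => //; exact: (measurableT_comp mK mlat).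
  apply: measurable_funM; first exact: (measurableT_comp (measurable_powR _) mlat).
  exact: (measurableT_comp (measurable_powR _) mN).
move=> x Sx; have cI := latI Sx; have /andP[_ c1] := cI.
rewrite /= -EFinM -EFinD lee_fin /K'; case: ifPn => c0; last by rewrite w0p// mul0r !mulr0 addr0.
rewrite [X in _ * X + _]mulrC lerD2l wE ?c0// -mulrA ler_wpM2l ?powR_ge0//.
apply: le_trans (sin_powN_le eps_gt0 cI (N0 x)).
rewrite ler_wpM2l ?powR_ge0//; apply: (ge0_ler_powR (ltW p_gt0)); last exact: gN.
  by rewrite nnegrE.
by rewrite nnegrE mulr_ge0 ?sqrtr_ge0.
Qed.

End pole.

Section poles.
Variables (Phi : E) (g g' : E -> R).
Hypothesis Phi1 : dot Phi Phi = 1.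
Local Notation lat x := (dot x Phi).
Hypotheses (fg : lie_pair Phi f g) (fg' : lie_pair (- Phi) f g').
Hypothesis gN : forall x, S x -> `|g x| <= Num.sqrt (1 - lat x ^+ 2) * N x.
Hypothesis g'N : forall x, S x -> `|g' x| <= Num.sqrt (1 - lat x ^+ 2) * N x.

Section two_hemispheres.
Variables (eps ea eb r : R) (K : R -> R) (D : R).
Hypothesis eps_gt0 : 0 < eps.
Hypotheses (ea_ge0 : 0 <= ea) (eb_ge0 : 0 <= eb).
Hypothesis rE : r = ea * (p - 1) + eb.
Hypothesis r_ge1 : 1 <= r.
Hypothesis mK : measurable_fun setT K.
Hypothesis K_itv : forall c, 0 <= c <= 1 -> 0 <= K c <= D.
Hypothesis K_le : forall c, 0 < c <= 1 -> p * alpha * (c `^ (ea * p) * sin_powN p eps c) - K c <=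
  (p * alpha * c `^ (r + 1) - r * (1 - c ^+ 2) * c `^ (r - 1)) * sin_powN p eps c.
Hypothesis K0 : alpha `^ p * (0 `^ (ea * p) * sin_powN p eps 0) <= alpha `^ (p - 1) * K 0.

(** Replacing [Phi] by its opposite exchanges the hemispheres and changes the sign of the latitude,
    which enters only through its absolute value and its square. On the equator the inequality holds
    pointwise by [K0]. *)
Lemma two_hemispheres :
  (\int[sigma]_(x in S)
     (alpha `^ p * (`|lat x| `^ (ea * p) * sin_powN p eps (lat x) * `|f x| `^ p))%:E <=
   \int[sigma]_(x in S)
     (alpha `^ (p - 1) * (K `|lat x| * `|f x| `^ p) + `|lat x| `^ (eb * p) * N x `^ p)%:E)%E.
Proof.
have mlat : measurable_fun setT (fun x : E => lat x) by exact: measurable_dot.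
have malat : measurable_fun setT (fun x : E => `|lat x|) by exact: measurableT_comp.
have mW : measurable_fun setT (fun x : E => sin_powN p eps (lat x)).
  apply: (measurableT_comp (measurable_powR _)).
  exact: (measurableT_comp (measurable_sin2_eps _) mlat).
have Kc x : S x -> 0 <= K `|lat x|.
  move=> Sx; have : 0 <= K `|lat x| <= D by apply: K_itv; rewrite normr_ge0 normr_dot_sphere.
  by case/andP.
have K_itv' c : 0 < c <= 1 -> 0 <= K c <= D.
  by move=> /andP[c0 c1]; apply: K_itv; rewrite ltW.
apply: (@integral_le_split _ _ _ sigma S mS _ _ (fun x => lat x)).
- exact: mlat.
- apply: measurable_funM; first exact: measurable_cst.
  apply: measurable_funM; last exact: mfp.
  apply: measurable_funM; last exact: mW.
  exact: (measurableT_comp (measurable_powR _) malat).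
- apply: measurable_funD; apply: measurable_funM.
  + exact: measurable_cst.
  + by apply: measurable_funM; [exact: (measurableT_comp mK malat)|exact: mfp].
  + exact: (measurableT_comp (measurable_powR _) malat).
  + exact: (measurableT_comp (measurable_powR _) mN).
- by move=> x _; rewrite !mulr_ge0 ?powR_ge0.
- move=> x Sx; apply: addr_ge0; last by rewrite mulr_ge0 ?powR_ge0.
  by rewrite !mulr_ge0 ?powR_ge0 ?Kc.
- move=> x Sx ->; rewrite normr0.
  apply: ler_wpDr; first by rewrite mulr_ge0 ?powR_ge0.
  by rewrite !mulrA ler_wpM2r ?powR_ge0// -mulrA.
- have H := hemisphere_weight Phi1 fg gN
    eps_gt0 ea_ge0 eb_ge0 rE r_ge1 mK K_itv' K_le.
  set L := (X in (X <= _)%E); set U := (X in (_ <= X)%E).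
  set L' := (X in (X <= _)%E) in H; set U' := (X in (_ <= X)%E) in H.
  suff [-> ->] : L = L' /\ U = U' by exact: H.
  by split; apply: eq_integral => x _; case: ifPn => // c0; rewrite gtr0_norm.
have Phi1' : dot (- Phi) (- Phi) = 1 by rewrite dotNl dotNr opprK.
have g'N' x : S x -> `|g' x| <= Num.sqrt (1 - dot x (- Phi) ^+ 2) * N x.
  by rewrite dotNr sqrrN; exact: g'N.
have H := hemisphere_weight Phi1' fg' g'N'
    eps_gt0 ea_ge0 eb_ge0 rE r_ge1 mK K_itv' K_le.
set L := (X in (X <= _)%E); set U := (X in (_ <= X)%E).
set L' := (X in (X <= _)%E) in H; set U' := (X in (_ <= X)%E) in H.
suff [-> ->] : L = L' /\ U = U' by exact: H.
split; apply: eq_integral => x _; rewrite dotNr; case: ifPn => // c0.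
  by rewrite -(normrN (lat x)) gtr0_norm// /sin_powN /sin2_eps sqrrN.
by rewrite -(normrN (lat x)) gtr0_norm.
Qed.

End two_hemispheres.

Local Notation s x := (Num.sqrt (1 - lat x ^+ 2)).

Let p2_ge0 : 0 <= p / 2. Proof. by rewrite divr_ge0// ltW. Qed.

Let latI (x : E) : S x -> -1 <= lat x <= 1.
Proof. by move=> Sx; rewrite -ler_norml normr_dot_sphere. Qed.

Let mlat : measurable_fun setT (fun x : E => lat x).
Proof. exact: measurable_dot. Qed.

Let malat : measurable_fun setT (fun x : E => `|lat x|).
Proof. exact: measurableT_comp. Qed.

Let mNp : measurable_fun setT (fun x => N x `^ p).
Proof. exact: (measurableT_comp (measurable_powR p)). Qed.

Let ms : measurable_fun setT (fun x => s x).
Proof. exact: measurable_sin_lat. Qed.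

Let mpow k : measurable_fun setT (fun x => `|lat x| `^ k).
Proof. exact: (measurableT_comp (measurable_powR _) malat). Qed.

Let mW eps : measurable_fun setT (fun x => sin_powN p eps (lat x)).
Proof.
apply: (measurableT_comp (measurable_powR _)).
exact: (measurableT_comp (measurable_sin2_eps _) mlat).
Qed.

Let sin2 (c : R) : -1 <= c <= 1 -> 0 <= 1 - c ^+ 2 <= 1.
Proof. by move=> /andP[? ?]; apply/andP; split; nra. Qed.

Lemma sin_powN_le_sin (eps c : R) : 0 < eps -> -1 <= c <= 1 ->
  (1 - c ^+ 2) * sin_powN p eps c <= (Num.sqrt (1 - c ^+ 2) `^ (p - 2))^-1.
Proof.
move=> e0 cI; have /andP[s0 _] := sin2 cI.
move: s0; rewrite le_eqVlt => /orP[/eqP <-|s0]; first by rewrite mul0r invr_ge0 powR_ge0.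
have sq0 : 0 < Num.sqrt (1 - c ^+ 2) by rewrite sqrtr_gt0.
have h : sin_powN p eps c <= (1 - c ^+ 2) `^ (- (p / 2)).
  by apply: powRN_le => //; rewrite /sin2_eps lerDl ltW.
apply: (le_trans (ler_wpM2l (ltW s0) h)).
rewrite -powRN -powR12_sqrt ?(ltW s0)// -powRrM -{1}(powRr1 (ltW s0)) -powRD_gt0//.
by rewrite le_eqVlt; apply/orP; left; apply/eqP; congr (_ `^ _); lra.
Qed.

(** Either sin^2 d + eps is at most the threshold [d], or the weight is at most its value there. The
    second term is independent of [eps], and for a small threshold the first one can be absorbed. *)
Lemma sin_powN_split (eps c d : R) : 0 < eps -> 0 < d -> -1 <= c <= 1 ->
  (1 - c ^+ 2) * sin_powN p eps c <= d * sin_powN p eps c + d `^ (- (p / 2)).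
Proof.
move=> e0 d0 cI; have /andP[s0 s1] := sin2 cI.
have W0 : 0 <= sin_powN p eps c by exact: powR_ge0.
have [h|h] := leP (sin2_eps eps c) d.
  apply: ler_wpDr; first exact: powR_ge0.
  by rewrite ler_wpM2r// (le_trans _ h)// /sin2_eps lerDl ltW.
apply: ler_wpDl; first by rewrite mulr_ge0// ltW.
apply: (@le_trans _ _ (sin_powN p eps c)); first by rewrite ler_piMl.
exact: powRN_le (ltW h).
Qed.

Lemma integral_sin_limit (k q : R) M :
  (forall eps, 0 < eps -> (\int[sigma]_(x in S)
     (k * (`|lat x| `^ q * sin_powN p eps (lat x) * `|f x| `^ p))%:E <= M)%E) -> 0 <= k ->
  (\int[sigma]_(x in S) (k * (`|lat x| `^ q * (s x `^ p)^-1 * `|f x| `^ p))%:E <= M)%E.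
Proof.
move=> H k0.
(* At the poles the target is the default value [0^-1 = 0], while [sin_powN] blows up; the
   approximation is set to 0 there. *)
pose W j (x : E) := if s x == 0 then 0 else sin_powN p (harmonic j) (lat x).
have W0 j x : 0 <= W j x by rewrite /W; case: ifP => // _; exact: powR_ge0.
have mWj j : measurable_fun setT (W j).
  apply: measurable_fun_ifT; [exact: measurable_fun_eqr|exact: measurable_cst|exact: mW].
have hj0 j : 0 < @harmonic R j by rewrite invr_gt0.
pose F j x := (k * (`|lat x| `^ q * W j x * `|f x| `^ p))%:E.
have mF j : measurable_fun setT (F j).
  apply/measurable_EFinP/measurable_funM; first exact: measurable_cst.
  by apply: measurable_funM => //; exact: measurable_funM.
have mF1 eps : measurable_fun setT (fun x => (k * (`|lat x| `^ q * sin_powN p eps (lat x) * `|f x| `^ p))%:E).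
  apply/measurable_EFinP/measurable_funM; first exact: measurable_cst.
  by apply: measurable_funM => //; exact: measurable_funM.
have F0 j x : (0 <= F j x)%E by rewrite lee_fin !mulr_ge0 ?powR_ge0.
apply: (@integral_le_cvg _ _ _ sigma S mS F).
- by move=> j; exact: measurable_funTS.
- by [].
- move=> x /latI /sin2 /andP[s0 _]; apply: cvg_EFin; first exact: nearW.
  apply: cvgM; first exact: cvg_cst.
  apply: cvgM; last exact: cvg_cst.
  apply: cvgM; first exact: cvg_cst.
  rewrite /W; case: eqP => [->|/eqP sn0].
    by rewrite powR0 ?gt_eqF// invr0; exact: cvg_cst.
  have c0 : 0 < 1 - lat x ^+ 2.
    by rewrite lt_neqAle s0 andbT eq_sym; apply: contra sn0 => /eqP ->; rewrite sqrtr0.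
  rewrite (_ : (s x `^ p)^-1 = (1 - lat x ^+ 2) `^ (- (p / 2))); last first.
    by rewrite -powRN -powR12_sqrt// -powRrM; congr (_ `^ _); lra.
  apply: (@continuous_cvg _ _ _ _ _ (fun j => sin2_eps (harmonic j) (lat x)) (fun y => y `^ (- (p / 2)))).
    have [h _] := is_derive1_powR (- (p / 2)) c0.
    by apply: differentiable_continuous; apply/derivable1_diffP.
  rewrite -[X in _ --> X]addr0; apply: cvgD; first exact: cvg_cst.
  exact: cvg_harmonic.
move=> j; apply: le_trans (H _ (hj0 j)); apply: ge0_le_integral.
- exact: mS.
- by move=> x _; exact: F0.
- exact: measurable_funTS.
- exact: measurable_funTS.
move=> x Sx; rewrite lee_fin ler_wpM2l// ler_wpM2r ?powR_ge0// ler_wpM2l ?powR_ge0//.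
by rewrite /W; case: ifP => // _; exact: powR_ge0.
Qed.

Let sin_powN_bound (eps c : R) : 0 < eps -> -1 <= c <= 1 -> 0 <= sin_powN p eps c <= eps `^ (- (p / 2)).
Proof.
move=> e0 cI; rewrite powR_ge0/=; apply: powRN_le => //; exact: sin2_eps_ge.
Qed.

Let alp : alpha `^ p = alpha `^ (p - 1) * alpha.
Proof. by rewrite -{1}(subrK 1 p) (powRD_gt0 (p - 1) 1 alpha_gt0) (powRr1 (ltW alpha_gt0)). Qed.

Let itv01 (c : R) : 0 <= c <= 1 -> -1 <= c <= 1.
Proof. by move=> /andP[? ?]; apply/andP; split; lra. Qed.

Let palpha_gt0 : 0 < p * alpha. Proof. exact: mulr_gt0. Qed.

Let sin2_mul_bound (eps c : R) : 0 < eps -> 0 <= c <= 1 ->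
  0 <= (1 - c ^+ 2) * sin_powN p eps c <= eps `^ (- (p / 2)).
Proof.
move=> e0 /itv01 cI; have /andP[s0 s1] := sin2 cI; have /andP[w0 w1] := sin_powN_bound e0 cI.
by rewrite mulr_ge0//= (le_trans _ w1)// ler_piMl.
Qed.

Let msin2W eps : measurable_fun setT (fun c : R => (1 - c ^+ 2) * sin_powN p eps c).
Proof.
apply: measurable_funM; first by apply: measurable_funB => //; exact: measurable_funX.
exact: (measurableT_comp (measurable_powR _) (measurable_sin2_eps _)).
Qed.

Let latE (x : E) : 1 - `|lat x| ^+ 2 = 1 - lat x ^+ 2.
Proof. by rewrite real_normK// num_real. Qed.

Let sin_powN_abs eps (x : E) : sin_powN p eps `|lat x| = sin_powN p eps (lat x).
Proof. by rewrite /sin_powN /sin2_eps real_normK// num_real. Qed.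

Lemma hardy_sin_eps eps : 0 < eps ->
  (\int[sigma]_(x in S) (alpha `^ p * (sin_powN p eps (lat x) * `|f x| `^ p))%:E <=
   \int[sigma]_(x in S) (alpha `^ (p - 1) * ((p * alpha + 1) *
      ((1 - lat x ^+ 2) * sin_powN p eps (lat x)) * `|f x| `^ p) + `|lat x| `^ p * N x `^ p)%:E)%E.
Proof.
move=> e0.
(* For the exponents [(0, 1)] one has r = 1, and this [K] makes [K_le] an equality: p alpha - p
   alpha c^2 + 1 - c^2 = (p alpha + 1) (1 - c^2). The factor is the n - p of the theorem. *)
pose K c := (p * alpha + 1) * ((1 - c ^+ 2) * sin_powN p eps c).
have pa1 : 0 <= p * alpha + 1 by rewrite addr_ge0// ltW.
have H := @two_hemispheres eps 0 1 1 K ((p * alpha + 1) * eps `^ (- (p / 2))) e0 (lexx _) ler01.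
have {}H := H (ltac:(by rewrite mul0r add0r)) (lexx _).
have mK : measurable_fun setT K by apply: measurable_funM => //; exact: msin2W.
have K1 c : 0 <= c <= 1 -> 0 <= K c <= (p * alpha + 1) * eps `^ (- (p / 2)).
  move=> cI; have /andP[h1 h2] := sin2_mul_bound e0 cI.
  by rewrite mulr_ge0//= ler_wpM2l.
have {}H := H mK K1.
set L := (X in (X <= _)%E); set U := (X in (_ <= X)%E).
set L' := (X in (X <= _)%E) in H; set U' := (X in (_ <= X)%E) in H.
suff [-> ->] : L = L' /\ U = U'; last first.
  split; apply: eq_integral => x _; first by rewrite mul0r powRr0 mul1r.
  by rewrite /K latE sin_powN_abs mul1r.
apply: H.
  move=> c /andP[c0 c1]; rewrite /K !mul0r powRr0 subrr powRr0.
  rewrite powRD_gt0// powRr1 ?(ltW c0)//.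
  by rewrite le_eqVlt; apply/orP; left; apply/eqP; ring.
rewrite /K mul0r powRr0 expr0n/= subr0 !mul1r alp -mulrA ler_wpM2l ?powR_ge0// ler_wpM2r ?powR_ge0//.
have : 0 <= (p - 1) * alpha by rewrite mulr_ge0 ?subr_ge0 ?(ltW p_gt1) ?(ltW alpha_gt0).
lra.
Qed.

Lemma hardy_tan_eps eps : 0 < eps -> 2 <= p ->
  (\int[sigma]_(x in S)
     (alpha `^ p * (`|lat x| `^ p * sin_powN p eps (lat x) * `|f x| `^ p))%:E <=
   \int[sigma]_(x in S) (alpha `^ (p - 1) * ((p - 1) * (`|lat x| `^ (p - 2) *
      ((1 - lat x ^+ 2) * sin_powN p eps (lat x))) * `|f x| `^ p) + N x `^ p)%:E)%E.
Proof.
move=> e0 p2.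
have p2' : 0 <= p - 2 by rewrite subr_ge0.
have p1 : 1 <= p - 1 by lra.
have p1' : 0 <= p - 1 by lra.
(* For the exponents [(1, 0)] one has r = p - 1, which is at least 1 as [2 <= p]. Again [K_le] is an
   equality, the terms in c^p cancelling. *)
pose K (c : R) := (p - 1) * (c `^ (p - 2) * ((1 - c ^+ 2) * sin_powN p eps c)).
have rE : p - 1 = 1 * (p - 1) + 0 by rewrite mul1r addr0.
have mK : measurable_fun setT K.
  by apply: measurable_funM => //; apply: measurable_funM; [exact: measurable_powR|exact: msin2W].
have K1 c : 0 <= c <= 1 -> 0 <= K c <= (p - 1) * eps `^ (- (p / 2)).
  move=> cI; have /andP[h1 h2] := sin2_mul_bound e0 cI; have /andP[c0 c1] := cI.
  have k1 : c `^ (p - 2) <= 1.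
    have := @ge0_ler_powR R _ p2' c 1; rewrite !nnegrE powR1 => k1.
    exact: k1.
  rewrite /K; apply/andP; split.
    by apply: mulr_ge0 => //; apply: mulr_ge0 => //; exact: powR_ge0.
  by rewrite ler_wpM2l// (le_trans _ h2)// ler_piMl.
have H := @two_hemispheres eps 1 0 (p - 1) K ((p - 1) * eps `^ (- (p / 2))) e0 ler01 (lexx _)
  rE p1 mK K1.
set L := (X in (X <= _)%E); set U := (X in (_ <= X)%E).
set L' := (X in (X <= _)%E) in H; set U' := (X in (_ <= X)%E) in H.
suff [-> ->] : L = L' /\ U = U'; last first.
  split; apply: eq_integral => x _; first by rewrite mul1r.
  by rewrite /K latE sin_powN_abs mul0r powRr0 mul1r.
apply: H.
  move=> c /andP[c0 c1]; rewrite /K mul1r subrK (_ : p - 1 - 1 = p - 2); last by ring.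
  by rewrite le_eqVlt; apply/orP; left; apply/eqP; ring.
rewrite mul1r powR0 ?gt_eqF// mul0r mulr0; apply: mulr_ge0; first exact: powR_ge0.
by have /K1/andP[] : 0 <= (0 : R) <= 1 by rewrite lexx ler01.
Qed.

Let mdiv (G : E -> R) : measurable_fun setT G -> measurable_fun S (EFin \o G).
Proof. by move=> mG; apply/measurable_funTS/measurable_EFinP. Qed.

Lemma hardy_sin :
  (\int[sigma]_(x in S) (alpha `^ p * ((s x `^ p)^-1 * `|f x| `^ p))%:E <=
   \int[sigma]_(x in S) (alpha `^ (p - 1) * ((p * alpha + 1) *
      (s x `^ (p - 2))^-1 * `|f x| `^ p) + `|lat x| `^ p * N x `^ p)%:E)%E.
Proof.
have pa1 : 0 <= p * alpha + 1 by rewrite addr_ge0// ltW.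
set U := (X in (_ <= X)%E).
have := @integral_sin_limit (alpha `^ p) 0 U.
rewrite (eq_integral (fun x => (alpha `^ p * ((s x `^ p)^-1 * `|f x| `^ p))%:E)); last first.
  by move=> x _; rewrite powRr0 mul1r.
apply; last exact: powR_ge0.
move=> eps e0; rewrite (eq_integral (fun x => (alpha `^ p * (sin_powN p eps (lat x) * `|f x| `^ p))%:E)); last first.
  by move=> x _; rewrite powRr0 mul1r.
apply: (le_trans (hardy_sin_eps e0)); apply: ge0_le_integral.
- exact: mS.
- move=> x /latI /sin2 /andP[s0 _]; rewrite lee_fin; apply: addr_ge0; last by rewrite mulr_ge0 ?powR_ge0.
  apply: mulr_ge0; first exact: powR_ge0.
  by apply: mulr_ge0; last exact: powR_ge0; apply: mulr_ge0 => //; apply: mulr_ge0 => //; exact: powR_ge0.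
- apply: mdiv; apply: measurable_funD; last exact: measurable_funM.
  apply: measurable_funM => //; apply: measurable_funM => //; apply: measurable_funM => //.
  exact: (measurableT_comp (msin2W eps) mlat).
- apply: mdiv; apply: measurable_funD; last exact: measurable_funM.
  apply: measurable_funM => //; apply: measurable_funM => //; apply: measurable_funM => //.
  by apply: measurable_funV; exact: (measurableT_comp (measurable_powR (p - 2)) ms).
move=> x Sx; rewrite lee_fin lerD2r ler_wpM2l ?powR_ge0// ler_wpM2r ?powR_ge0// ler_wpM2l//.
by apply: sin_powN_le_sin => //; exact: latI.
Qed.

Lemma hardy_tan : 2 <= p ->
  (\int[sigma]_(x in S) (alpha `^ p * (`|lat x| `^ p * (s x `^ p)^-1 * `|f x| `^ p))%:E <=
   \int[sigma]_(x in S) (alpha `^ (p - 1) * ((p - 1) *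
      ((s x / `|lat x|) `^ (p - 2))^-1 * `|f x| `^ p) + N x `^ p)%:E)%E.
Proof.
move=> p2; have p1' : 0 <= p - 1 by lra.
set U := (X in (_ <= X)%E).
apply: (@integral_sin_limit (alpha `^ p) p U); last exact: powR_ge0.
move=> eps e0.
apply: (le_trans (hardy_tan_eps e0 p2)); apply: ge0_le_integral.
- exact: mS.
- move=> x /latI /sin2 /andP[s0 _]; rewrite lee_fin; apply: addr_ge0; last by rewrite powR_ge0.
  apply: mulr_ge0; first exact: powR_ge0.
  apply: mulr_ge0; last exact: powR_ge0; apply: mulr_ge0 => //.
  by apply: mulr_ge0; [exact: powR_ge0|apply: mulr_ge0 => //; exact: powR_ge0].
- apply: mdiv; apply: measurable_funD => //.
  apply: measurable_funM => //; apply: measurable_funM => //; apply: measurable_funM => //.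
  by apply: measurable_funM; [exact: mpow|exact: (measurableT_comp (msin2W eps) mlat)].
- apply: mdiv; apply: measurable_funD => //.
  apply: measurable_funM => //; apply: measurable_funM => //; apply: measurable_funM => //.
  apply: measurable_funV; apply: (measurableT_comp (measurable_powR (p - 2))).
  by apply: measurable_funM => //; exact: measurable_funV.
move=> x Sx; rewrite lee_fin lerD2r ler_wpM2l ?powR_ge0// ler_wpM2r ?powR_ge0// ler_wpM2l//.
have h := sin_powN_le_sin e0 (latI Sx).
apply: (le_trans (ler_wpM2l (powR_ge0 _ _) h)).
(* On the equator the quotient by [|lat x|] is 0 by default: both sides are 1 for [p = 2] and 0 for
   [p > 2]. *)
have [->|c0] := eqVneq (lat x) 0.
  rewrite expr0n/= subr0 sqrtr1 powR1 invr1 mulr1 normr0 invr0 mulr0.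
  have [->|q0] := eqVneq (p - 2) 0; first by rewrite powRr0 invr1.
  by rewrite powR0// invr0.
rewrite powRM ?sqrtr_ge0 ?invr_ge0//.
by rewrite powRV// invfM invrK mulrC lexx.
Qed.

(** Absorption at fixed [eps], where the left-hand integral is finite: by [sin_powN_split] only half
    of it reappears on the right, and the rest bounds it uniformly in [eps]. *)
Lemma hardy_finite : (\int[sigma]_(x in S) (N x `^ p)%:E < +oo)%E ->
  (\int[sigma]_(x in S) ((s x `^ p)^-1 * `|f x| `^ p)%:E < +oo)%E.
Proof.
move=> Noo; pose q := p * alpha + 1.
have q0 : 0 < q by rewrite addr_gt0.
(* Chosen so that alpha^(p-1) q d = alpha^p / 2. *)
pose d := alpha / (2 * q); have d0 : 0 < d by rewrite divr_gt0// mulr_gt0.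
pose C := alpha `^ (p - 1) * q * d `^ (- (p / 2)).
have C0 : 0 <= C by apply: mulr_ge0; [apply: mulr_ge0 (powR_ge0 _ _) (ltW q0)|exact: powR_ge0].
pose B := (\int[sigma]_(x in S) (C * `|f x| `^ p + N x `^ p)%:E)%E.
have mCf : measurable_fun setT (fun x => C * `|f x| `^ p) by exact: measurable_funM.
have Boo : (B < +oo)%E.
  rewrite /B; under eq_integral do rewrite EFinD.
  rewrite ge0_integralD; last 5 first.
  - exact: mS.
  - by move=> x _; rewrite lee_fin mulr_ge0// powR_ge0.
  - exact: (mdiv mCf).
  - by move=> x _; rewrite lee_fin powR_ge0.
  - exact: (mdiv mNp).
  apply: lte_add_pinfty; last exact: Noo.
  under eq_integral do rewrite EFinM.
  rewrite ge0_integralZl; first last.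
  - by rewrite lee_fin.
  - by move=> x _; rewrite lee_fin powR_ge0.
  - exact: (mdiv mfp).
  - exact: mS.
  by apply: lte_mul_pinfty; [rewrite lee_fin|exact: fin_numE|exact: f_Lp].
have B0 : (0 <= B)%E.
  by apply: integral_ge0 => x _; rewrite lee_fin addr_ge0 ?powR_ge0// mulr_ge0 ?powR_ge0.
have AB eps : 0 < eps ->
    (\int[sigma]_(x in S) (alpha `^ p * (sin_powN p eps (lat x) * `|f x| `^ p))%:E <= 2%:E * B)%E.
  move=> e0; set A := integral _ _ _.
  have iA : sigma.-integrable S (fun x => (alpha `^ p * (sin_powN p eps (lat x) * `|f x| `^ p))%:E).
    rewrite (_ : (fun x => _) = (fun x => (`|f x| `^ p * (alpha `^ p * sin_powN p eps (lat x)))%:E)); last first.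
      by apply/funext => x; congr EFin; ring.
    apply: (@integrable_bounded _ _ _ _ (alpha `^ p * eps `^ (- (p / 2)))).
    - exact: ifp.
    - by apply: measurable_funM.
    move=> x /latI /(sin_powN_bound e0)/andP[h1 h2].
    by rewrite ger0_norm ?mulr_ge0 ?powR_ge0// ler_wpM2l ?powR_ge0.
  have fA : A \is a fin_num := integrable_fin_num mS iA.
  have fB : B \is a fin_num by rewrite (ge0_fin_numE B0); exact: Boo.
  suff : (A <= (2^-1)%:E * A + B)%E.
    rewrite -(fineK fA) -(fineK fB) -!(EFinM, EFinD) !lee_fin; lra.
  apply: (le_trans (hardy_sin_eps e0)).
  rewrite /A -(integralZl mS iA) /B -ge0_integralD; first last.
  - by apply: mdiv; exact: measurable_funD.
  - by move=> x _; rewrite lee_fin addr_ge0 ?powR_ge0// mulr_ge0 ?powR_ge0.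
  - rewrite (_ : (fun x => _) = EFin \o (fun x => 2^-1 * (alpha `^ p * (sin_powN p eps (lat x) * `|f x| `^ p)))); last first.
      by apply/funext => x; rewrite /= EFinM.
    by apply: mdiv; apply: measurable_funM => //; apply: measurable_funM => //; exact: measurable_funM.
  - by move=> x _; rewrite -EFinM lee_fin mulr_ge0 ?mulr_ge0 ?powR_ge0.
  - exact: mS.
  apply: ge0_le_integral.
  - exact: mS.
  - move=> x /latI /sin2 /andP[s0 _]; rewrite lee_fin; apply: addr_ge0; last by rewrite mulr_ge0 ?powR_ge0.
    apply: mulr_ge0; first exact: powR_ge0.
    by apply: mulr_ge0; last exact: powR_ge0; apply: mulr_ge0 (ltW q0) _; apply: mulr_ge0 => //; exact: powR_ge0.
  - apply: mdiv; apply: measurable_funD; last exact: measurable_funM.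
    apply: measurable_funM => //; apply: measurable_funM => //; apply: measurable_funM => //.
    exact: (measurableT_comp (msin2W eps) mlat).
  - rewrite (_ : (fun x => _) = EFin \o (fun x => 2^-1 * (alpha `^ p * (sin_powN p eps (lat x) * `|f x| `^ p))
        + (C * `|f x| `^ p + N x `^ p))); last first.
      by apply/funext => x; rewrite /= EFinD EFinM.
    apply: mdiv; apply: measurable_funD; last exact: measurable_funD.
    by apply: measurable_funM => //; apply: measurable_funM => //; exact: measurable_funM.
  move=> x Sx; rewrite -EFinM -EFinD lee_fin addrA; apply: lerD; last first.
    rewrite ler_piMl ?powR_ge0//.
    by have := @ge0_ler_powR R p (ltW p_gt0) `|lat x| 1; rewrite !nnegrE powR1 normr_dot_sphere//; apply.
  have h := sin_powN_split e0 d0 (latI Sx).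
  have h2 := ler_wpM2l (mulr_ge0 (powR_ge0 alpha (p - 1)) (ltW q0)) h.
  have h3 := ler_wpM2r (powR_ge0 `|f x| p) h2.
  rewrite mulrA mulrA -/q; apply: (le_trans h3).
  rewrite le_eqVlt; apply/orP; left; apply/eqP; rewrite /C alp /d; field.
  by rewrite gt_eqF.
have H : (\int[sigma]_(x in S) (alpha `^ p * (`|lat x| `^ 0 * (s x `^ p)^-1 * `|f x| `^ p))%:E <= 2%:E * B)%E.
  apply: integral_sin_limit; last exact: powR_ge0.
  move=> eps e0; rewrite (eq_integral (fun x => (alpha `^ p * (sin_powN p eps (lat x) * `|f x| `^ p))%:E)); last first.
    by move=> x _; rewrite powRr0 mul1r.
  exact: AB.
have {}H : ((alpha `^ p)%:E * \int[sigma]_(x in S) ((s x `^ p)^-1 * `|f x| `^ p)%:E <= 2%:E * B)%E.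
  rewrite -ge0_integralZl; first last.
  - by rewrite lee_fin powR_ge0.
  - by move=> x _; rewrite lee_fin mulr_ge0 ?invr_ge0 ?powR_ge0.
  - apply: mdiv; apply: measurable_funM => //.
    by apply: measurable_funV; exact: (measurableT_comp (measurable_powR p) ms).
  - exact: mS.
  rewrite [X in (X <= _)%E](eq_integral (fun x => (alpha `^ p * (`|lat x| `^ 0 * (s x `^ p)^-1 * `|f x| `^ p))%:E))//.
  by move=> x _; rewrite powRr0 mul1r -EFinM.
have : (2%:E * B < +oo)%E by apply: lte_mul_pinfty; [rewrite lee_fin ler0n|exact: fin_numE|exact: Boo].
move=> /(le_lt_trans H).
case: (integral _ _ _) => [r| |]//; first by move=> _; exact: ltry.
by rewrite gt0_muley// lte_fin powR_gt0.
Qed.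

End poles.
End weighted_inequality.

(** * From the weighted inequalities to the theorem *)

Section tangential_part.
Context {R : realType} (n : nat).
Local Notation E := 'rV[R]_n.

Lemma enorm_tang (Phi x : E) : dot Phi Phi = 1 -> sphere n x ->
  enorm (tang Phi x) = Num.sqrt (1 - dot x Phi ^+ 2).
Proof.
move=> Phi1 /sphereE x1; congr Num.sqrt.
rewrite /tang dotDl !dotDr !dotNl !dotNr !dotZl !dotZr (dotC Phi x) Phi1 x1; ring.
Qed.

Lemma tang_part_le (Phi v x : E) : dot Phi Phi = 1 -> sphere n x ->
  `|dot v (tang Phi x)| <= Num.sqrt (1 - dot x Phi ^+ 2) * enorm v.
Proof. by move=> Phi1 Sx; rewrite -(enorm_tang Phi1 Sx) mulrC normr_dot_le. Qed.

End tangential_part.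

Lemma powR_div {R : realType} (x y p : R) : 0 <= y -> `|x / y| `^ p = (y `^ p)^-1 * `|x| `^ p.
Proof.
move=> y0; rewrite normrM normfV (ger0_norm y0) powRM ?invr_ge0//.
by rewrite powRV// mulrC.
Qed.

Lemma ge0_integralZD d (T : measurableType d) (R : realType)
    (mu : {measure set T -> \bar R}) (D : set T) (a : R) (F G : T -> R) :
  measurable D -> 0 <= a -> measurable_fun setT F -> measurable_fun setT G ->
  (forall x, 0 <= F x) -> (forall x, 0 <= G x) ->
  (\int[mu]_(x in D) (G x)%:E + a%:E * \int[mu]_(x in D) (F x)%:E =
   \int[mu]_(x in D) (a * F x + G x)%:E)%E.
Proof.
move=> mD a0 mF mG F0 G0.
have m (H : T -> R) : measurable_fun setT H -> measurable_fun D (EFin \o H).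
  by move=> mH; exact/measurable_funTS/measurable_EFinP.
rewrite -ge0_integralZl; first last.
- by rewrite lee_fin.
- by move=> x _; rewrite lee_fin.
- exact: m.
- exact: mD.
rewrite addeC -ge0_integralD; first last.
- exact: m.
- by move=> x _; rewrite lee_fin.
- by apply: (m (fun x => a * F x)); exact: measurable_funM.
- by move=> x _; rewrite -EFinM lee_fin mulr_ge0.
- exact: mD.
by [].
Qed.

Theorem theorem5 (R : realType) (n : nat) (p : R) (Phi : 'rV[R]_n)
    (u : 'rV[R]_n -> R)
    (n_ge4 : (4 <= n)%N) (p_gt1 : 1 < p) (p_lt : p < n%:R - 1)
    (Phi_sphere : sphere n Phi) (u_sobolev : sobolev p u) :
  let d := geodist Phi in
  let alpha := (n%:R - p - 1) / p in
  let sigma := @surface_measure R n in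
  let S := @sphere R n in
  [/\ sphere_Lp p (fun x => u x / sin (d x)),
      2 <= p -> sphere_Lp p (fun x => u x / `|tan (d x)|),
      ((alpha `^ p)%:E *
         \int[sigma]_(x in S) (`|u x| `^ p / sin (d x) `^ p)%:E <=
       \int[sigma]_(x in S)
         (enorm (sphere_grad u x) `^ p * `|cos (d x)| `^ p)%:E +
       ((n%:R - p) * alpha `^ (p - 1))%:E *
         \int[sigma]_(x in S) (`|u x| `^ p / sin (d x) `^ (p - 2))%:E)%E &
      2 <= p ->
      ((alpha `^ p)%:E *
         \int[sigma]_(x in S) (`|u x| `^ p / `|tan (d x)| `^ p)%:E <=
       \int[sigma]_(x in S) (enorm (sphere_grad u x) `^ p)%:E +
       ((p - 1) * alpha `^ (p - 1))%:E *
         \int[sigma]_(x in S) (`|u x| `^ p / `|tan (d x)| `^ (p - 2))%:E)%E].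
Proof.
move=> d alpha sigma S.
have p_gt0 : 0 < p by exact: lt_trans p_gt1.
have n0 : (0 < n)%N by exact: leq_trans n_ge4.
have Phi1 : dot Phi Phi = 1 by exact/sphereE.
have Phi1' : dot (- Phi) (- Phi) = 1 by rewrite dotNl dotNr opprK.
have alpha_gt0 : 0 < alpha by rewrite divr_gt0//; lra.
have alphaE : p * alpha = n.-1%:R - p.
  rewrite /alpha mulrCA mulfV ?gt_eqF// mulr1 -[in n%:R](prednK n0) -natr1; ring.
have palphaE : n%:R - p = p * alpha + 1.
  by rewrite alphaE -[in n%:R](prednK n0) -natr1; ring.
have mS : measurable S by exact: measurable_sphere.
case: u_sobolev => Lu exPsi Lgrad.
set Psi := sphere_grad u in Lgrad *.
(* [sphere_grad] is a choice, and it is a weak gradient because one exists. *)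
have gradP : is_sphere_grad u Psi by exact: getPex exPsi.
have [mf u_oo] := (sphere_LpP u p_gt0).1 Lu.
have [mN N_oo] := (sphere_LpP _ p_gt0).1 Lgrad.
pose f := u \_ S; pose N := (fun x => enorm (Psi x)) \_ S.
have fE x : S x -> f x = u x by move=> Sx; rewrite /f patchE mem_set.
have NE x : S x -> N x = enorm (Psi x) by move=> Sx; rewrite /N patchE mem_set.
have N0 x : 0 <= N x by rewrite /N patchE; case: ifP => // _; exact: enorm_ge0.
have f_oo : (\int[sigma]_(x in S) (`|f x| `^ p)%:E < +oo)%E.
  rewrite (eq_integral (fun x => (`|u x| `^ p)%:E)); first exact: u_oo.
  by move=> x /[!inE] Sx; rewrite fE.
have {}N_oo : (\int[sigma]_(x in S) (N x `^ p)%:E < +oo)%E.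
  rewrite (eq_integral (fun x => (`|enorm (Psi x)| `^ p)%:E)); first exact: N_oo.
  move=> x /[!inE] Sx.
  by rewrite NE// ger0_norm// enorm_ge0.
have fg := lie_pair_sobolev n0 Phi1 gradP.
have fg' := lie_pair_sobolev n0 Phi1' gradP.
have gN x : S x -> `|((fun x => dot (Psi x) (tang Phi x)) \_ S) x| <=
    Num.sqrt (1 - dot x Phi ^+ 2) * N x.
  by move=> Sx; rewrite patchE mem_set// NE// tang_part_le.
have gN' x : S x -> `|((fun x => dot (Psi x) (tang (- Phi) x)) \_ S) x| <=
    Num.sqrt (1 - dot x Phi ^+ 2) * N x.
  by move=> Sx; rewrite patchE mem_set// NE// -[X in X ^+ 2]opprK sqrrN -dotNr tang_part_le.
have fin := hardy_finite n0 p_gt1 alpha_gt0 alphaE f_oo mf mN N0 Phi1 fg fg' gN gN' N_oo.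
have Hsin := hardy_sin n0 p_gt1 alpha_gt0 alphaE f_oo mf mN N0 Phi1 fg fg' gN gN'.
have Htan := hardy_tan n0 p_gt1 alpha_gt0 alphaE f_oo mf mN N0 Phi1 fg fg' gN gN'.
have latI x : S x -> -1 <= dot x Phi <= 1.
  by move=> Sx; rewrite -ler_norml normr_dot_sphere.
have cosE x : S x -> cos (d x) = dot x Phi.
  by move=> /latI cI; rewrite /d /geodist acosK.
have sinE x : S x -> sin (d x) = Num.sqrt (1 - dot x Phi ^+ 2).
  by move=> /latI cI; rewrite /d /geodist sin_acos.
pose s x := Num.sqrt (1 - dot x Phi ^+ 2).
have s0 x : 0 <= s x by exact: sqrtr_ge0.
have tanE x : S x -> `|tan (d x)| = s x / `|dot x Phi|.
  by move=> Sx; rewrite /tan sinE// cosE// normrM normfV ger0_norm ?sqrtr_ge0.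
have tan_powR x : ((s x / `|dot x Phi|) `^ p)^-1 = `|dot x Phi| `^ p * (s x `^ p)^-1.
  by rewrite powRM ?invr_ge0// powRV// invfM invrK mulrC.
have ms : measurable_fun setT s by exact: measurable_sin_lat.
have ml : measurable_fun setT (fun x => `|dot x Phi|).
  by apply: measurableT_comp => //; exact: measurable_dot.
have mpow k (h : 'rV[R]_n -> R) : measurable_fun setT h -> measurable_fun setT (fun x => h x `^ k).
  by move=> mh; exact: (measurableT_comp (measurable_powR k) mh).
have mfp : measurable_fun setT (fun x => `|f x| `^ p) by apply: mpow; exact: measurableT_comp.
have mt : measurable_fun setT (fun x => s x / `|dot x Phi|).
  by apply: measurable_funM => //; exact: measurable_funV.
split.
- apply/(sphere_LpP _ p_gt0); split.
    rewrite (_ : _ \_ S = (fun x => f x * (s x)^-1)).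
      by apply: measurable_funM => //; exact: measurable_funV.
    apply/funext => x; rewrite /f !patchE; case: ifPn => [|_]; last by rewrite mul0r.
    by rewrite inE => Sx; rewrite sinE.
  rewrite (eq_integral (fun x => ((s x `^ p)^-1 * `|f x| `^ p)%:E)); first exact: fin.
  by move=> x /[!inE] Sx; rewrite sinE// powR_div// fE.
- move=> p2; apply/(sphere_LpP _ p_gt0); split.
    rewrite (_ : _ \_ S = (fun x => f x * (s x / `|dot x Phi|)^-1)).
      by apply: measurable_funM => //; exact: measurable_funV.
    apply/funext => x; rewrite /f !patchE; case: ifPn => [|_]; last by rewrite mul0r.
    by rewrite inE => Sx; rewrite tanE.
  rewrite (eq_integral (fun x => (`|dot x Phi| `^ p * (s x `^ p)^-1 * `|f x| `^ p)%:E)); last first.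
    move=> x /[!inE] Sx; rewrite tanE// powR_div; last by rewrite divr_ge0.
    by rewrite tan_powR fE.
  (* As |cos d| <= 1, the integrand for the tangent is at most that for the sine. *)
  apply: le_lt_trans fin; apply: ge0_le_integral.
  + exact: mS.
  + by move=> x _; rewrite lee_fin !mulr_ge0 ?invr_ge0 ?powR_ge0.
  + apply/measurable_funTS/measurable_EFinP/measurable_funM; last exact: mfp.
    by apply: measurable_funM; [exact: mpow|apply: measurable_funV; exact: mpow].
  + apply/measurable_funTS/measurable_EFinP/measurable_funM; last exact: mfp.
    by apply: measurable_funV; exact: mpow.
  move=> x Sx; rewrite lee_fin ler_wpM2r ?powR_ge0// ler_piMl ?invr_ge0 ?powR_ge0//.
  by have := @ge0_ler_powR R p (ltW p_gt0) `|dot x Phi| 1; rewrite !nnegrE powR1 normr_dot_sphere//; apply.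
- rewrite (eq_integral (fun x => ((s x `^ p)^-1 * `|f x| `^ p)%:E)); last first.
    by move=> x /[!inE] Sx; rewrite sinE// fE// mulrC.
  rewrite [X in (_ <= X + _)%E](eq_integral (fun x => (`|dot x Phi| `^ p * N x `^ p)%:E)); last first.
    by move=> x /[!inE] Sx; rewrite cosE// NE// mulrC.
  rewrite [X in (_ <= _ + _ * X)%E](eq_integral (fun x => ((s x `^ (p - 2))^-1 * `|f x| `^ p)%:E)); last first.
    by move=> x /[!inE] Sx; rewrite sinE// fE// mulrC.
  rewrite ge0_integralZD; first last.
  + by move=> x; rewrite mulr_ge0 ?powR_ge0.
  + by move=> x; rewrite mulr_ge0 ?invr_ge0 ?powR_ge0.
  + by apply: measurable_funM; exact: mpow.
  + by apply: measurable_funM; last exact: mfp; apply: measurable_funV; exact: mpow.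
  + by rewrite mulr_ge0 ?powR_ge0//; lra.
  + exact: mS.
  rewrite -ge0_integralZl; first last.
  + by rewrite lee_fin powR_ge0.
  + by move=> x _; rewrite lee_fin mulr_ge0 ?invr_ge0 ?powR_ge0.
  + apply/measurable_funTS/measurable_EFinP/measurable_funM; last exact: mfp.
    by apply: measurable_funV; exact: mpow.
  + exact: mS.
  set U := (X in (_ <= X)%E); set U' := (X in (_ <= X)%E) in Hsin.
  suff -> : U = U' by exact: Hsin.
  apply: eq_integral => x _; congr EFin; rewrite palphaE; ring.
- move=> p2; have {}Htan := Htan p2.
  rewrite (eq_integral (fun x => (`|dot x Phi| `^ p * (s x `^ p)^-1 * `|f x| `^ p)%:E)); last first.
    by move=> x /[!inE] Sx; rewrite tanE// fE// -tan_powR mulrC.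
  rewrite [X in (_ <= X + _)%E](eq_integral (fun x => (N x `^ p)%:E)); last first.
    by move=> x /[!inE] Sx; rewrite NE.
  rewrite [X in (_ <= _ + _ * X)%E](eq_integral (fun x =>
      (((s x / `|dot x Phi|) `^ (p - 2))^-1 * `|f x| `^ p)%:E)); last first.
    by move=> x /[!inE] Sx; rewrite tanE// fE// mulrC.
  rewrite ge0_integralZD; first last.
  + by move=> x; rewrite powR_ge0.
  + by move=> x; rewrite mulr_ge0 ?invr_ge0 ?powR_ge0.
  + exact: mpow.
  + by apply: measurable_funM; last exact: mfp; apply: measurable_funV; exact: mpow.
  + by rewrite mulr_ge0 ?powR_ge0//; lra.
  + exact: mS.
  rewrite -ge0_integralZl; first last.
  + by rewrite lee_fin powR_ge0.
  + by move=> x _; rewrite lee_fin !mulr_ge0 ?invr_ge0 ?powR_ge0.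
  + apply/measurable_funTS/measurable_EFinP/measurable_funM; last exact: mfp.
    by apply: measurable_funM; [exact: mpow|apply: measurable_funV; exact: mpow].
  + exact: mS.
  set U := (X in (_ <= X)%E); set U' := (X in (_ <= X)%E) in Htan.
  suff -> : U = U' by exact: Htan.
  by apply: eq_integral => x _; congr EFin; ring.
Qed.
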